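(* Let $0\in M=\{r=0\}\subset\mathbb{C}^{n+1}$ be a real hypersurface with $$r(z)=2\,\mathrm{Re}(z_{n+1})+\sum_{j=1}^{N}|f_j(z_1,\dots,z_{n+1})|^2,$$ where $f_1,\dots,f_N$ are holomorphic functions on a neighborhood of the origin, and assume that the D'Angelo 1-type of $M$ at the origin is finite. Then the Catlin multitype at the origin is an invariant of the ideal of holomorphic functions defining the domain; that is, if $g_1,\dots,g_S$ are holomorphic functions near the origin such that $\langle g_1,\dots,g_S\rangle=\langle f_1,\dots,f_N\rangle$ as ideals in the ring $\mathcal{O}$ of germs of holomorphic functions at the origin, then the hypersurface $M'=\{2\,\mathrm{Re}(z_{n+1})+\sum_{j=1}^{S}|g_j|^2=0\}$ has the same multitype at the origin as $M$.
   Context: The D'Angelo 1-type of $M=\{r=0\}$ at $0$ is $\Delta_1(M,0)=\sup_\varphi \mathrm{ord}_0(r\circ\varphi)/\mathrm{ord}_0(\varphi)$ over nonconstant germs of holomorphic curves $\varphi:(\mathbb{C},0)\to(\mathbb{C}^{n+1},0)$. Weights and multitype. A weight is an $n$-tuple $\Lambda=(\mu_1,\dots,\mu_n)$ of rationals, $0\le\mu_j\le\frac12$, $\mu_j\ge\mu_{j+1}$, such that for each $t$ either $\mu_t=0$ or there are nonnegative integers $a_1,\dots,a_t$, $a_t>0$, with $\sum_{j\le t}a_j\mu_j=1$. Weights are ordered lexicographically. In local holomorphic coordinates $(z,w)$, $z=(z_1,\dots,z_n)$, $w=u+iv$, the monomial $z^\alpha\bar z^{\hat\alpha}u^l$ has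 weighted degree $l+\sum_{j=1}^n(\alpha_j+\hat\alpha_j)\mu_j$; a polynomial is $\Lambda$-homogeneous of weighted degree $\kappa$ if it is a sum of monomials of weighted degree $\kappa$; weighted orders of derivatives are defined in the same way. $\Lambda$ is distinguished for $M$ at $0$ if there are local holomorphic coordinates $(z,w)$ centered at $0$ in which $M$ is $v=P(z,\bar z)+o_\Lambda(1)$, where $P$ is $\Lambda$-homogeneous of weighted degree $1$ without pluriharmonic terms and $o_\Lambda(1)$ is a smooth function whose derivatives of weighted order $\le1$ vanish at $0$. Let $\Lambda^*=(\mu_1,\dots,\mu_n)$ be the greatest lower bound (lexicographically) of all distinguished weights at $0$. The (Catlin) multitype at $0$ is $(m_1,\dots,m_n)$ with $m_j=1/\mu_j$ if $\mu_j\neq0$ and $m_j=\infty$ if $\mu_j=0$. *)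

(* Defs.v *)
(* The complex field is C = R[i] for R : realType.                            *)
(* Cspace R m = C^m is normed over C, so `differentiable` on it means         *)
(* C-differentiable.  The last coordinate (index ord_max) of C^(n+1) plays    *)
(* the role of z_{n+1}, or of w in coordinates (z, w).                        *)
From HB Require Import structures.
From mathcomp Require Import all_boot all_order all_algebra.
From mathcomp Require Import all_classical all_reals all_analysis.
From mathcomp Require Import complex.
From mathcomp Require mpoly.
(* The notations of mpoly clash with those of analysis. *)
Import -(notations) mpoly.

Set Implicit Arguments.
Unset Strict Implicit.
Unset Printing Implicit Defensive.

Import Order.TTheory GRing.Theory Num.Theory numFieldNormedType.Exports.
Local Open Scope classical_set_scope.
Local Open Scope complex_scope.
Local Open Scope ring_scope.

Definition Cspace (R : realType) (m : nat) : normedModType R[i] := 'rV[R[i]]_m.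

Definition iterD (K : numFieldType) (V W : normedModType K)
    (vs : seq V) (f : V -> W) : V -> W :=
  foldr (fun (v : V) (h : V -> W) => fun x => 'D_v h x) f vs.

(* Differentiability of all iterated directional derivatives on one fixed     *)
(* neighbourhood is smoothness (C^oo) there.                                  *)
Definition smooth_near (K : numFieldType) (V W : normedModType K)
    (f : V -> W) (a : V) : Prop :=
  \forall x \near a, forall vs : seq V, differentiable (iterD vs f) x.

(* The least order of a nonvanishing derivative at a, +oo if there is none;   *)
(* used with K = R for r \o phi and with K = C for the curve phi.             *)
Definition vanishing_order (R : realType) (K : numFieldType)
    (V W : normedModType K) (f : V -> W) (a : V) : \bar R :=
  ereal_inf [set ((size vs)%:R)%:E | vs in [set vs : seq V | iterD vs f a != 0]].

Definition holomorphic0 (R : realType) (V W : normedModType R[i])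
    (f : V -> W) : Prop :=
  \forall z \near (0 : V), differentiable f z.

Section Hypersurface.
Variables (R : realType) (n N : nat).
Implicit Type f : 'I_N -> Cspace R n.+1 -> R[i]^o.

Definition defining_function f (z : Cspace R n.+1) : R :=
  2 * complex.Re (z 0 ord_max) + \sum_(j < N) Normc.normc (f j z) ^+ 2.

Definition hypersurface f : set (Cspace R n.+1) :=
  [set z | defining_function f z = 0].

(* Functions whose germ at 0 lies in the ideal <f_1, ..., f_N> of the ring of *)
(* germs of holomorphic functions.  The set is stable under equality near 0,  *)
(* so two ideals of germs are equal iff the corresponding sets are.           *)
Definition germ_ideal f : set (Cspace R n.+1 -> R[i]^o) :=
  [set h | exists a : 'I_N -> Cspace R n.+1 -> R[i]^o,
     (forall j, holomorphic0 (a j)) /\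
     \forall z \near (0 : Cspace R n.+1), h z = \sum_(j < N) a j z * f j z].

End Hypersurface.

Section DAngeloType.
Variables (R : realType) (m : nat).

Definition curve_germ (phi : R[i]^o -> Cspace R m) : Prop :=
  [/\ holomorphic0 phi, phi 0 = 0 &
      ~ (\forall t \near (0 : R[i]^o), phi t = 0)].

Definition pullback (r : Cspace R m -> R) (phi : R[i]^o -> Cspace R m)
    (p : R^o * R^o) : R^o :=
  r (phi (p.1 +i* p.2)).

Definition dangelo_type (r : Cspace R m -> R) : \bar R :=
  ereal_sup
    [set (vanishing_order R (pullback r phi) 0%R / vanishing_order R phi 0%R)%E
    | phi in curve_germ].

End DAngeloType.

Section Weights.
Variable n : nat.
Implicit Type L : n.-tuplelexi rat.

Definition is_weight L : Prop :=
  [/\ forall j, 0 <= tnth L j <= 2^-1,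
      forall i j : 'I_n, (i <= j)%N -> tnth L j <= tnth L i &
      forall t : 'I_n, tnth L t = 0 \/
        exists a : 'I_n -> nat, (0 < a t)%N /\
          \sum_(j < n | (j <= t)%N) (a j)%:R * tnth L j = 1].

Definition multitype_of_weight L : n.-tuple (\bar rat) :=
  [tuple if tnth L j == 0 then +oo%E else ((tnth L j)^-1)%:E | j < n].

End Weights.

Section Multitype.
Variables (R : realType) (n : nat).

Definition z_part (q : Cspace R n.+1) : Cspace R n :=
  \row_j q 0 (widen_ord (leqnSn n) j).

(* Points (x, y, u) of R^n x R^n x R, standing for (z, u) with z = x + i y.   *)
Definition zu_space : normedModType R := ('rV[R]_n * 'rV[R]_n * R^o)%type.

Definition zu_point (p : Cspace R n.+1) : zu_space :=
  (\row_j complex.Re (z_part p 0 j), \row_j complex.Im (z_part p 0 j),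
   complex.Re (p 0 ord_max)).

Variant zu_variable := Var_z of 'I_n | Var_zbar of 'I_n | Var_u.

Definition weight_of_variable (L : n.-tuplelexi rat) (a : zu_variable) : rat :=
  match a with
  | Var_z j | Var_zbar j => tnth L j
  | Var_u => 1
  end.

Definition real_derivative (v : zu_space) (F : zu_space -> R[i])
    (p : zu_space) : R[i] :=
  ('D_v (fun q => complex.Re (F q) : R^o) p) +i*
  ('D_v (fun q => complex.Im (F q) : R^o) p).

(* d/dz_j = (d/dx_j - i d/dy_j) / 2 and d/dzbar_j = (d/dx_j + i d/dy_j) / 2.  *)
Definition wirtinger (a : zu_variable) (F : zu_space -> R[i])
    (p : zu_space) : R[i] :=
  match a with
  | Var_z j => 2^-1 * (real_derivative (delta_mx 0 j, 0, 0) F p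
                       - 'i%C * real_derivative (0, delta_mx 0 j, 0) F p)
  | Var_zbar j => 2^-1 * (real_derivative (delta_mx 0 j, 0, 0) F p
                          + 'i%C * real_derivative (0, delta_mx 0 j, 0) F p)
  | Var_u => real_derivative (0, 0, 1) F p
  end.

Definition o_weighted (L : n.-tuplelexi rat) (h : zu_space -> R^o) : Prop :=
  smooth_near h 0 /\
  forall s : seq zu_variable,
    \sum_(a <- s) weight_of_variable L a <= 1 ->
    foldr wirtinger (fun p => (h p)%:C) s 0 = 0.

(* Polynomials in (z, zbar): the first n variables stand for z_1, ..., z_n    *)
(* and the last n for their conjugates.                                       *)
Definition zzbar_poly := mpoly (n + n) R[i].

Definition eval_zzbar (P : zzbar_poly) (z : Cspace R n) : R[i] :=
  meval (fun i => match fintype.split i with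
                  | inl j => z 0 j
                  | inr j => Num.conj (z 0 j)
                  end) P.

Definition exp_z (m : multinom (n + n)) (j : 'I_n) : nat := m (lshift n j).
Definition exp_zbar (m : multinom (n + n)) (j : 'I_n) : nat := m (rshift n j).

Definition weighted_homogeneous (L : n.-tuplelexi rat) (kappa : rat)
    (P : zzbar_poly) : Prop :=
  forall m, m \in msupp P ->
    \sum_(j < n) (exp_z m j + exp_zbar m j)%:R * tnth L j = kappa.

(* The pluriharmonic monomials are those in z only or in zbar only.           *)
Definition no_pluriharmonic_terms (P : zzbar_poly) : Prop :=
  forall m, m \in msupp P ->
    (exists j, exp_z m j != 0%N) /\ (exists j, exp_zbar m j != 0%N).

Definition local_coordinates
    (Phi : Cspace R n.+1 -> Cspace R n.+1) : Prop :=
  [/\ holomorphic0 Phi, Phi 0 = 0 &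
      exists Psi : Cspace R n.+1 -> Cspace R n.+1,
        [/\ holomorphic0 Psi, Psi 0 = 0,
            \forall p \near (0 : Cspace R n.+1), Psi (Phi p) = p &
            \forall q \near (0 : Cspace R n.+1), Phi (Psi q) = q]].

Definition distinguished (M : set (Cspace R n.+1)) : set (n.-tuplelexi rat) :=
  [set L | is_weight L /\
     exists (Phi : Cspace R n.+1 -> Cspace R n.+1)
            (P : zzbar_poly) (h : zu_space -> R^o),
       [/\ local_coordinates Phi,
           weighted_homogeneous L 1 P /\ no_pluriharmonic_terms P,
           forall z, eval_zzbar P z \is Num.real,
           o_weighted L h &
           \forall p \near (0 : Cspace R n.+1), M p <->
             complex.Im (Phi p 0 ord_max) =
             complex.Re (eval_zzbar P (z_part (Phi p))) + h (zu_point (Phi p))]].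

(* The greatest lower bound is taken among weights, for the lexicographic     *)
(* order, which is the order of n.-tuplelexi rat.                             *)
Definition is_glb_weight (A : set (n.-tuplelexi rat)) (L : n.-tuplelexi rat) :
    Prop :=
  [/\ is_weight L, lbound A L &
      forall L', is_weight L' -> lbound A L' -> (L' <= L)%O].

Definition is_multitype (M : set (Cspace R n.+1)) (m : n.-tuple (\bar rat)) :
    Prop :=
  exists L, is_glb_weight (distinguished M) L /\ m = multitype_of_weight L.

Lemma is_multitype_unique M m m' :
  is_multitype M m -> is_multitype M m' -> m = m'.
Proof.
move=> [L [[wL lL gL] ->]] [L' [[wL' lL' gL'] ->]].
by congr multitype_of_weight; apply/le_anti; rewrite gL'// gL.
Qed.

End Multitype.

(* Main.v *)
(* In coordinates with inverse Psi put Z = 2 (z_{n+1} o Psi) and               *)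
(* F_j = f_j o Psi, so that M becomes Re Z + sum |F_j|^2 = 0.  If this is      *)
(* v = P + o(1) with respect to the weight L, then differentiating the         *)
(* identity along the graph gives, for multi-indices alpha in the z variables: *)
(* d^alpha F_j (0) = 0 when |alpha|_L < 1/2, d^alpha Z (0) = 0 when            *)
(* |alpha|_L <= 1, and d Z / d w (0) is a nonzero imaginary number.  By the    *)
(* Leibniz rule these conditions depend only on the ideal of the f_j and on    *)
(* Z.  If some weight L_i is 0, they make the curve Psi (t e_i) tangent to M   *)
(* to infinite order, which finite type excludes.  If all the weights are      *)
(* positive, the conditions conversely bring the hypersurface to the form      *)
(* v = P + o(1) in the same coordinates: solve for v by the implicit function  *)
(* theorem, and take for P the part of weight 1 of the Taylor expansion.       *)
(* Hence f and g have the same distinguished weights.  A greatest lower bound  *)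
(* exists because an entry of a weight takes, above any positive number,       *)
(* finitely many values once the previous entries are fixed.                   *)
Require Import Defs.
From HB Require Import structures.
From mathcomp Require Import all_boot all_order all_algebra.
From mathcomp Require Import all_classical all_reals all_analysis.
From mathcomp Require Import complex ring lra.
From mathcomp Require mpoly.
(* The notations of mpoly clash with those of analysis. *)
Import -(notations) mpoly.

Set Implicit Arguments.
Unset Strict Implicit.
Unset Printing Implicit Defensive.

Import Order.TTheory GRing.Theory Num.Theory numFieldNormedType.Exports.
Local Open Scope classical_set_scope.
Local Open Scope complex_scope.
Local Open Scope ring_scope.


(** * Goursat's theorem on rectangles *)

(** For a fixed chart, being in normal form of weight L is equivalent, once all entries of L are
    positive, to the condition [adapted], which only speaks of derivatives at 0 of the holomorphic
    functions Z and F_j. The functions f_j enter it only by the vanishing of their derivatives of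
    weight below 1/2 in the chart. By the Leibniz rule the functions with this property form an
    ideal, so the condition passes from one system of generators to another ([adapted_ideal]).

    A normal form is adapted ([normal_form_adapted]) because sums of squares cannot cancel.
    Differentiate Re Z + sum |F_j|^2 = 0 along the graph by a word in the z followed by its
    conjugate. When the total weight is below 1 the graph is flat to that order, the mixed
    derivative of Re Z vanishes, and sum |d^alpha F_j(0)|^2 = 0 remains. Pure words give the
    conditions on Z.

    Conversely ([adapted_distinguished]), [hypersurface_graph] solves the equation for v. The same
    expansion, now read as a recursion on the length of words, shows that the graphing function has
    no jets of weight below 1 and no pure jets of weight 1 ([graph_jets]). Its part of weight 1 is
    then an admissible P ([weighted_taylor]), a polynomial because all weights are positive.
    Positivity comes from finite type ([adapted_weight_gt0]): a zero weight would give a smooth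
    holomorphic curve along which the defining function vanishes to infinite order.

    Thus both hypersurfaces have the same distinguished weights ([distinguished_transfer]), and the
    greatest lower bound of these exists by [exists_glb_weight].

    Holomorphic means complex differentiable near 0, so derivatives of all orders have to be earned:
    [goursat] gives [cauchy_estimate], and this gives [holomorphic_diff], that a directional
    derivative of a holomorphic function is holomorphic. Smoothness of real functions is proved by
    exhibiting a class closed under differentiation ([smooth_coinduction]), and [clairaut] makes
    Wirtinger derivatives commute. *)

Section SegmentIntegral.
Variable R : realType.
Implicit Types (k : R -> R) (a b c : R).
Local Notation mu := (@lebesgue_measure R).

Definition segint k a b : R := \int[mu]_(x in `[a, b]) k x.

Definition continuous_on k a b := forall x, a <= x <= b -> {for x, continuous k}.

Lemma continuous_on_sub k a b a' b' : a <= a' -> b' <= b ->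
  continuous_on k a b -> continuous_on k a' b'.
Proof.
move=> aa bb ck x /andP[ax xb]; apply: ck.
by rewrite (le_trans aa ax) (le_trans xb bb).
Qed.

Lemma continuous_onB k1 k2 a b : continuous_on k1 a b -> continuous_on k2 a b ->
  continuous_on (fun x => k1 x - k2 x) a b.
Proof. by move=> c1 c2 x ab; apply: cvgB; [exact: c1|exact: c2]. Qed.

Lemma continuous_on_integrable k a b : continuous_on k a b ->
  mu.-integrable `[a, b] (EFin \o k).
Proof.
move=> ck; apply: continuous_compact_integrable; first exact: segment_compact.
apply: continuous_in_subspaceT => x; rewrite inE /= in_itv /=.
exact: ck.
Qed.

Lemma segint_cst r a b : a <= b -> segint (fun=> r) a b = r * (b - a).
Proof.
move=> ab; rewrite /segint Rintegral_cst//= lebesgue_measure_itv/= lte_fin.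
by case: ltgtP ab => //= -> _; rewrite subrr.
Qed.

Lemma segintB k1 k2 a b : continuous_on k1 a b -> continuous_on k2 a b ->
  segint (fun x => k1 x - k2 x) a b = segint k1 a b - segint k2 a b.
Proof. by move=> c1 c2; rewrite /segint RintegralB//; exact: continuous_on_integrable. Qed.

Lemma segint_cat k a b c : a <= b -> b <= c -> continuous_on k a c ->
  segint k a c = segint k a b + segint k b c.
Proof.
move=> ab bc ck; apply/eqP; rewrite addrC -subr_eq; apply/eqP.
rewrite /segint Rintegral_itvB//; last exact: continuous_on_integrable.
apply: Rintegral_itv_obnd_cbnd; apply: (integrableS _ _ _ (continuous_on_integrable ck)) => //.
by move=> x /=; rewrite !in_itv/= => /andP[bx ->]; rewrite (le_trans ab (ltW bx)).
Qed.

Lemma segint_le k1 k2 a b : continuous_on k1 a b -> continuous_on k2 a b ->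
  (forall x, a <= x <= b -> k1 x <= k2 x) -> segint k1 a b <= segint k2 a b.
Proof. by move=> c1 c2 le12; apply: le_Rintegral => //; exact: continuous_on_integrable. Qed.

Lemma segint_near k r e a b : a <= b -> continuous_on k a b ->
  (forall x, a <= x <= b -> `|k x - r| <= e) ->
  `|segint k a b - r * (b - a)| <= e * (b - a).
Proof.
move=> ab ck H.
have cc s : continuous_on (fun=> s) a b by move=> x _; exact: cst_continuous.
have lo : segint (fun=> r - e) a b <= segint k a b.
  by apply: segint_le => // x /H; rewrite ler_norml => /andP[+ _]; lra.
have hi : segint k a b <= segint (fun=> r + e) a b.
  by apply: segint_le => // x /H; rewrite ler_norml => /andP[_]; lra.
rewrite !segint_cst// in lo hi.
by rewrite ler_norml; apply/andP; split; lra.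
Qed.

End SegmentIntegral.

Section Goursat.
Variable R : realType.
Implicit Types (p q : R -> R -> R) (a b c d x y : R).

(* The 1-form p dx + q dy is differentiable at (x, y) and its differential    *)
(* vanishes there.                                                            *)
Definition closed_form_at p q x y := exists A B C : R, forall e, 0 < e ->
  exists2 r, 0 < r & forall h k, `|h| < r -> `|k| < r ->
    `|p (x + h) (y + k) - p x y - (A * h + B * k)| <= e * (`|h| + `|k|) /\
    `|q (x + h) (y + k) - q x y - (B * h + C * k)| <= e * (`|h| + `|k|).

(** The integral of p dx + q dy along the boundary of [a, b] x [c, d], counterclockwise. *)
Definition rectint p q a b c d :=
  segint (p ^~ c) a b - segint (p ^~ d) a b
  + (segint (q b) c d - segint (q a) c d).

Lemma lin2_cvg0 (k : R -> R) (A : R) x :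
  (forall e, 0 < e -> exists2 r, 0 < r & forall h, `|h| < r ->
     `|k (x + h) - k x - A * h| <= e * `|h|) -> {for x, continuous k}.
Proof.
move=> H; apply/cvgrPdist_le => e e0.
have [r r0 Hr] := H 1 ltr01.
pose s := Num.min r (e / (`|A| + 1)).
have A1 : 0 < `|A| + 1 by rewrite ltr_wpDl.
have s0 : 0 < s by rewrite lt_min r0 divr_gt0.
near=> z.
have zs : `|z - x| < s by rewrite distrC; near: z; apply: cvgr_dist_lt s0; exact: cvg_id.
have := Hr (z - x); rewrite addrCA subrr addr0 mul1r => Hz.
have {}Hz : `|k z - k x - A * (z - x)| <= `|z - x|.
  by apply/Hz/(lt_le_trans zs); rewrite ge_min lexx.
rewrite distrC.
have -> : k z - k x = (k z - k x - A * (z - x)) + A * (z - x) by ring.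
apply: le_trans (ler_normD _ _) _; rewrite normrM.
apply: (@le_trans _ _ ((`|A| + 1) * `|z - x|)); first by rewrite mulrDl mul1r addrC lerD2l.
rewrite mulrC -ler_pdivlMr//; apply/ltW/(lt_le_trans zs).
by rewrite ge_min lexx orbT.
Unshelve. all: by end_near. Qed.

Lemma closed_form_contx p q x y : closed_form_at p q x y ->
  {for x, continuous (p ^~ y)} /\ {for y, continuous (q x)}.
Proof.
move=> [A [B [C H]]]; split.
  apply: (@lin2_cvg0 _ A) => e /H[r r0 Hr]; exists r => // h hr.
  have [] := Hr h 0 hr; first by rewrite normr0.
  by rewrite normr0 !addr0 mulr0 addr0.
apply: (@lin2_cvg0 _ C) => e /H[r r0 Hr]; exists r => // h hr.
have [|_] := Hr 0 h _ hr; first by rewrite normr0.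
by rewrite normr0 !addr0 mulr0 !add0r.
Qed.

Definition closed_form_on p q a b c d :=
  forall x y, a <= x <= b -> c <= y <= d -> closed_form_at p q x y.

Lemma closed_form_on_sub p q a b c d a' b' c' d' :
  a <= a' -> b' <= b -> c <= c' -> d' <= d ->
  closed_form_on p q a b c d -> closed_form_on p q a' b' c' d'.
Proof.
move=> aa bb cc dd cl x y /andP[ax xb] /andP[cy yd]; apply: cl.
  by rewrite (le_trans aa ax) (le_trans xb bb).
by rewrite (le_trans cc cy) (le_trans yd dd).
Qed.

Lemma closed_form_on_continuous p q a b c d : closed_form_on p q a b c d ->
  (forall y, c <= y <= d -> continuous_on (p ^~ y) a b) /\
  (forall x, a <= x <= b -> continuous_on (q x) c d).
Proof.
move=> cl; split.
  by move=> y hy t ht; have [] := closed_form_contx (cl t y ht hy).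
by move=> x hx t ht; have [] := closed_form_contx (cl x t hx ht).
Qed.

(** The affine approximation of the form at (x, y) is closed, and its boundary integral is zero: the
    terms B (c - d) (b - a) and B (b - a) (d - c) cancel. Only the remainder of the approximation is
    left, integrated over sides of total length twice (b - a) + (d - c). *)
Lemma closed_form_small p q x y e : closed_form_at p q x y -> 0 < e ->
  exists2 r, 0 < r & forall a b c d, a <= x <= b -> c <= y <= d ->
    b - a < r -> d - c < r -> closed_form_on p q a b c d ->
    `|rectint p q a b c d| <= e * ((b - a) + (d - c)) ^+ 2.
Proof.
move=> [A [B [C H]]] e0.
have [r r0 Hr] := H _ (divr_gt0 e0 (ltr0Sn _ 3)).
exists r => // a b c d /andP[ax xb] /andP[cy yd] br dr cl.
have ab := le_trans ax xb; have cd := le_trans cy yd.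
have [cp cq] := closed_form_on_continuous cl.
have [aI bI cI dI] : [/\ a <= a <= b, a <= b <= b, c <= c <= d & c <= d <= d].
  by rewrite !lexx ab cd.
pose L := (b - a) + (d - c).
have L0 : 0 <= L by rewrite addr_ge0 ?subr_ge0.
have E x' y' : a <= x' <= b -> c <= y' <= d ->
  `|p x' y' - p x y - (A * (x' - x) + B * (y' - y))| <= e / 4 * L /\
  `|q x' y' - q x y - (B * (x' - x) + C * (y' - y))| <= e / 4 * L.
  move=> /andP[ax' xb'] /andP[cy' yd'].
  have hx : `|x' - x| <= b - a by rewrite ler_norml; apply/andP; split; lra.
  have hy : `|y' - y| <= d - c by rewrite ler_norml; apply/andP; split; lra.
  have [] := Hr _ _ (le_lt_trans hx br) (le_lt_trans hy dr).
  rewrite !(addrC _ (_ - _)) !subrK => h1 h2.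
  have hL : e / 4 * (`|x' - x| + `|y' - y|) <= e / 4 * L.
    by rewrite ler_wpM2l ?lerD// divr_ge0// ltW.
  by split; [apply: le_trans h1 hL|apply: le_trans h2 hL].
have P : `|segint (fun t => p t c - p t d) a b - (B * (c - d)) * (b - a)|
    <= e / 2 * L * (b - a).
  apply: segint_near => [//||t tab]; first exact: continuous_onB (cp _ cI) (cp _ dI).
  have [h1 _] := E t c tab cI; have [h2 _] := E t d tab dI.
  rewrite ler_norml; move: h1 h2; rewrite !ler_norml => /andP[? ?] /andP[? ?].
  by apply/andP; split; lra.
have Q : `|segint (fun t => q b t - q a t) c d - (B * (b - a)) * (d - c)|
    <= e / 2 * L * (d - c).
  apply: segint_near => [//||t tab]; first exact: continuous_onB (cq _ bI) (cq _ aI).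
  have [_ h1] := E b t bI tab; have [_ h2] := E a t aI tab.
  rewrite ler_norml; move: h1 h2; rewrite !ler_norml => /andP[? ?] /andP[? ?].
  by apply/andP; split; lra.
rewrite segintB in P; [|exact: cp|exact: cp].
rewrite segintB in Q; [|exact: cq|exact: cq].
have -> : rectint p q a b c d =
   (segint (p ^~ c) a b - segint (p ^~ d) a b - (B * (c - d)) * (b - a)) +
   (segint (q b) c d - segint (q a) c d - (B * (b - a)) * (d - c)).
  by rewrite /rectint; ring.
apply: le_trans (ler_normD _ _) _.
apply: le_trans (lerD P Q) _; rewrite -mulrDr -/L expr2 mulrA ler_wpM2r//.
by rewrite ler_wpM2r//; lra.
Qed.

Lemma rectint_split p q a b c d x y : a <= x <= b -> c <= y <= d ->
  closed_form_on p q a b c d ->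
  rectint p q a b c d =
  (rectint p q a x c y + rectint p q x b c y)
  + (rectint p q a x y d + rectint p q x b y d).
Proof.
move=> xI yI cl; have /andP[ax xb] := xI; have /andP[cy yd] := yI.
have ab := le_trans ax xb; have cd := le_trans cy yd.
have [cp cq] := closed_form_on_continuous cl.
have [aI bI cI dI] : [/\ a <= a <= b, a <= b <= b, c <= c <= d & c <= d <= d].
  by rewrite !lexx ab cd.
rewrite /rectint (segint_cat ax xb (cp _ cI)) (segint_cat ax xb (cp _ dI)).
rewrite (segint_cat cy yd (cq _ aI)) (segint_cat cy yd (cq _ bI)).
ring.
Qed.

(* Bisection: a quarter of a bad rectangle is bad, and the bad quarters       *)
(* shrink to a point where the form is not closed.                            *)
Theorem goursat p q a b c d : a <= b -> c <= d ->
  closed_form_on p q a b c d -> rectint p q a b c d = 0.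
Proof.
move=> ab cd cl; apply/eqP/negPn/negP => J0.
pose sz (r : R * R * R * R) := (r.1.1.2 - r.1.1.1) + (r.2 - r.1.2).
pose J (r : R * R * R * R) := `|rectint p q r.1.1.1 r.1.1.2 r.1.2 r.2|.
pose L := (b - a) + (d - c).
have L0 : 0 < L.
  rewrite lt_neqAle addr_ge0 ?subr_ge0// andbT eq_sym.
  apply: contra J0; rewrite paddr_eq0 ?subr_ge0// !subr_eq0 => /andP[/eqP -> /eqP ->].
  by rewrite /rectint !subrr addr0.
(* With this constant the initial rectangle satisfies the inequality in [bad] with equality, and the
   inequality scales like the square of the size, just as a bisection does. *)
pose eta := `|rectint p q a b c d| / L ^+ 2.
have eta0 : 0 < eta by rewrite divr_gt0 ?normr_gt0 ?exprn_gt0.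
pose bad (r : R * R * R * R) := [/\ r.1.1.1 <= r.1.1.2, r.1.2 <= r.2,
   closed_form_on p q r.1.1.1 r.1.1.2 r.1.2 r.2 & eta * sz r ^+ 2 <= J r].
pose sub (r s : R * R * R * R) := [/\ r.1.1.1 <= s.1.1.1, s.1.1.2 <= r.1.1.2,
   r.1.2 <= s.1.2 & s.2 <= r.2].
have half r : bad r -> exists s, [/\ bad s, sub r s & sz s = sz r / 2].
  case: r => [[[a1 b1] c1] d1] [/= ab1 cd1 cl1 bad1].
  pose x := (a1 + b1) / 2; pose y := (c1 + d1) / 2.
  have [ax xb] : a1 <= x /\ x <= b1 by rewrite /x; split; lra.
  have [cy yd] : c1 <= y /\ y <= d1 by rewrite /y; split; lra.
  apply: contrapT => nos.
  have no s : s.1.1.1 <= s.1.1.2 -> s.1.2 <= s.2 ->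
      sub (a1, b1, c1, d1) s -> sz s = sz (a1, b1, c1, d1) / 2 ->
      J s < eta * (sz (a1, b1, c1, d1) / 2) ^+ 2.
    move=> s1 s2 ss szs; rewrite -szs ltNge; apply/negP => bads; apply: nos.
    exists s; split => //; split => //.
    by case: ss => ? ? ? ?; exact: closed_form_on_sub cl1.
  have := no (a1, x, c1, y) ax cy; have := no (x, b1, c1, y) xb cy.
  have := no (a1, x, y, d1) ax yd; have := no (x, b1, y, d1) xb yd.
  rewrite /sub /sz /J /= !lexx ax xb cy yd.
  move=> /(_ _ _)/wrap[]//; first by rewrite /x /y; lra.
  move=> h1 /(_ _ _)/wrap[]//; first by rewrite /x /y; lra.
  move=> h2 /(_ _ _)/wrap[]//; first by rewrite /x /y; lra.
  move=> h3 /(_ _ _)/wrap[]//; first by rewrite /x /y; lra.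
  move=> h4.
  move: bad1; rewrite /J /sz /=.
  rewrite (@rectint_split _ _ _ _ _ _ x y) ?ax ?cy//; apply/negP; rewrite -ltNge.
  apply: le_lt_trans (ler_normD _ _) _.
  apply: le_lt_trans (lerD (ler_normD _ _) (ler_normD _ _)) _.
  move: h1 h2 h3 h4; rewrite expr_div_n; lra.
have [f Hf] : exists f, forall r, bad r ->
    [/\ bad (f r), sub r (f r) & sz (f r) = sz r / 2].
  have H r : exists s, bad r -> [/\ bad s, sub r s & sz s = sz r / 2].
    by have [/half[s]|] := pselect (bad r); [exists s|exists r].
  by have [f Hf] := choice H; exists f.
pose u n := iter n f (a, b, c, d).
have ubad n : bad (u n).
  elim: n => [|n IH]; last by have [] := Hf _ IH.
  by split => //=; rewrite /eta /sz /J /= divfK// expf_neq0// gt_eqF.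
have usz n : sz (u n) = L / 2 ^+ n.
  elim: n => [|n IH]; first by rewrite expr0 divr1.
  by have [_ _ ->] := Hf _ (ubad n); rewrite IH exprSr invfM mulrA.
have usub n m : (n <= m)%N -> sub (u n) (u m).
  move=> /subnKC <-; elim: (m - n)%N => [|k [h1 h2 h3 h4]].
    by rewrite addn0; split.
  rewrite addnS; have [_ [g1 g2 g3 g4] _] := Hf _ (ubad (n + k)%N).
  by split; [exact: le_trans g1|exact: le_trans g2 _|exact: le_trans g3|exact: le_trans g4 _].
have uab n m : (u n).1.1.1 <= (u m).1.1.2.
  have [h1 _ _ _] := usub _ _ (leq_maxl n m); have [_ h2 _ _] := usub _ _ (leq_maxr n m).
  by have [h3 _ _ _] := ubad (maxn n m); exact: le_trans h1 (le_trans h3 h2).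
have ucd n m : (u n).1.2 <= (u m).2.
  have [_ _ h1 _] := usub _ _ (leq_maxl n m); have [_ _ _ h2] := usub _ _ (leq_maxr n m).
  by have [_ h3 _ _] := ubad (maxn n m); exact: le_trans h1 (le_trans h3 h2).
(* The point common to all the nested rectangles. *)
pose x := sup (range (fun n => (u n).1.1.1)).
pose y := sup (range (fun n => (u n).1.2)).
have xI n : (u n).1.1.1 <= x <= (u n).1.1.2.
  apply/andP; split.
    apply: ub_le_sup; last by exists n.
    by exists (u 0%N).1.1.2 => _ [m _ <-]; exact: uab.
  by apply: ge_sup; [exists (u 0%N).1.1.1, 0%N|move=> _ [m _ <-]; exact: uab].
have yI n : (u n).1.2 <= y <= (u n).2.
  apply/andP; split.
    apply: ub_le_sup; last by exists n.
    by exists (u 0%N).2 => _ [m _ <-]; exact: ucd.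
  by apply: ge_sup; [exists (u 0%N).1.2, 0%N|move=> _ [m _ <-]; exact: ucd].
(* At this point the form is closed, and the estimate with eta / 2 contradicts [bad] with eta on a
   small rectangle. *)
have [r r0 Hr] := closed_form_small (cl _ _ (xI 0%N) (yI 0%N)) (divr_gt0 eta0 (ltr0Sn _ 1)).
have [n hn] : exists n, L / 2 ^+ n < r.
  have := near_infty_natSinv_expn_lt (PosNum (divr_gt0 r0 L0)) => -[n _ /(_ n)].
  move=> /(_ (leqnn n)) /=; rewrite div1r ltr_pdivlMr// mulrC => ?.
  by exists n.
have [h1 h2 h3 h4] := ubad n.
have := usz n; rewrite /sz => szn.
have := Hr _ _ _ _ (xI n) (yI n) _ _ h3; rewrite -/(sz (u n)) => /(_ _ _)/wrap[].
- by apply: le_lt_trans hn; rewrite -szn lerDl subr_ge0.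
- by apply: le_lt_trans hn; rewrite -szn lerDr subr_ge0.
apply/negP; rewrite -ltNge; apply: lt_le_trans h4.
rewrite ltr_pM2r; first by rewrite ltr_pdivrMr// mulr_natr mulr2n ltrDl.
by rewrite exprn_gt0// usz divr_gt0// exprn_gt0.
Qed.

End Goursat.

Section Square.
Variable R : realType.
Implicit Types (p q : R -> R -> R).

(** An annulus for the maximum norm; for s = r it is the boundary of a square. *)
Definition closed_form_annulus p q (s r : R) := forall x y,
  `|x| <= r -> `|y| <= r -> (s <= `|x|) || (s <= `|y|) -> closed_form_at p q x y.

(** The region between the two squares is tiled by four rectangles, strips of full width above and
    below and two short ones at the sides. [goursat] applies to each, and the inner edges cancel. *)
Lemma rectint_annulus p q (s r : R) : 0 < s -> s <= r ->
  closed_form_annulus p q s r ->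
  rectint p q (- r) r (- r) r = rectint p q (- s) s (- s) s.
Proof.
move=> s0 sr cl.
have cln x y : - r <= x <= r -> - r <= y <= r -> (s <= `|x|) || (s <= `|y|) ->
    closed_form_at p q x y.
  by move=> hx hy; apply: cl; rewrite ler_norml.
have far (t : R) : (s <= t) || (t <= - s) -> s <= `|t|.
  by rewrite ler_normr lerNr.
have T1 : rectint p q (- r) r s r = 0.
  apply: goursat; [lra|lra|] => x y hx hy; apply: cln => //; first by lra.
  by apply/orP; right; apply: far; lra.
have T2 : rectint p q (- r) r (- r) (- s) = 0.
  apply: goursat; [lra|lra|] => x y hx hy; apply: cln => //; first by lra.
  by apply/orP; right; apply: far; lra.
have T3 : rectint p q (- r) (- s) (- s) s = 0.
  apply: goursat; [lra|lra|] => x y hx hy; apply: cln => //; [lra|lra|].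
  by apply/orP; left; apply: far; lra.
have T4 : rectint p q s r (- s) s = 0.
  apply: goursat; [lra|lra|] => x y hx hy; apply: cln => //; [lra|lra|].
  by apply/orP; left; apply: far; lra.
have cp y : - r <= y <= r -> s <= `|y| -> continuous_on (p ^~ y) (- r) r.
  by move=> hy sy x hx; have [] := closed_form_contx (cln x y hx hy _); rewrite ?sy ?orbT.
have cq x : - r <= x <= r -> s <= `|x| -> continuous_on (q x) (- r) r.
  by move=> hx sx y hy; have [] := closed_form_contx (cln x y hx hy _); rewrite ?sx ?orbT.
have sn : s <= `|s| by apply: far; rewrite lexx.
have sn' : s <= `|- s| by rewrite normrN.
have rn : s <= `|r| by apply: far; rewrite sr.
have rn' : s <= `|- r| by rewrite normrN.
have cat3 (k : R -> R) : continuous_on k (- r) r ->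
    segint k (- r) r = segint k (- r) (- s) + segint k (- s) s + segint k s r.
  move=> ck; rewrite (@segint_cat _ k (- r) s r)//; [|lra].
  rewrite (@segint_cat _ k (- r) (- s) s)//; [lra|lra|].
  exact: continuous_on_sub ck.
move: T1 T2 T3 T4; rewrite /rectint.
rewrite (cat3 (p ^~ s))//; last by apply: cp => //; lra.
rewrite (cat3 (p ^~ (- s)))//; last by apply: cp => //; lra.
rewrite (cat3 (q r))//; last by apply: cq => //; lra.
rewrite (cat3 (q (- r)))//; last by apply: cq => //; lra.
lra.
Qed.

Lemma rectint_square_le p q (s B : R) : 0 <= s ->
  closed_form_annulus p q s s ->
  (forall x y, `|x| <= s -> `|y| <= s -> (s <= `|x|) || (s <= `|y|) ->
    `|p x y| <= B /\ `|q x y| <= B) ->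
  `|rectint p q (- s) s (- s) s| <= 8 * s * B.
Proof.
move=> s0 cl H.
have sI (t : R) : - s <= t <= s -> `|t| <= s by rewrite ler_norml.
have ns : `|s| = s by rewrite ger0_norm.
have nNs : `|- s| = s by rewrite normrN.
have E (k : R -> R) : continuous_on k (- s) s ->
    (forall x, - s <= x <= s -> `|k x| <= B) -> `|segint k (- s) s| <= B * (2 * s).
  move=> ck kB; have := @segint_near _ k 0 B (- s) s.
  rewrite mul0r subr0 opprK -mulr2n mulr_natl; apply => //; first by lra.
  by move=> x xs; rewrite subr0; exact: kB.
have cp y : `|y| = s -> `|segint (p ^~ y) (- s) s| <= B * (2 * s).
  move=> ys; apply: E => x /sI xs.
    by have [] := closed_form_contx (cl x y xs _ _); rewrite ?ys ?lexx ?orbT.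
  by have [] := H x y xs; rewrite ?ys ?lexx ?orbT.
have cq x : `|x| = s -> `|segint (q x) (- s) s| <= B * (2 * s).
  move=> xs; apply: E => y /sI ys.
    by have [] := closed_form_contx (cl x y _ ys _); rewrite ?xs ?lexx ?orbT.
  by have [] := H x y _ ys; rewrite ?xs ?lexx ?orbT.
have := cp s ns; have := cp (- s) nNs; have := cq s ns; have := cq (- s) nNs.
rewrite /rectint !ler_norml => /andP[? ?] /andP[? ?] /andP[? ?] /andP[? ?].
by apply/andP; split; lra.
Qed.

End Square.

(** * Real-valued norms on complex normed spaces *)

Section ComplexNorm.
Variable R : realType.

Lemma ltr0c (r : R) : (0 < r%:C) = (0 < r).
Proof. by rewrite -(ltcR 0 r). Qed.

Lemma gt0_Re (e : R[i]) : 0 < e -> 0 < complex.Re e.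
Proof. by rewrite ltcE => /andP[]. Qed.

(* The norm of a normed module over R[i] takes values in R[i]; cnorm is its   *)
(* real part.                                                                 *)
Definition cnorm (V : normedModType R[i]) (v : V) : R := complex.Re `|v|.

Section CNormTheory.
Variable V : normedModType R[i].
Implicit Types u v : V.

Lemma cnormE v : `|v| = (cnorm v)%:C.
Proof. by rewrite /cnorm RRe_real// normr_real. Qed.

Lemma cnorm_ge0 v : 0 <= cnorm v.
Proof. by rewrite -ler0c -cnormE. Qed.

Lemma cnormD u v : cnorm (u + v) <= cnorm u + cnorm v.
Proof. by rewrite -lecR rmorphD/= -!cnormE ler_normD. Qed.

Lemma cnormN v : cnorm (- v) = cnorm v.
Proof. by rewrite /cnorm normrN. Qed.

Lemma cdistC u v : cnorm (u - v) = cnorm (v - u).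
Proof. by rewrite -cnormN opprB. Qed.

Lemma cnorm0 : cnorm (0 : V) = 0.
Proof. by rewrite /cnorm normr0. Qed.

Lemma cnorm_eq0 v : (cnorm v == 0) = (v == 0).
Proof. by rewrite -[RHS]normr_eq0 cnormE -(inj_eq (@complexI R)). Qed.

Lemma cnormZ (k : R[i]) v : cnorm (k *: v) = Normc.normc k * cnorm v.
Proof. by have := normrZ k v; rewrite !cnormE normc_def -rmorphM => /complexI ->; case: k. Qed.

Lemma nbhs_cnormP v (P : set V) :
  nbhs v P <-> exists2 r : R, 0 < r & forall y, cnorm (y - v) < r -> P y.
Proof.
split.
  move=> /nbhs_ballP[e /= e0 He]; exists (complex.Re e); first exact: gt0_Re.
  move=> y yv; apply: He; rewrite -ball_normE/= distrC cnormE.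
  rewrite -(RRe_real (gtr0_real e0)) ltcR; exact: yv.
move=> [r r0 H]; apply/nbhs_ballP; exists r%:C => /=; first by rewrite ltr0c.
by move=> y; rewrite -ball_normE/= distrC cnormE ltcR => /H.
Qed.

End CNormTheory.

Lemma cnorm_normc (z : R[i]) : cnorm (z : R[i]^o) = Normc.normc z.
Proof. by []. Qed.

Lemma diff_cnormP (V W : normedModType R[i]) (f : V -> W) x :
  differentiable f x -> forall e : R, 0 < e -> exists2 r : R, 0 < r &
  forall h, cnorm h < r -> cnorm (f (x + h) - f x - 'd f x h) <= e * cnorm h.
Proof.
move=> df e e0.
have /eqaddoP/(_ e%:C) := diff_locally df.
rewrite ltr0c => /(_ e0)/nbhs_cnormP[r r0 Hr]; exists r => // h hr.
have := Hr h; rewrite subr0 => /(_ hr) /=.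
by rewrite !fctE/= !cnormE -rmorphM/= lecR [h + x]addrC opprD addrA.
Qed.

(** The bound by C makes A continuous, as a differential has to be; uniqueness of the differential
    then identifies it with A. *)
Lemma cnorm_diff (V W : normedModType R[i]) (f : V -> W) x (A : {linear V -> W}) C :
  (forall h, cnorm (A h) <= C * cnorm h) ->
  (forall e : R, 0 < e -> exists2 r : R, 0 < r &
    forall h, cnorm h < r -> cnorm (f (x + h) - f x - A h) <= e * cnorm h) ->
  differentiable f x /\ 'd f x = A :> (V -> W).
Proof.
move=> AC H.
have cA : continuous A.
  move=> v; apply/cvgrPdist_le => e e0.
  have C1 : 0 < `|C| + 1 by rewrite ltr_wpDl.
  apply/nbhs_cnormP; exists (complex.Re e / (`|C| + 1)).
    by rewrite divr_gt0 ?gt0_Re.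
  move=> y; rewrite ltr_pdivlMr// => yv.
  rewrite -linearB cnormE -(RRe_real (gtr0_real e0)) lecR.
  apply: le_trans (AC _) _; rewrite cdistC; apply: le_trans (ltW yv).
  by rewrite mulrC ler_wpM2l ?cnorm_ge0// (le_trans (ler_norm _))// lerDl.
have E : f \o shift x = cst (f x) + A +o_ 0 id.
  apply/eqaddoP => e e0.
  have [|r r0 Hr] := H (complex.Re e); first exact: gt0_Re.
  apply/nbhs_cnormP; exists r => // y; rewrite subr0 => /Hr.
  rewrite -lecR rmorphM/= -!cnormE RRe_real ?gtr0_real// => {}Hr.
  by rewrite !fctE/= opprD addrA [y + x]addrC.
have dE := diff_unique cA E.
by split=> //; apply/diff_locallyP; rewrite dE.
Qed.

End ComplexNorm.

(** * Cauchy estimate *)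


Section ComplexPlane.
Variable R : realType.
Implicit Types (z w : R[i]).
Local Notation C := (R[i])^o.
Local Notation normc := Normc.normc.

Lemma Re_le_normc z : `|complex.Re z| <= normc z.
Proof. by rewrite -lecR (le_trans (normc_ge_Re z)). Qed.

Lemma Im_le_normc z : `|complex.Im z| <= normc z.
Proof.
case: z => x y /=; rewrite -sqrtr_sqr ler_wsqrtr// lerDr; exact: sqr_ge0.
Qed.

Lemma normc_le_add (x y : R) : normc (x +i* y) <= `|x| + `|y|.
Proof.
rewrite /= -[leRHS]ger0_norm ?addr_ge0// -[leRHS]sqrtr_sqr ler_wsqrtr//.
rewrite sqrrD !real_normK ?num_real// lerD2r lerDl.
by rewrite mulrn_wge0// mulr_ge0.
Qed.

Lemma normc_ge0 z : 0 <= normc z.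
Proof. by case: z => x y /=; exact: sqrtr_ge0. Qed.

Lemma normcX z n : normc (z ^+ n) = normc z ^+ n.
Proof.
elim: n => [|n IH]; first by rewrite !expr0 Normc.normc1.
by rewrite !exprS Normc.normcM IH.
Qed.

Lemma normc_eq0 z : (normc z == 0) = (z == 0).
Proof. by apply/eqP/eqP => [/Normc.eq0_normc//|->]; rewrite Normc.normc0. Qed.

(** The form is the real part of h dz. By the Cauchy-Riemann equations its matrix of partial
    derivatives is symmetric, with entries Re h', - Im h', - Im h', - Re h'. *)
Lemma closed_form_holomorphic (h : C -> C) (x y : R) :
  differentiable h (x +i* y : C) ->
  closed_form_at (fun x y => complex.Re (h (x +i* y)))
                 (fun x y => - complex.Im (h (x +i* y))) x y.
Proof.
move=> dh; pose d := 'd h (x +i* y : C) 1.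
exists (complex.Re d), (- complex.Im d), (- complex.Re d) => e e0.
have [r r0 Hr] := diff_cnormP dh e0.
exists (r / 2) => [|s t sr tr]; first by rewrite divr_gt0.
have st := normc_le_add s t.
have /Hr : cnorm (s +i* t : R[i]^o) < r.
  by rewrite cnorm_normc; apply: le_lt_trans st _; lra.
have -> : 'd h (x +i* y : C) (s +i* t) = (s +i* t) * d.
  by rewrite -[RHS]/((s +i* t : R[i]) *: (d : C)) -linearZ; congr ('d h _ _); rewrite -[LHS]mulr1.
rewrite !cnorm_normc => Hst.
have {}Hst : normc (h ((x +i* y) + (s +i* t)) - h (x +i* y) - (s +i* t) * d)
    <= e * (`|s| + `|t|).
  by apply: le_trans Hst _; rewrite ler_wpM2l// ltW.
have E : (x +i* y) + (s +i* t) = (x + s) +i* (y + t) by [].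
rewrite E in Hst; clearbody d.
move: d (h (_ +i* _)) (h (_ +i* _)) Hst => [d1 d2] [a1 b1] [a2 b2] Hst.
have /= H1 := le_trans (Re_le_normc _) Hst.
have /= H2 := le_trans (Im_le_normc _) Hst.
split.
  by apply: le_trans H1; rewrite le_eqVlt; apply/orP; left; apply/eqP; congr `|_|; ring.
apply: le_trans H2; rewrite -normrN le_eqVlt; apply/orP; left; apply/eqP.
by congr `|_|; ring.
Qed.

(** B bounds the integrand from below in the direction of travel, which is negative on the top and
    left sides. The perimeter is 8 s. *)
Lemma rectint_square_ge (p q : R -> R -> R) (s B : R) : 0 <= s ->
  closed_form_annulus p q s s ->
  (forall t, - s <= t <= s ->
    [/\ B <= p t (- s), p t s <= - B, B <= q s t & q (- s) t <= - B]) ->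
  8 * s * B <= rectint p q (- s) s (- s) s.
Proof.
move=> s0 cl H.
have sI (t : R) : - s <= t <= s -> `|t| <= s by rewrite ler_norml.
have ns : `|s| = s by rewrite ger0_norm.
have nNs : `|- s| = s by rewrite normrN.
have cp y : `|y| = s -> continuous_on (p ^~ y) (- s) s.
  by move=> ys x /sI xs; have [] := closed_form_contx (cl x y xs _ _);
    rewrite ?ys ?lexx ?orbT.
have cq x : `|x| = s -> continuous_on (q x) (- s) s.
  by move=> xs y /sI ys; have [] := closed_form_contx (cl x y _ ys _);
    rewrite ?xs ?lexx ?orbT.
have cc r : continuous_on (fun=> r) (- s) s by move=> x _; exact: cst_continuous.
have ss : - s <= s by lra.
have : B * (s - - s) <= segint (p ^~ (- s)) (- s) s.
  by rewrite -segint_cst//; apply: segint_le (cc _) (cp _ nNs) _ => x /H[].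
have : segint (p ^~ s) (- s) s <= - B * (s - - s).
  by rewrite -segint_cst//; apply: segint_le (cp _ ns) (cc _) _ => x /H[].
have : B * (s - - s) <= segint (q s) (- s) s.
  by rewrite -segint_cst//; apply: segint_le (cc _) (cq _ ns) _ => x /H[].
have : segint (q (- s)) (- s) s <= - B * (s - - s).
  by rewrite -segint_cst//; apply: segint_le (cq _ nNs) (cc _) _ => x /H[].
rewrite /rectint; lra.
Qed.

(* Compare the integrals of k (phi z - phi 0) / z^2 dz over a large square    *)
(* and over a small one, with k chosen so that k phi'(0) dz / z has           *)
(* positive real part on the positively oriented boundary.                    *)
Theorem cauchy_estimate (phi : C -> C) (rho M : R) : 0 < rho ->
  (forall z, normc z < rho -> differentiable phi (z : C)) ->
  (forall z, normc z < rho -> normc (phi z) <= M) ->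
  normc ('d phi (0 : C) 1) <= 16 * M / rho.
Proof.
move=> rho0 dphi phiM; set d := 'd phi (0 : C) 1.
have normc00 : normc (0 : R[i]) = 0 := Normc.normc0 R.
have M0 : 0 <= M by apply: le_trans (phiM 0 _); rewrite ?normc_ge0// normc00.
have [d0|d0] := eqVneq (normc d) 0; first by rewrite d0 divr_ge0 ?mulr_ge0// ltW.
apply/ler_addgt0Pr => e e0.
(* A number of modulus 1 with k d = - i |d|. Then k d dz / z has real part |d| d theta, which is
   positive in the counterclockwise direction. *)
pose k : R[i] := - 'i%C * d^*%C / (normc d)%:C.
have nJ z : normc z^*%C = normc z by case: z => a b /=; rewrite sqrrN.
have nR (r : R) : 0 <= r -> normc r%:C = r.
  by move=> r0; rewrite /= expr0n addr0 sqrtr_sqr ger0_norm.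
have ni : normc 'i%C = 1 :> R by rewrite /= expr0n add0r expr1n sqrtr1.
have kn : normc k = 1.
  rewrite /k !Normc.normcM nJ normcN ni mul1r Normc.normcV nR ?normc_ge0//.
  by rewrite divff.
have kd : k * d = - 'i%C * (normc d)%:C.
  have dd : d^*%C * d = (normc d)%:C ^+ 2.
    by rewrite mulrC -sqr_normc normc_def; case: (d).
  rewrite /k mulrAC -(mulrA _ _ d) dd; field.
  by rewrite (inj_eq (@complexI R) _ 0).
clearbody k.
pose h (z : C) : C := k * (phi z - phi 0) * (z ^+ 2)^-1.
have dh z : normc z < rho -> z != 0 -> differentiable h (z : C).
  move=> zr z0; apply: differentiableM.
    apply: differentiableM; first exact: differentiable_cst.
    by apply: differentiableB; [exact: dphi|exact: differentiable_cst].
  by apply: differentiableV; [exact: (@differentiableX _ _ (@id C) 1%N z)|rewrite expf_neq0].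
pose p x y := complex.Re (h (x +i* y)).
pose q x y := - complex.Im (h (x +i* y)).
pose r := rho / 2; have r0 : 0 < r by rewrite divr_gt0.
have cl s r' : 0 < s -> r' < r -> closed_form_annulus p q s r'.
  move=> s0 r'r x y xr yr sxy; apply: closed_form_holomorphic; apply: dh.
    by apply: le_lt_trans (normc_le_add _ _) _; rewrite /r in r'r; lra.
  rewrite eq_complex /=; apply/negP => /andP[/eqP x0 /eqP y0].
  by move: sxy; rewrite x0 y0 normr0 orbb; apply/negP; rewrite -ltNge.
have hE z : normc z < rho -> z != 0 ->
    normc (h z) <= 2 * M / normc z ^+ 2.
  move=> zr z0; rewrite /h !Normc.normcM kn mul1r Normc.normcV normcX.
  rewrite ler_wpM2r ?invr_ge0 ?exprn_ge0 ?normc_ge0//.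
  apply: le_trans (le_normcD _ _) _; rewrite normcN mulrDl mul1r.
  by rewrite lerD ?phiM// normc00.
have large r' : 0 < r' -> r' < r ->
    `|rectint p q (- r') r' (- r') r'| <= 8 * r' * (2 * M / r' ^+ 2).
  move=> r'0 r'r; apply: rectint_square_le; [exact: ltW|exact: cl|].
  move=> x y xr yr rxy; pose z := x +i* y.
  have zr : r' <= normc z.
    by case/orP: rxy => /le_trans; apply;
      [exact: (Re_le_normc z)|exact: (Im_le_normc z)].
  have z0 : z != 0 by rewrite -normc_eq0 gt_eqF// (lt_le_trans r'0).
  have hz : normc (h z) <= 2 * M / r' ^+ 2.
    apply: (le_trans (hE z _ z0)).
      by apply: le_lt_trans (normc_le_add _ _) _; rewrite /r in r'r; lra.
    rewrite ler_wpM2l ?mulr_ge0// lef_pV2 ?posrE ?exprn_gt0//.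
      by rewrite ler_pXn2r ?nnegrE ?normc_ge0// ltW.
    exact: lt_le_trans zr.
  split; first exact: le_trans (Re_le_normc _) hz.
  by rewrite normrN; exact: le_trans (Im_le_normc _) hz.
have [|r1 r10 Hr1] := diff_cnormP (dphi 0 _) (divr_gt0 e0 (ltr0Sn _ 1)).
  by rewrite normc00.
have hd w : normc w < r1 -> normc (phi w - phi 0 - w * d) <= e / 2 * normc w.
  move=> /Hr1; rewrite add0r !cnorm_normc; congr (normc (_ - _) <= _).
  by rewrite -[RHS]/(w *: (d : C)) -linearZ; congr ('d phi _ _); rewrite -[LHS]mulr1.
(* A point of the square of half-side r' has modulus at most 2 r' < rho. The bound s <= r1 / 3
   likewise keeps the small square where the linear approximation of phi holds. *)
pose r' := rho / 4; pose s := Num.min r' (r1 / 3).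
have r'0 : 0 < r' by rewrite divr_gt0.
have r'r : r' < r by rewrite /r' /r; lra.
have s0 : 0 < s by rewrite lt_min r'0 divr_gt0.
have sr' : s <= r' by rewrite ge_min lexx.
have sr1 : s <= r1 / 3 by rewrite ge_min lexx orbT.
have := large _ r'0 r'r; rewrite (rectint_annulus s0 sr' (cl _ _ s0 r'r)).
move=> /(le_trans (ler_norm _)) up.
have lo : 8 * s * (normc d / (2 * s) - e / 2 / s) <= rectint p q (- s) s (- s) s.
  apply: rectint_square_ge; first exact: ltW.
    by apply: cl => //; exact: le_lt_trans r'r.
  have key x y : `|x| <= s -> `|y| <= s -> (s <= `|x|) || (s <= `|y|) ->
      exists A B, [/\ p x y = - normc d * y / (x ^+ 2 + y ^+ 2) + A,
        q x y = normc d * x / (x ^+ 2 + y ^+ 2) + B,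
        `|A| <= e / 2 / s & `|B| <= e / 2 / s].
    move=> xs ys sxy; pose z := x +i* y.
    have zs : s <= normc z.
      by case/orP: sxy => /le_trans; apply;
        [exact: (Re_le_normc z)|exact: (Im_le_normc z)].
    have z0 : z != 0 by rewrite -normc_eq0 gt_eqF// (lt_le_trans s0).
    have zr1 : normc z < r1 by apply: le_lt_trans (normc_le_add _ _) _; lra.
    pose E := k * (phi z - phi 0 - z * d) / z ^+ 2.
    have hzE : h z = - 'i%C * (normc d)%:C / z + E.
      by rewrite /h /E -kd; field.
    have Es : normc E <= e / 2 / s.
      rewrite /E !Normc.normcM kn mul1r Normc.normcV normcX.
      rewrite ler_pdivrMr ?exprn_gt0 ?(lt_le_trans s0)//.
      apply: (le_trans (hd _ zr1)).
      rewrite (_ : _ * normc z ^+ 2 = e / 2 * normc z * (normc z / s)); last first.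
        by field; rewrite gt_eqF.
      by rewrite ler_peMr ?ler_pdivlMr ?mul1r// mulr_ge0 ?normc_ge0// divr_ge0// ltW.
    have xy0 : x ^+ 2 + y ^+ 2 != 0.
      rewrite paddr_eq0 ?sqr_ge0// !sqrf_eq0; apply: contra z0 => /andP[/eqP x0 /eqP y0].
      by rewrite /z x0 y0.
    exists (complex.Re E), (- complex.Im E); split.
    - rewrite /p -/z hzE; clear -xy0; case: E => a b /=; field.
      by rewrite /z in xy0 *.
    - rewrite /q -/z hzE; clear -xy0; case: E => a b /=; field.
      by rewrite /z in xy0 *.
    - exact: le_trans (Re_le_normc _) Es.
    - by rewrite normrN; exact: le_trans (Im_le_normc _) Es.
  (* On a side of the small square x^2 + s^2 is at most 2 s^2. *)
  have half x : `|x| <= s -> normc d / (2 * s) <= normc d * s / (x ^+ 2 + s ^+ 2).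
    move=> xs; rewrite -mulrA ler_wpM2l ?normc_ge0//.
    have xs2 : x ^+ 2 <= s ^+ 2.
      by rewrite -(real_normK (num_real x)) ler_pXn2r// nnegrE// ltW.
    have s20 : 0 < s ^+ 2 by rewrite exprn_gt0.
    have xx0 := sqr_ge0 x.
    rewrite ler_pdivlMr; last by lra.
    rewrite mulrC ler_pdivrMr ?mulr_gt0//; lra.
  move=> t tI; have ts : `|t| <= s by rewrite ler_norml.
  have ns : `|s| = s by rewrite gtr0_norm.
  have nNs : `|- s| = s by rewrite normrN.
  have ht := half _ ts.
  split.
  - have [|| A [B [-> _ As _]]] := key t (- s) ts; rewrite ?nNs ?lexx ?orbT//.
    rewrite sqrrN mulrNN; move: As; rewrite ler_norml => /andP[]; lra.
  - have [|| A [B [-> _ As _]]] := key t s ts; rewrite ?ns ?lexx ?orbT//.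
    rewrite !mulNr; move: As; rewrite ler_norml => /andP[]; lra.
  - have [||| A [B [_ -> _ Bs]]] := key s t; rewrite ?ns ?lexx//.
    move: Bs; rewrite ler_norml (addrC (s ^+ 2)) => /andP[]; lra.
  - have [||| A [B [_ -> _ Bs]]] := key (- s) t; rewrite ?nNs ?lexx//.
    rewrite sqrrN mulrN mulNr; move: Bs; rewrite ler_norml (addrC (s ^+ 2)) => /andP[]; lra.
have {lo up} := le_trans lo up.
have -> : 8 * s * (normc d / (2 * s) - e / 2 / s) = 4 * (normc d - e).
  by field; rewrite gt_eqF.
have -> : 8 * r' * (2 * M / r' ^+ 2) = 4 * (16 * M / rho).
  by rewrite /r'; field; rewrite gt_eqF.
rewrite ler_pM2l//; lra.
Qed.

End ComplexPlane.

(** * Derivatives of holomorphic functions of several variables *)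


Section RealDiff.
Variable R : realType.

Lemma eps_diff (V W : normedModType R) (f : V -> W) x (A : {linear V -> W}) C :
  (forall h, `|A h| <= C * `|h|) ->
  (forall e : R, 0 < e -> exists2 r : R, 0 < r &
    forall h, `|h| < r -> `|f (x + h) - f x - A h| <= e * `|h|) ->
  differentiable f x /\ 'd f x = A :> (V -> W).
Proof.
move=> AC H.
have cA : continuous A.
  move=> v; apply/cvgrPdist_le => e e0.
  have C1 : 0 < `|C| + 1 by rewrite ltr_wpDl.
  apply/nbhs_ballP; exists (e / (`|C| + 1)); first by rewrite /= divr_gt0.
  move=> y; rewrite -ball_normE/= ltr_pdivlMr// => yv.
  rewrite -linearB; apply: le_trans (AC _) _; apply: le_trans (ltW yv).
  by rewrite mulrC ler_wpM2l// (le_trans (ler_norm _))// lerDl.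
have E : f \o shift x = cst (f x) + A +o_ 0 id.
  apply/eqaddoP => e /H[r r0 Hr]; apply/nbhs_ballP; exists r => // y.
  rewrite -ball_normE/= sub0r normrN => /Hr.
  by rewrite !fctE/= opprD addrA [y + x]addrC.
have dE := diff_unique cA E.
by split=> //; apply/diff_locallyP; rewrite dE.
Qed.

Lemma diff_epsP (V W : normedModType R) (f : V -> W) x :
  differentiable f x -> forall e : R, 0 < e -> exists2 r : R, 0 < r &
  forall h, `|h| < r -> `|f (x + h) - f x - 'd f x h| <= e * `|h|.
Proof.
move=> df e e0.
have /eqaddoP/(_ _ e0)/nbhs_ballP[r /= r0 Hr] := diff_locally df.
exists r => // h hr.
have := Hr h; rewrite -ball_normE/= sub0r normrN => /(_ hr) /=.
by rewrite !fctE/= [h + x]addrC opprD addrA.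
Qed.

Lemma eps_is_derive (f : R -> R) x D :
  (forall e : R, 0 < e -> exists2 r : R, 0 < r &
    forall h, `|h| < r -> `|f (x + h) - f x - h * D| <= e * `|h|) ->
  is_derive (x : R^o) 1 (f : R^o -> R^o) D.
Proof.
move=> H; pose A0 (h : R^o) : R^o := h * D.
have A0l : linear A0 by move=> k u v; rewrite /A0 mulrDl -mulrA.
pose aM := GRing.isLinear.Build R R^o R^o *:%R A0 A0l.
pose A : {linear R^o -> R^o} := HB.pack A0 aM.
have [||df dE] := @eps_diff _ _ (f : R^o -> R^o) x A `|D|.
- by move=> h; rewrite /A/= /A0 normrM mulrC.
- exact: H.
have df' : derivable (f : R^o -> R^o) x 1 by exact: diff_derivable.
by apply: DeriveDef => //; rewrite deriveE// dE/= /A0 mul1r.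
Qed.

End RealDiff.

Section SeveralVariables.
Variable R : realType.
Local Notation C := (R[i])^o.
Local Notation normc := Normc.normc.
Implicit Types (r M : R).

(** The real mean value theorem for Re (k phi), where the unit number k rotates phi 1 - phi 0 onto
    the positive axis. *)
Lemma mvt_complex (phi : C -> C) (K : R) :
  (forall t : R, 0 <= t <= 1 -> differentiable phi (t%:C : C)) ->
  (forall t : R, 0 <= t <= 1 -> normc ('d phi (t%:C : C) 1) <= K) ->
  normc (phi 1 - phi 0) <= K.
Proof.
move=> dphi bphi; set w := phi 1 - phi 0.
have [w0|w0] := eqVneq (normc w) 0.
  by rewrite w0; apply: le_trans (bphi 0 _); rewrite ?normc_ge0 ?lexx ?ler01.
pose k : R[i] := w^*%C / (normc w)%:C.
have kn : normc k = 1.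
  rewrite /k Normc.normcM Normc.normcV; have -> : normc w^*%C = normc w.
    by case: (w) => a b /=; rewrite sqrrN.
  have -> : normc (normc w)%:C = normc w.
    by rewrite /= expr0n addr0 sqrtr_sqr ger0_norm// normc_ge0.
  by rewrite divff.
have kw : complex.Re (k * w) = normc w.
  have -> : k * w = (normc w)%:C.
    have ww : w^*%C * w = (normc w)%:C ^+ 2.
      by rewrite mulrC -sqr_normc normc_def; case: (w).
    rewrite /k mulrAC ww; field.
    by rewrite (inj_eq (@complexI R) _ 0).
  by [].
clearbody k.
pose g (t : R) : R := complex.Re (k * phi t%:C).
have dg t : 0 <= t <= 1 ->
    is_derive (t : R^o) 1 (g : R^o -> R^o) (complex.Re (k * 'd phi (t%:C : C) 1)).
  move=> tI; apply: eps_is_derive => e e0.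
  have [r r0 Hr] := diff_cnormP (dphi t tI) e0; exists r => // h hr.
  have nh : cnorm (h%:C : C) = `|h|.
    by rewrite cnorm_normc /= expr0n addr0 sqrtr_sqr.
  have := Hr (h%:C); rewrite nh => /(_ hr); rewrite cnorm_normc => Hh.
  apply: le_trans Hh.
  rewrite -[leRHS]mul1r -kn -Normc.normcM; apply: le_trans (Re_le_normc _).
  have -> : 'd phi (t%:C : C) h%:C = h%:C * 'd phi (t%:C : C) 1.
    by rewrite -[RHS]/(h%:C *: _) -linearZ; congr ('d phi _ _); rewrite -[LHS]mulr1.
  rewrite /g rmorphD; move: (phi _) (phi _) ('d phi _ _) => [a1 b1] [a2 b2] [a3 b3].
  rewrite le_eqVlt; apply/orP; left; apply/eqP; congr `|_|.
  by case: (k) => k1 k2 /=; ring.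
have cg : {within `[0, 1], continuous g}.
  apply: derivable_within_continuous => t; rewrite in_itv/= => /dg dgt.
  exact: ex_derive.
have [|t tI] := @MVT_segment _ g
    (fun t => complex.Re (k * 'd phi (t%:C : C) 1)) 0 1 ler01 _ cg.
  by move=> t; rewrite in_itv/= => /andP[t0 t1]; apply: dg; rewrite !ltW.
rewrite subr0 mulr1 => gE.
have -> : normc w = g 1 - g 0.
  rewrite -kw /g /w; move: (phi _) (phi _) => [a1 b1] [a2 b2].
  by case: (k) => k1 k2 /=; ring.
rewrite gE; apply: le_trans (ler_norm _) _; apply: le_trans (Re_le_normc _) _.
by rewrite Normc.normcM kn mul1r; apply: bphi; move: tI; rewrite in_itv.
Qed.

Variable V : normedModType R[i].
Implicit Types (f : V -> C) (x y h u v : V).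

Lemma diffB_at (U W : normedModType R[i]) (f g : U -> W) (x h : U) :
  differentiable f x -> differentiable g x ->
  'd (f - g) x h = 'd f x h - 'd g x h.
Proof. by move=> df dg; exact: (congr1 (fun F : U -> W => F h) (diffB df dg)). Qed.

Lemma diff_shift (U W : normedModType R[i]) (f : U -> W) (x w h : U) :
  differentiable f (x + w) ->
  differentiable (f \o shift w) x /\ 'd (f \o shift w) x h = 'd f (x + w) h.
Proof.
move=> df.
have H : is_diff x (shift w : U -> U) (id + 0) by exact: is_diffD.
have ds := @ex_diff _ _ _ _ _ _ _ H.
have E := congr1 (fun F : U -> U => F h) (@diff_val _ _ _ _ _ _ _ H).
split; first exact: differentiable_comp.
have Q := congr1 (fun F : U -> W => F h) (diff_comp ds df).
apply: (etrans Q) => /=; congr ('d f _ _).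
by apply: (etrans E); rewrite /= addr0.
Qed.

Lemma diff_scalev (U : normedModType R[i]) (v : U) (t : R[i]) :
  differentiable (fun s : C => s *: v) (t : C) /\
  'd (fun s : C => s *: v) (t : C) 1 = v.
Proof.
have H := @is_diff_scalel R[i] U t v.
by split; [exact: (@ex_diff _ _ _ _ _ _ _ H)|rewrite (@diff_val _ _ _ _ _ _ _ H) /= scale1r].
Qed.

Lemma diff_line f x v (t : R[i]) : differentiable f (x + t *: v) ->
  differentiable (fun s : C => f (x + s *: v)) (t : C) /\
  'd (fun s : C => f (x + s *: v)) (t : C) 1 = 'd f (x + t *: v) v.
Proof.
move=> df; pose l (s : C) : V := x + s *: v.
have [ds dsE] := diff_scalev v t.
have dx : differentiable (cst x : C -> V) (t : C) by [].
have dl : differentiable l (t : C) by exact: (differentiableD dx ds).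
have E : 'd l (t : C) 1 = v.
  have H := congr1 (fun F : C -> V => F 1) (diffD dx ds).
  have H0 := congr1 (fun F : C -> V => F 1) (diff_cst x (t : C)).
  by apply: (etrans H); rewrite -[RHS]add0r; exact: (congr2 +%R H0 dsE).
split; first exact: differentiable_comp.
by rewrite (@diff_comp _ _ _ _ l f)//= E.
Qed.

Definition bounded_holomorphic f x r M := forall y, cnorm (y - x) < r ->
  differentiable f y /\ normc (f y) <= M.

(** The one-variable estimate for f (x + t v) on the disc of radius r / |v|. *)
Lemma cauchy_estimate_dir f x r M v : 0 < r -> bounded_holomorphic f x r M ->
  normc ('d f x v) <= 16 * M / r * cnorm v.
Proof.
move=> r0 bf.
have [v0|v0] := eqVneq v 0.
  by rewrite v0 linear0 Normc.normc0 cnorm0 mulr0.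
have nv : 0 < cnorm v by rewrite lt_neqAle eq_sym cnorm_eq0 v0 cnorm_ge0.
have inB (t : R[i]) : normc t < r / cnorm v -> cnorm (x + t *: v - x) < r.
  by rewrite addrAC subrr add0r cnormZ ltr_pdivlMr.
have H0 : differentiable f (x + (0 : R[i]) *: v).
  by have [] := bf (x + (0 : R[i]) *: v); rewrite ?inB// Normc.normc0 divr_gt0.
have -> : 'd f x v = 'd f (x + (0 : R[i]) *: v) v.
  by congr ('d f _ v); rewrite scale0r addr0.
have [_ <-] := diff_line H0.
apply: (@le_trans _ _ (16 * M / (r / cnorm v))); last first.
  by rewrite invf_div mulrA mulrAC.
apply: cauchy_estimate; first exact: divr_gt0.
  by move=> t /inB/bf[df _]; have [] := diff_line df.
by move=> t /inB/bf[].
Qed.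

Lemma cnorm_convex x y (t : R) r : 0 <= t <= 1 -> cnorm x < r -> cnorm (x + y) < r ->
  cnorm (x + t%:C *: y) < r.
Proof.
move=> /andP[t0 t1] xr yr.
have -> : x + t%:C *: y = (1 - t)%:C *: x + t%:C *: (x + y).
  by rewrite scalerDr addrA -scalerDl -rmorphD subrK scale1r.
apply: le_lt_trans (cnormD _ _) _; rewrite !cnormZ.
have nR (s : R) : 0 <= s -> normc s%:C = s.
  by move=> s0; rewrite /= expr0n addr0 sqrtr_sqr ger0_norm.
rewrite !nR ?subr_ge0//.
have [->|t0'] := eqVneq t 0; first by rewrite subr0 mul1r mul0r addr0.
have tp : 0 < t by rewrite lt_neqAle eq_sym t0'.
have : t * cnorm (x + y) < t * r by rewrite ltr_pM2l.
have : (1 - t) * cnorm x <= (1 - t) * r by rewrite ler_wpM2l ?subr_ge0// ltW.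
lra.
Qed.

Lemma holomorphic_lipschitz f x r K u :
  (forall y, cnorm (y - x) < r -> differentiable f y) ->
  (forall y v, cnorm (y - x) < r -> normc ('d f y v) <= K * cnorm v) ->
  forall y, cnorm (y - x) < r -> cnorm (y + u - x) < r ->
  normc (f (y + u) - f y) <= K * cnorm u.
Proof.
move=> df bf y yr yur.
have inB (t : R) : 0 <= t <= 1 -> cnorm (y + t%:C *: u - x) < r.
  by move=> tI; rewrite addrAC cnorm_convex// addrAC.
have := @mvt_complex (fun s : C => f (y + s *: u)) (K * cnorm u).
rewrite scale1r scale0r addr0; apply => t /inB tB.
  by have [] := diff_line (df _ tB).
by have [_ ->] := diff_line (df _ tB); exact: bf.
Qed.

(** Two Cauchy estimates, whence 256 = 16^2. The first makes f Lipschitz, so that the difference of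
    f and its translate by t h is of size |h|; the second, applied to this difference, bounds the
    variation of the differential along the segment by a multiple of |h|^2. The mean value
    inequality concludes. *)
Lemma holomorphic_second_order f x r M h : 0 < r ->
  bounded_holomorphic f x (3 * r) M -> cnorm h < r ->
  normc (f (x + h) - f x - 'd f x h) <= 256 * M / r ^+ 2 * cnorm h ^+ 2.
Proof.
move=> r0 bf hr.
have M0 : 0 <= M.
  have [|_] := bf x; first by rewrite subrr cnorm0 mulr_gt0.
  by apply: le_trans; exact: normc_ge0.
have df y : cnorm (y - x) < 2 * r -> differentiable f y.
  by move=> yr; have [|] := bf y; rewrite // (lt_trans yr)// ltr_pM2r// ltr_nat.
have d1 y v : cnorm (y - x) < 2 * r -> normc ('d f y v) <= 16 * M / r * cnorm v.
  move=> yr; apply: cauchy_estimate_dir => // z zr; apply: bf.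
  have -> : z - x = (z - y) + (y - x) by rewrite addrA subrK.
  by apply: le_lt_trans (cnormD _ _) _; lra.
have lip y u : cnorm (y - x) < 2 * r -> cnorm (y + u - x) < 2 * r ->
    normc (f (y + u) - f y) <= 16 * M / r * cnorm u.
  exact: holomorphic_lipschitz.
have nR (s : R) : 0 <= s -> normc s%:C = s.
  by move=> s0; rewrite /= expr0n addr0 sqrtr_sqr ger0_norm.
have thr (t : R) : 0 <= t <= 1 -> cnorm (t%:C *: h) <= cnorm h.
  move=> /andP[t0 t1]; rewrite cnormZ nR//.
  by rewrite -[leRHS]mul1r ler_wpM2r// cnorm_ge0.
have d2 (t : R) : 0 <= t <= 1 -> normc ('d f (x + t%:C *: h) h - 'd f x h) <=
    256 * M / r ^+ 2 * cnorm h ^+ 2.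
  move=> tI; pose w := t%:C *: h.
  have wr : cnorm w < r by exact: le_lt_trans (thr _ tI) hr.
  have dsh y : cnorm (y - x) < r -> differentiable (f \o shift w) y.
    move=> yr; apply: differentiable_comp => //.
    by apply: df; rewrite /= addrAC; apply: le_lt_trans (cnormD _ _) _; lra.
  have dfy y : cnorm (y - x) < r -> differentiable f y.
    by move=> yr; apply: df; lra.
  pose k : V -> C := (f \o shift w) - f.
  have xx : cnorm (x - x) < r by rewrite subrr cnorm0.
  have dkE : 'd k x h = 'd f (x + w) h - 'd f x h.
    have dfw : differentiable f (x + w).
      by apply: df; rewrite addrAC subrr add0r; lra.
    have [_ <-] := diff_shift h dfw.
    exact: (diffB_at h (dsh _ xx) (dfy _ xx)).
  have bk : bounded_holomorphic k x r (16 * M / r * cnorm h).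
    move=> y yr; split; first by apply: differentiableB; [exact: dsh|exact: dfy].
    apply: (@le_trans _ _ (16 * M / r * cnorm w)).
      apply: lip; first by lra.
      by rewrite addrAC; apply: le_lt_trans (cnormD _ _) _; lra.
    by rewrite ler_wpM2l ?thr// divr_ge0 ?mulr_ge0// ltW.
  rewrite -dkE; apply: (le_trans (cauchy_estimate_dir h r0 bk)).
  rewrite le_eqVlt; apply/orP; left; apply/eqP; field; rewrite gt_eqF//.
pose F (s : C) : C := f (x + s *: h).
pose G (s : C) : C := s *: ('d f x h : C).
pose phi : C -> C := F - G.
have inB (t : R) : 0 <= t <= 1 -> cnorm (x + t%:C *: h - x) < 2 * r.
  by move=> tI; rewrite addrAC subrr add0r; apply: le_lt_trans (thr _ tI) _; lra.
have phiD (t : R) : 0 <= t <= 1 -> differentiable phi (t%:C : C) /\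
    'd phi (t%:C : C) 1 = 'd f (x + t%:C *: h) h - 'd f x h.
  move=> /inB/df dt.
  have [g1 g2] : differentiable F (t%:C : C) /\
    'd F (t%:C : C) 1 = 'd f (x + t%:C *: h) h by exact: diff_line.
  have [l1 l2] : differentiable G (t%:C : C) /\ 'd G (t%:C : C) 1 = 'd f x h.
    exact: diff_scalev.
  split; first exact: differentiableB.
  have HH : 'd phi (t%:C : C) 1 = 'd F (t%:C : C) 1 - 'd G (t%:C : C) 1.
    exact: (diffB_at (1 : C) g1 l1).
  exact: (etrans HH (congr2 (fun a b : C => a - b) g2 l2)).
have phiE : phi 1 - phi 0 = f (x + h) - f x - 'd f x h.
  rewrite /phi !fctE /F /G scale1r scale0r addr0 scale0r subr0 addrAC.
  by congr (_ - _ - _); rewrite scale1r.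
rewrite -phiE; apply: mvt_complex => t tI; have [dt dE] := phiD t tI => //.
by rewrite dE; exact: d2.
Qed.

End SeveralVariables.

Section HolomorphicDerivative.
Variable R : realType.
Local Notation C := (R[i])^o.
Local Notation normc := Normc.normc.

Lemma le_small (X Y K c : R) : 0 < c -> (forall t, 0 < t <= c -> X <= Y + K * t) -> X <= Y.
Proof.
move=> c0 H; apply/ler_addgt0Pr => e e0.
have K1 : 0 < `|K| + 1 by rewrite ltr_wpDl.
pose t := Num.min c (e / (`|K| + 1)).
have t0 : 0 < t by rewrite lt_min c0 divr_gt0.
apply: (le_trans (H t _)); first by rewrite t0 ge_min lexx.
rewrite lerD2l; apply: (@le_trans _ _ ((`|K| + 1) * t)).
  by rewrite ler_wpM2r ?(ltW t0)// (le_trans (ler_norm _))// lerDl.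
by rewrite mulrC -ler_pdivlMr// ge_min lexx orbT.
Qed.

(** The limit at 0 is the supremum of the lower bounds a t - K t, each of which lies below every a s
    + K s. *)
Lemma real_family_limit (a : R -> R) (c K : R) : 0 < c ->
  (forall s t, 0 < s <= c -> 0 < t <= c -> `|a s - a t| <= K * (s + t)) ->
  exists l, forall t, 0 < t <= c -> `|a t - l| <= K * t.
Proof.
move=> c0 H; pose E := [set a t - K * t | t in [set t | 0 < t <= c]].
have cI : 0 < c <= c by rewrite c0 lexx.
have ub t : 0 < t <= c -> ubound E (a t + K * t).
  by move=> tI _ [s sI <-]; have := H s t sI tI; rewrite ler_norml => /andP[_]; lra.
exists (sup E) => t tI.
have lo : a t - K * t <= sup E.
  by apply: ub_le_sup; [exists (a c + K * c); exact: ub|exists t].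
have hi : sup E <= a t + K * t.
  by apply: ge_sup (ub t tI); exists (a c - K * c), c.
by rewrite ler_norml; apply/andP; split; lra.
Qed.

Lemma complex_family_limit (a : R -> R[i]) (c K : R) : 0 < c ->
  (forall s t, 0 < s <= c -> 0 < t <= c -> normc (a s - a t) <= K * (s + t)) ->
  exists l, forall t, 0 < t <= c -> normc (a t - l) <= 2 * K * t.
Proof.
move=> c0 H.
have [|x Hx] := @real_family_limit (fun t => complex.Re (a t)) c K c0.
  move=> s t sI tI; apply: le_trans (H s t sI tI); apply: le_trans (Re_le_normc _).
  by case: (a s) (a t) => ? ? [].
have [|y Hy] := @real_family_limit (fun t => complex.Im (a t)) c K c0.
  move=> s t sI tI; apply: le_trans (H s t sI tI); apply: le_trans (Im_le_normc _).
  by case: (a s) (a t) => ? ? [].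
exists (x +i* y) => t tI; move: (Hx t tI) (Hy t tI); case: (a t) => u v /= hu hv.
by apply: le_trans (normc_le_add _ _) _; lra.
Qed.

Variable V : normedModType R[i].
Implicit Types (x y h u v : V).

Definition diffquot (f : V -> C) (v : V) (t : R) (y : V) : C :=
  (t%:C)^-1 * (f (y + t%:C *: v) - f y).

Lemma diffZ_at (W : normedModType R[i]) (f : W -> C) k (x h : W) :
  differentiable f x -> differentiable (k *: f) x /\
  'd (k *: f) x h = k * 'd f x h.
Proof.
move=> df; split; first exact: differentiableZ.
exact: (congr1 (fun F : W -> C => F h) (diffZ k df)).
Qed.

Lemma diff_diffquot (f : V -> C) v (t : R) y h :
  differentiable f y -> differentiable f (y + t%:C *: v) ->
  differentiable (diffquot f v t) y /\
  'd (diffquot f v t) y h = (t%:C)^-1 * ('d f (y + t%:C *: v) h - 'd f y h).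
Proof.
move=> df dfv; pose k : V -> C := (f \o shift (t%:C *: v)) - f.
have [ds dsE] := diff_shift h dfv.
have dk : differentiable k y by exact: differentiableB.
have [dq dqE] := diffZ_at (t%:C)^-1 h dk.
split; first exact: dq.
apply: (etrans dqE); congr (_ * _).
apply: (etrans (diffB_at h ds df)).
exact: (congr1 (fun a : C => a - 'd f y h) dsE).
Qed.

(** The derivative in direction v is the limit of the difference quotients q_t, at a rate K1 t that
    is uniform near x. The q_t are holomorphic, so a Cauchy estimate for q_s - q_t shows that their
    differentials at x converge. The limit A is the differential sought, because the second-order
    remainder of q_t is bounded independently of t. *)
Theorem holomorphic_diff (f : V -> C) x v :
  (\forall y \near x, differentiable f y) ->
  differentiable (fun y => 'd f y v : C) x.
Proof.
move=> /nbhs_cnormP[r1 r10 Hr1].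
have : \forall y \near x, normc (f y) <= normc (f x) + 1.
  have /differentiable_continuous/cvgrPdist_lt/(_ 1 ltr01) : differentiable f x.
    by apply: Hr1; rewrite subrr cnorm0.
  apply: filterS => y; rewrite cnormE -[1 in X in X -> _]/(1%:C) ltcR cnorm_normc => yx.
  have -> : f y = f x - (f x - f y) by rewrite subKr.
  apply: le_trans (le_normcD _ _) _; rewrite lerD2l normcN ltW//.
move=> /nbhs_cnormP[r2 r20 Hr2]; set M := normc (f x) + 1 in Hr2.
(* The factor 8 leaves room for balls of radius 3 r around points at distance less than 4 r from
   x. *)
pose r := Num.min r1 r2 / 8.
have r0 : 0 < r by rewrite divr_gt0// lt_min r10 r20.
have bf0 y : cnorm (y - x) < 8 * r -> differentiable f y /\ normc (f y) <= M.
  rewrite /r mulrCA divff// mulr1 lt_min => /andP[y1 y2].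
  by split; [exact: Hr1|exact: Hr2].
clearbody r.
have bf y : cnorm (y - x) < 4 * r -> bounded_holomorphic f y (3 * r) M.
  move=> yx z zy; apply: bf0; have -> : z - x = (z - y) + (y - x) by rewrite addrA subrK.
  by apply: le_lt_trans (cnormD _ _) _; lra.
have M0 : 0 <= M by rewrite /M addr_ge0 ?normc_ge0.
pose nu := cnorm v; have nu0 : 0 <= nu := cnorm_ge0 _.
pose c := r / (nu + 1).
have nu1 : 0 < nu + 1 by rewrite ltr_wpDl.
have c0 : 0 < c by rewrite divr_gt0.
have nR (s : R) : 0 <= s -> normc s%:C = s.
  by move=> s0; rewrite /= expr0n addr0 sqrtr_sqr ger0_norm.
have tv t : 0 < t <= c -> cnorm (t%:C *: v) = t * nu /\ t * nu < r.
  move=> /andP[t0 tc]; rewrite cnormZ nR ?ltW//; split => //.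
  have : t * (nu + 1) <= r by rewrite -ler_pdivlMr.
  lra.
pose q := diffquot f v.
pose g y : C := 'd f y v.
pose K1 := 256 * M / r ^+ 2 * nu ^+ 2.
have K10 : 0 <= K1 by rewrite !mulr_ge0 ?invr_ge0 ?exprn_ge0 ?(ltW r0).
have q_g t y : 0 < t <= c -> cnorm (y - x) < 4 * r -> normc (q t y - g y) <= K1 * t.
  move=> tI yx; have [tvE tvr] := tv t tI; have /andP[t0 _] := tI.
  have tC0 : t%:C != 0 :> R[i] by rewrite (inj_eq (@complexI R) _ 0) gt_eqF.
  have := holomorphic_second_order r0 (bf y yx); move=> /(_ (t%:C *: v)).
  rewrite tvE => /(_ tvr); have -> : 'd f y (t%:C *: v) = t%:C * g y by rewrite linearZ.
  move=> Hq; have -> : q t y - g y =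
      (t%:C)^-1 * (f (y + t%:C *: v) - f y - t%:C * g y).
    by rewrite mulrBr [X in _ = _ - X]mulrA mulVf// mul1r.
  rewrite Normc.normcM Normc.normcV nR ?(ltW t0)// ler_pdivrMl//.
  apply: le_trans Hq _; rewrite /K1 le_eqVlt; apply/orP; left; apply/eqP. ring.
have qd t y h : 0 < t <= c -> cnorm (y - x) < 4 * r ->
    differentiable (q t) y /\
    'd (q t) y h = (t%:C)^-1 * ('d f (y + t%:C *: v) h - 'd f y h).
  move=> tI yx; have [tvE tvr] := tv t tI; apply: diff_diffquot.
    by have [] := bf0 y; rewrite // (lt_le_trans yx)// ler_pM2r// ler_nat.
  have [] := bf0 (y + t%:C *: v) => //.
  by rewrite addrAC; apply: le_lt_trans (cnormD _ _) _; lra.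
pose a h t : C := 'd (q t) x h.
have xx s : 0 < s -> cnorm (x - x) < s by rewrite subrr cnorm0.
have r4 : 0 < 4 * r by rewrite mulr_gt0.
have aE h s t : 0 < s <= c -> 0 < t <= c ->
    normc (a h s - a h t) <= 16 * K1 / r * cnorm h * (s + t).
  move=> sI tI; pose k : V -> C := q s - q t.
  have [ds _] := qd s x h sI (xx _ r4); have [dt _] := qd t x h tI (xx _ r4).
  have <- : 'd k x h = a h s - a h t by exact: diffB_at.
  have bk : bounded_holomorphic k x r (K1 * (s + t)).
    move=> y yr; have yr4 : cnorm (y - x) < 4 * r by lra.
    have [dsy _] := qd s y h sI yr4; have [dty _] := qd t y h tI yr4.
    split; first exact: differentiableB.
    have -> : k y = (q s y - g y) - (q t y - g y) by rewrite opprB addrA subrK.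
    apply: le_trans (le_normcD _ _) _; rewrite normcN mulrDr.
    by rewrite lerD// q_g.
  apply: le_trans (cauchy_estimate_dir h r0 bk) _.
  rewrite le_eqVlt; apply/orP; left; apply/eqP; ring.
(* [A0] h is the limit of the differentials of the q_t at x in direction h; it is the candidate for
   the second derivative. *)
have /choice[A0 HA0] : forall h, exists l, forall t, 0 < t <= c ->
    normc (a h t - l) <= 2 * (16 * K1 / r * cnorm h) * t.
  by move=> h; apply: complex_family_limit => //; exact: aE.
have a_lin t k u w : a (k *: u + w) t = k * a u t + a w t.
  exact: (linearP ('d (q t) x) k u w).
have A0lin : linear (A0 : V -> C).
  move=> k u w; apply/eqP; rewrite -subr_eq0 -normc_eq0.
  rewrite eq_le normc_ge0 andbT.
  pose L h := 2 * (16 * K1 / r * cnorm h).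
  apply: (@le_small _ _ (L (k *: u + w) + normc k * L u + L w) c) => // t tI.
  have -> : A0 (k *: u + w) - (k *: (A0 u : C) + A0 w) =
     - (a (k *: u + w) t - A0 (k *: u + w))
     + (k * (a u t - A0 u) + (a w t - A0 w)).
    rewrite a_lin; have -> : k *: (A0 u : C) = k * A0 u by []. ring.
  apply: le_trans (le_normcD _ _) _; rewrite normcN add0r !mulrDl -addrA lerD ?HA0//.
  apply: le_trans (le_normcD _ _) _; rewrite lerD ?HA0// Normc.normcM -mulrA.
  by rewrite ler_wpM2l ?normc_ge0 ?HA0.
pose aM := GRing.isLinear.Build R[i] V C *:%R A0 A0lin.
pose A : {linear V -> C} := HB.pack (A0 : V -> C) aM.
pose M' := K1 * c + 16 * M / r * nu.
have q_bound t : 0 < t <= c -> bounded_holomorphic (q t) x (3 * r) M'.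
  move=> tI y yr; have yr4 : cnorm (y - x) < 4 * r by lra.
  have [dq _] := qd t y 0 tI yr4; split => //.
  have -> : q t y = (q t y - g y) + g y by rewrite subrK.
  apply: le_trans (le_normcD _ _) _; rewrite lerD//.
    apply: (le_trans (q_g _ _ tI yr4)); rewrite ler_wpM2l//; by case/andP: tI.
  apply: cauchy_estimate_dir => // z zr.
  by apply: (bf y yr4); lra.
have cI : 0 < c <= c by rewrite c0 lexx.
have Abound h : cnorm (A h : C) <= (32 * K1 / r * c + 16 * M' / (3 * r)) * cnorm h.
  have -> : A h = - (a h c - A0 h) + a h c by rewrite opprB subrK.
  apply: le_trans (cnormD _ _) _; rewrite cnormN !cnorm_normc mulrDl lerD//.
    apply: (le_trans (HA0 h c cI)).
    rewrite le_eqVlt; apply/orP; left; apply/eqP; ring.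
  by apply: cauchy_estimate_dir; [rewrite mulr_gt0|exact: q_bound].
have [|dg _] := @cnorm_diff _ _ _ g x A _ Abound; last exact: dg.
move=> e e0; pose K2 := 256 * M' / r ^+ 2.
have K21 : 0 < `|K2| + 1 by rewrite ltr_wpDl.
exists (Num.min r (e / (`|K2| + 1))); first by rewrite lt_min r0 divr_gt0.
move=> h; rewrite lt_min => /andP[hr he]; rewrite cnorm_normc.
have h0 := cnorm_ge0 h.
have xh : cnorm (x + h - x) < 4 * r by rewrite addrAC subrr add0r; lra.
(* The errors of order t from replacing [g] by q_t and [A] by the differential of q_t disappear as t
   tends to 0. *)
apply: (@le_small _ _ (2 * K1 + 32 * K1 / r * cnorm h) c) => // t tI.
have -> : g (x + h) - g x - A h =
   (q t (x + h) - q t x - a h t) - (q t (x + h) - g (x + h))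
   + (q t x - g x) + (a h t - A h).
  ring.
have B1 := holomorphic_second_order r0 (q_bound t tI) hr.
have B2 := q_g _ _ tI xh; have B3 := q_g _ _ tI (xx _ r4); have B4 := HA0 h t tI.
apply: (@le_trans _ _ (K2 * cnorm h ^+ 2 + K1 * t + K1 * t +
    2 * (16 * K1 / r * cnorm h) * t)).
  apply: le_trans (le_normcD _ _) _; apply: lerD; last exact: B4.
  apply: le_trans (le_normcD _ _) _; apply: lerD; last exact: B3.
  apply: le_trans (le_normcD _ _) _; rewrite normcN; apply: lerD; last exact: B2.
  exact: B1.
have : K2 * cnorm h ^+ 2 <= e * cnorm h.
  rewrite expr2 mulrA ler_wpM2r//; apply: (@le_trans _ _ ((`|K2| + 1) * cnorm h)).
    by rewrite ler_wpM2r// (le_trans (ler_norm _))// lerDl.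
  by rewrite mulrC -ler_pdivlMr// ltW.
lra.
Qed.

End HolomorphicDerivative.

(** * Chain rule for a holomorphic function along a real differentiable map *)

Section MixedChainRule.
Variable R : realType.
Local Notation C := (R[i])^o.
Local Notation normc := Normc.normc.

Lemma eps_diff_near (V W : normedModType R) (f : V -> W) x (A : {linear V -> W}) K :
  (forall h, `|A h| <= K * `|h|) ->
  (forall e : R, 0 < e ->
    \forall h \near (0 : V), `|f (x + h) - f x - A h| <= e * `|h|) ->
  differentiable f x /\ 'd f x = A :> (V -> W).
Proof.
move=> AK H; apply: (eps_diff AK) => e /H/nbhs_ballP[r /= r0 Hr].
by exists r => // h hr; apply: Hr; rewrite -ball_normE/= sub0r normrN.
Qed.

Lemma diff_near (V W : normedModType R) (f : V -> W) x :
  differentiable f x -> forall e : R, 0 < e ->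
  \forall h \near (0 : V), `|f (x + h) - f x - 'd f x h| <= e * `|h|.
Proof.
move=> df e e0; have [r r0 Hr] := diff_epsP df e0.
apply/nbhs_ballP; exists r => // h.
by rewrite -ball_normE/= sub0r normrN; exact: Hr.
Qed.

Lemma cnorm_row_le m (w : Cspace R m) : cnorm w <= \sum_j normc (w 0 j).
Proof.
have [->|w0] := eqVneq w 0.
  by rewrite cnorm0; apply: sumr_ge0 => j _; exact: normc_ge0.
have /mx_norm_neq0[[i j] /= wE] : mx_norm w != 0.
  by apply: contra w0 => /eqP/mx_norm_eq0 ->.
have -> : cnorm w = normc (w 0 j).
  by rewrite /cnorm -[`|w|]/(mx_norm w) wE ord1.
by rewrite (bigD1 j)//= lerDl sumr_ge0// => k _; exact: normc_ge0.
Qed.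

Lemma cnorm_row_ge m (w : Cspace R m) j : normc (w 0 j) <= cnorm w.
Proof.
rewrite -lecR -cnormE -[X in X <= _]/(`|w 0 j : R[i]^o|) -[X in _ <= X]/(mx_norm w).
rewrite mx_normE -[leLHS]nngE num_le.
exact: (le_bigmax _ (fun ij : 'I_1 * 'I_m => `|w ij.1 ij.2|%:nng) (0, j)).
Qed.

Variable V : normedModType R.

Section Chain.
Variables (m : nat) (pt : V -> Cspace R m) (p : V).
Hypothesis dRe : forall j, differentiable (fun q => complex.Re (pt q 0 j) : R^o) p.
Hypothesis dIm : forall j, differentiable (fun q => complex.Im (pt q 0 j) : R^o) p.

Let D (v : V) : Cspace R m := \row_j
  (('d (fun q => complex.Re (pt q 0 j) : R^o) p v) +i*
   ('d (fun q => complex.Im (pt q 0 j) : R^o) p v)).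

Let D_lin (k : R) u v : D (k *: u + v) = k%:C *: D u + D v.
Proof.
apply/rowP => j.
have DE w : D w 0 j = ('d (fun q => complex.Re (pt q 0 j) : R^o) p w) +i*
   ('d (fun q => complex.Im (pt q 0 j) : R^o) p w) by exact: mxE.
have rowE (w w' : Cspace R m) c : (c *: w + w') 0 j = c * w 0 j + w' 0 j by rewrite !mxE.
have alg (a b c d : R) : (k * a + c) +i* (k * b + d) = k%:C * (a +i* b) + (c +i* d).
  by apply/eqP; rewrite eq_complex /= !mul0r subr0 addr0 !eqxx.
rewrite rowE !DE; apply: etrans (alg _ _ _ _).
exact: (congr2 (@Complex R) (linearP _ k u v) (linearP _ k u v)).
Qed.

Let D_bound : exists2 K, 0 < K & forall v, cnorm (D v) <= K * `|v|.
Proof.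
have H j : exists K, forall v, normc (D v 0 j) <= K * `|v| /\ 0 < K.
  have [k1 k10 H1] := linear_lipschitz (diff_continuous (dRe j)).
  have [k2 k20 H2] := linear_lipschitz (diff_continuous (dIm j)).
  exists (k1 + k2) => v; split; last exact: addr_gt0.
  rewrite mxE; apply: le_trans (normc_le_add _ _) _.
  by rewrite mulrDl; exact: lerD (H1 v) (H2 v).
have [K HK] := choice H.
exists (1 + \sum_j K j).
  by rewrite ltr_pwDl// sumr_ge0// => j _; have [_ /ltW] := HK j 0.
move=> v; apply: le_trans (cnorm_row_le _) _; rewrite mulrDl mul1r.
apply: (@le_trans _ _ (\sum_j (K j * `|v|))).
  by apply: ler_sum => j _; have [] := HK j v.
by rewrite mulr_suml lerDr.
Qed.

Let D_near e : 0 < e ->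
  \forall h \near (0 : V), cnorm (pt (p + h) - pt p - D h) <= e * `|h|.
Proof.
move=> e0; pose e' := e / (2 * m.+1%:R).
have e'0 : 0 < e' by rewrite divr_gt0// mulr_gt0.
have H : \forall h \near (0 : V), forall j : 'I_m,
    normc ((pt (p + h) - pt p - D h) 0 j) <= 2 * e' * `|h|.
  apply: filter_forall => j.
  have := diff_near (dIm j) e'0; have := diff_near (dRe j) e'0.
  apply: filterS2 => h h1 h2; rewrite !mxE.
  apply: (@le_trans _ _ (e' * `|h| + e' * `|h|)); last by rewrite -mulrDl -mulr2n mulr_natl.
  apply: le_trans (lerD h1 h2).
  by case: (pt (p + h) 0 j) (pt p 0 j) => [a b] [c d]; exact: normc_le_add.
apply: filterS H => h Hh; apply: le_trans (cnorm_row_le _) _.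
apply: (@le_trans _ _ (\sum_(j < m) (2 * e' * `|h|))); first by apply: ler_sum.
rewrite sumr_const card_ord -[_ *+ m]mulr_natr.
apply: (@le_trans _ _ (2 * e' * `|h| * m.+1%:R)).
  by rewrite ler_wpM2l ?ler_nat// mulr_ge0 ?mulr_ge0// ltW.
rewrite le_eqVlt; apply/orP; left; apply/eqP; rewrite /e'; field.
by rewrite addrC natr1 pnatr_eq0.
Qed.

(** The outer map is differentiable over R[i] and the inner one over R, so the remainders are
    estimated explicitly. [D] is the real differential of [pt], assembled from the real and
    imaginary parts of its coordinates. *)
Lemma mixed_chain (H : Cspace R m -> C) : differentiable H (pt p) ->
  differentiable (fun q => complex.Re (H (pt q)) : R^o) p /\
  forall v, 'D_v (fun q => complex.Re (H (pt q)) : R^o) p =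
    complex.Re ('d H (pt p) (\row_j
      ('D_v (fun q => complex.Re (pt q 0 j) : R^o) p +i*
       'D_v (fun q => complex.Im (pt q 0 j) : R^o) p))).
Proof.
move=> dH.
have [K K0 DK] := D_bound.
have [L L0 HL] : exists2 L, 0 < L & forall w, normc ('d H (pt p) w) <= L * cnorm w.
  have [l l0 Hl] := linear_lipschitz (diff_continuous dH).
  exists (complex.Re l); first exact: gt0_Re.
  move=> w; have := Hl w; rewrite cnormE [`|w|]cnormE -(RRe_real (gtr0_real l0)).
  by rewrite -rmorphM lecR.
pose A0 v : R^o := complex.Re ('d H (pt p) (D v)).
have A0lin : linear A0.
  move=> k u v; rewrite /A0 D_lin linearP.
  by move: ('d H _ _) ('d H _ _) => [a b] [c d] /=; rewrite mul0r subr0.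
pose aM := GRing.isLinear.Build R V R^o *:%R A0 A0lin.
pose A : {linear V -> R^o} := HB.pack A0 aM.
have Abound h : `|A h| <= (L * K) * `|h|.
  apply: le_trans (Re_le_normc _) _; apply: le_trans (HL _) _.
  by rewrite -mulrA ler_wpM2l// ltW.
have [|dk dkE] := @eps_diff_near _ _ (fun q => complex.Re (H (pt q)) : R^o) p A _ Abound.
  move=> e e0; have e1 : 0 < e / (2 * (K + 1)) by rewrite divr_gt0// mulr_gt0// addr_gt0.
  have [r r0 Hr] := diff_cnormP dH e1.
  have e2 : 0 < Num.min 1 (e / (2 * L)).
    by rewrite lt_min ltr01 divr_gt0// mulr_gt0.
  have N1 := D_near e2.
  have N2 : \forall h \near (0 : V), `|h| < r / (K + 1).
    apply/nbhs_ballP; exists (r / (K + 1)); first by rewrite /= divr_gt0// addr_gt0.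
    by move=> h; rewrite -ball_normE/= sub0r normrN.
  near=> h.
  have hN1 : cnorm (pt (p + h) - pt p - D h) <= Num.min 1 (e / (2 * L)) * `|h|.
    by near: h.
  have hr : `|h| * (K + 1) < r by rewrite -ltr_pdivlMr ?addr_gt0//; near: h.
  pose w := pt (p + h) - pt p.
  have w1 : cnorm w <= (K + 1) * `|h|.
    have -> : w = (w - D h) + D h by rewrite subrK.
    apply: le_trans (cnormD _ _) _; rewrite mulrDl mul1r addrC lerD//.
    by apply: le_trans hN1 _; rewrite -[leRHS]mul1r ler_wpM2r// ge_min lexx.
  have := Hr w; rewrite {1}/w => /(_ (le_lt_trans w1 _)); rewrite mulrC => /(_ hr).
  rewrite /w addrCA subrr addr0 -/w cnorm_normc => Hw.
  have Hd : normc ('d H (pt p) (w - D h)) <= e / 2 * `|h|.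
    apply: le_trans (HL _) _; apply: le_trans (ler_wpM2l (ltW L0) hN1) _.
    rewrite mulrA ler_wpM2r//; apply: (@le_trans _ _ (L * (e / (2 * L)))).
      by rewrite ler_wpM2l ?(ltW L0)// ge_min lexx orbT.
    by rewrite le_eqVlt; apply/orP; left; apply/eqP; field; rewrite gt_eqF.
  have Hw' : normc (H (pt (p + h)) - H (pt p) - 'd H (pt p) w) <= e / 2 * `|h|.
    apply: le_trans Hw _.
    apply: (@le_trans _ _ (e / (2 * (K + 1)) * ((K + 1) * `|h|))).
      by rewrite ler_wpM2l// ltW.
    rewrite mulrA ler_wpM2r// le_eqVlt; apply/orP; left; apply/eqP; field.
    by rewrite gt_eqF// addr_gt0.
  have E : complex.Re (H (pt (p + h))) - complex.Re (H (pt p)) - A h =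
     complex.Re ((H (pt (p + h)) - H (pt p) - 'd H (pt p) w) + 'd H (pt p) (w - D h)).
    have -> : 'd H (pt p) (w - D h) = 'd H (pt p) w - 'd H (pt p) (D h) by rewrite linearB.
    rewrite addrA subrK /A /= /A0.
    by move: (H _) (H _) ('d H _ _) => [? ?] [? ?] [? ?].
  rewrite E; apply: le_trans (Re_le_normc _) _; apply: le_trans (le_normcD _ _) _.
  by rewrite [e]splitr mulrDl lerD.
split=> // v; rewrite deriveE// dkE /A /= /A0; congr (complex.Re ('d H (pt p) _)).
by apply/rowP => j; rewrite !mxE !deriveE.
Unshelve. all: by end_near. Qed.

End Chain.

End MixedChainRule.

(** * Smooth functions of (z, u) *)


(* ssrnat also has an iterD. *)
Local Notation iterD := Defs.iterD.

Section SmoothOn.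
Variable R : realType.
Variable V : normedModType R.
Implicit Types (U : set V) (k : V -> R^o) (p v : V).

Lemma bounded_linear_diff k p (K : R) : linear k -> (forall v, `|k v| <= K * `|v|) ->
  differentiable k p /\ forall v, 'D_v k p = k v.
Proof.
move=> kl kK; pose aM := GRing.isLinear.Build R V R^o *:%R k kl.
pose A : {linear V -> R^o} := HB.pack k aM.
have [|dk dE] := @eps_diff_near _ _ _ k p A K kK.
  move=> e e0; near=> h; have -> : k (p + h) - k p - A h = 0.
    by rewrite -[k]/(A : V -> R^o) linearD -addrA -opprD subrr.
  by rewrite normr0 mulr_ge0// ltW.
by split => // v; rewrite deriveE// dE.
Unshelve. all: by end_near. Qed.

Lemma near_eq_diff k1 k2 p :
  (\forall q \near p, k1 q = k2 q) -> differentiable k1 p -> differentiable k2 p.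
Proof.
move=> E dk; have [K _ HK] := linear_lipschitz (diff_continuous dk).
have [|//] := @eps_diff_near _ _ _ k2 p ('d k1 p) K HK.
move=> e e0; have H := diff_near dk e0.
have E0 := nbhs_singleton E.
have : \forall h \near (0 : V), k1 (p + h) = k2 (p + h).
  have /nbhs_ballP[r /= r0 Hr] := E; apply/nbhs_ballP; exists r => // h.
  rewrite -ball_normE/= sub0r normrN => hr; apply: Hr.
  by rewrite -ball_normE/= opprD addrA subrr add0r normrN.
by apply: filterS2 H => h Hh <-; rewrite -E0.
Qed.

Definition smooth_on U k := forall vs p, U p -> differentiable (iterD vs k) p.

Lemma smooth_on_diff U k p : smooth_on U k -> U p -> differentiable k p.
Proof. by move=> sk; exact: (sk [::]). Qed.

Lemma iterD_rcons vs v k : iterD (rcons vs v) k = iterD vs ('D_v k).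
Proof. by rewrite /iterD foldr_rcons. Qed.

Lemma smooth_on_derive U k v : smooth_on U k -> smooth_on U ('D_v k).
Proof. by move=> sk vs p Up; rewrite -iterD_rcons; exact: sk. Qed.

Lemma smooth_on_sub U U' k : U' `<=` U -> smooth_on U k -> smooth_on U' k.
Proof. by move=> sU sk vs p /sU; exact: sk. Qed.

Lemma open_near U p (P : V -> Prop) : open U -> (forall q, U q -> P q) -> U p ->
  \forall q \near p, P q.
Proof. by move=> oU UP Up; exact: filterS UP (open_nbhs_nbhs (conj oU Up)). Qed.

Lemma iterD_coinduction (F : (V -> R^o) -> Prop) U : open U ->
  (forall k, F k -> forall v, exists2 k', F k' & forall p, U p -> 'D_v k p = k' p) ->
  forall k vs, F k -> exists2 k', F k' & forall p, U p -> iterD vs k p = k' p.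
Proof.
move=> oU DF k vs Fk; elim: vs => [|v vs [k1 Fk1 E1]]; first by exists k.
have [k2 Fk2 E2] := DF _ Fk1 v; exists k2 => // p Up.
rewrite -E2//=; apply: near_eq_derive; exact: (open_near oU _ Up).
Qed.

(** Smoothness by a closed class: if all members of [F] are differentiable on U and their
    directional derivatives agree on U with members of [F], all iterated derivatives are
    differentiable. Openness of U allows such an equality to be differentiated again. *)
Lemma smooth_coinduction (F : (V -> R^o) -> Prop) U : open U ->
  (forall k, F k -> forall p, U p -> differentiable k p) ->
  (forall k, F k -> forall v, exists2 k', F k' & forall p, U p -> 'D_v k p = k' p) ->
  forall k, F k -> smooth_on U k.
Proof.
move=> oU dF DF k Fk vs p Up; have [k' Fk' E] := iterD_coinduction oU DF vs Fk.
apply: (@near_eq_diff k'); last exact: dF.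
by apply: (open_near oU _ Up) => q /E.
Qed.

Lemma eq_smooth_on U k1 k2 : open U -> (forall p, U p -> k1 p = k2 p) ->
  smooth_on U k1 -> smooth_on U k2.
Proof.
move=> oU E sk; apply: (@smooth_coinduction
    (fun k => exists2 k', smooth_on U k' & forall p, U p -> k' p = k p)) => //.
- move=> k [k' sk' Ek] p Up; apply: (@near_eq_diff k').
    exact: (open_near oU _ Up).
  exact: smooth_on_diff sk' Up.
- move=> k [k' sk' Ek] v; exists ('D_v k'); first by exists ('D_v k') => //; exact: smooth_on_derive.
  by move=> p Up; apply/esym/near_eq_derive; exact: (open_near oU _ Up).
- by exists k1.
Qed.

End SmoothOn.

Section ZuSpace.
Variables (R : realType) (n : nat).
Local Notation C := (R[i])^o.
Local Notation normc := Normc.normc.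
Local Notation zu := (zu_space R n).
Local Notation Cn := (Cspace R n.+1).
Implicit Types (U : set zu) (k : zu -> R^o) (p v : zu) (Om : set Cn).

(** The real linear embedding of (z, u) into C^(n+1) as the point (z, w) with w = u. *)
Definition emb v : Cn := \row_j
  if unlift ord_max j is Some i then v.1.1 0 i +i* v.1.2 0 i else v.2%:C.

Definition ew : Cn := delta_mx 0 ord_max.

(* The point (z, u + i K(z, u)) of the graph of K. *)
Definition lift_pt (K : zu -> R) p : Cn := emb p + (0 +i* K p) *: ew.

Lemma lift_ptE K p j : lift_pt K p 0 j =
  if unlift ord_max j is Some i then p.1.1 0 i +i* p.1.2 0 i else p.2 +i* K p.
Proof.
rewrite !mxE eqxx /=; case: unliftP => [i ->|->].
  by rewrite eq_sym (negbTE (neq_lift _ _)) mulr0 addr0.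
by rewrite eqxx mulr1; apply/eqP; rewrite eq_complex /= addr0 add0r !eqxx.
Qed.

Lemma norm_fst (A B : normedModType R) (x : A * B) : `|x.1| <= `|x|.
Proof. by rewrite prod_normE le_max lexx. Qed.

Lemma norm_snd (A B : normedModType R) (x : A * B) : `|x.2| <= `|x|.
Proof. by rewrite prod_normE le_max lexx orbT. Qed.

Lemma norm_coord m (x : 'rV[R]_m) j : `|x 0 j| <= `|x|.
Proof.
rewrite -[X in _ <= X]/(mx_norm x) mx_normE -[leLHS]nngE num_le.
exact: (le_bigmax _ (fun ij : 'I_1 * 'I_m => `|x ij.1 ij.2|%:nng) (0, j)).
Qed.

Lemma zu_coord_x i p : differentiable (fun q : zu => q.1.1 0 i : R^o) p /\
  forall v, 'D_v (fun q : zu => q.1.1 0 i : R^o) p = v.1.1 0 i.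
Proof.
apply: (@bounded_linear_diff _ _ _ p 1) => [a u v|v]; first by rewrite !mxE.
rewrite mul1r; apply: le_trans (norm_coord _ _) _.
exact: le_trans (norm_fst v.1) (norm_fst v).
Qed.

Lemma zu_coord_y i p : differentiable (fun q : zu => q.1.2 0 i : R^o) p /\
  forall v, 'D_v (fun q : zu => q.1.2 0 i : R^o) p = v.1.2 0 i.
Proof.
apply: (@bounded_linear_diff _ _ _ p 1) => [a u v|v]; first by rewrite !mxE.
rewrite mul1r; apply: le_trans (norm_coord _ _) _.
exact: le_trans (norm_snd v.1) (norm_fst v).
Qed.

Lemma zu_coord_u p : differentiable (fun q : zu => q.2 : R^o) p /\
  forall v, 'D_v (fun q : zu => q.2 : R^o) p = v.2.
Proof.
apply: (@bounded_linear_diff _ _ _ p 1) => [a u v|v]; first by [].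
by rewrite mul1r; exact: norm_snd.
Qed.

Lemma lift_pt_chain K (H : Cn -> C) p : differentiable (K : zu -> R^o) p ->
  differentiable H (lift_pt K p) ->
  differentiable (fun q => complex.Re (H (lift_pt K q)) : R^o) p /\
  forall v, 'D_v (fun q => complex.Re (H (lift_pt K q)) : R^o) p =
    complex.Re ('d H (lift_pt K p) (emb v)) +
    complex.Re ('i%C * 'd H (lift_pt K p) ew) * 'D_v (K : zu -> R^o) p.
Proof.
move=> dK dH.
have HRe j : differentiable (fun q => complex.Re (lift_pt K q 0 j) : R^o) p /\
   forall v, 'D_v (fun q => complex.Re (lift_pt K q 0 j) : R^o) p = complex.Re (emb v 0 j).
  have -> : (fun q => complex.Re (lift_pt K q 0 j)) = (fun q : zu =>
      if unlift ord_max j is Some i then q.1.1 0 i else q.2).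
    by apply/funext => q; rewrite lift_ptE; case: unlift.
  rewrite /emb; case E: (unlift ord_max j) => [i|].
    have [d1 d2] := zu_coord_x i p; split => // v; rewrite mxE E; exact: d2.
  by have [d1 d2] := zu_coord_u p; split => // v; rewrite mxE E; exact: d2.
have HIm j : differentiable (fun q => complex.Im (lift_pt K q 0 j) : R^o) p /\
   forall v, 'D_v (fun q => complex.Im (lift_pt K q 0 j) : R^o) p =
     if unlift ord_max j is Some i then v.1.2 0 i else 'D_v (K : zu -> R^o) p.
  have -> : (fun q => complex.Im (lift_pt K q 0 j)) = (fun q : zu =>
      if unlift ord_max j is Some i then q.1.2 0 i else K q).
    by apply/funext => q; rewrite lift_ptE; case: unlift.
  case E: (unlift ord_max j) => [i|//].
  by have [d1 d2] := zu_coord_y i p.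
have [dc Dc] := mixed_chain (fun j => (HRe j).1) (fun j => (HIm j).1) dH.
split=> // v; rewrite Dc.
have -> : (\row_j (('D_v (fun q => complex.Re (lift_pt K q 0 j) : R^o) p) +i*
       ('D_v (fun q => complex.Im (lift_pt K q 0 j) : R^o) p)) : Cn) =
    emb v + (0 +i* ('D_v (K : zu -> R^o) p)) *: ew.
  apply/rowP => j; rewrite [LHS]mxE (HRe j).2 (HIm j).2.
  rewrite -[RHS]/(lift_pt (fun=> 'D_v (K : zu -> R^o) p) v 0 j) lift_ptE /emb mxE.
  by case: unlift.
rewrite linearD linearZ.
move: ('d H _ _) ('d H _ _) => [a b] [c d] /=; ring.
Qed.

Definition hol_on (m : nat) (Om : set (Cspace R m)) (H : Cspace R m -> C) :=
  forall z, Om z -> differentiable H z.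

Lemma hol_on_diff m (Om : set (Cspace R m)) (H : Cspace R m -> C) w : open Om ->
  hol_on Om H -> hol_on Om (fun z => 'd H z w : C).
Proof.
move=> oO hH z Oz; apply: holomorphic_diff.
exact: filterS hH (open_nbhs_nbhs (conj oO Oz)).
Qed.

Lemma cst_smooth U (a : R) : open U -> smooth_on U (cst a : zu -> R^o).
Proof.
move=> oU; apply: (@smooth_coinduction _ _ (fun k => exists a, k = cst a)) => //.
- by move=> _ [b ->] p _; exact: differentiable_cst.
- by move=> _ [b ->] v; exists (cst 0); [exists 0|move=> p _; rewrite derive_cst].
- by exists a.
Qed.

(* Closed under all derivatives as soon as the derivatives of K are in the     *)
(* class, as for the implicit function K of such an equation.                  *)
Section Generated.
Variables (K : zu -> R^o) (Om : set Cn) (U : set zu).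

Inductive gen : (zu -> R^o) -> Prop :=
| gen_Re H : hol_on Om H -> gen (fun p => complex.Re (H (lift_pt K p)))
| gen_smooth k : smooth_on U k -> gen k
| gen_add k1 k2 : gen k1 -> gen k2 -> gen (k1 + k2)
| gen_mul k1 k2 : gen k1 -> gen k2 -> gen (k1 * k2)
| gen_inv k : gen k -> (forall p, U p -> k p != 0) -> gen (fun p => (k p)^-1).

Hypothesis oO : open Om.
Hypothesis oU : open U.
Hypothesis UO : forall p, U p -> Om (lift_pt K p).
Hypothesis dK : forall p, U p -> differentiable K p.
Hypothesis DK : forall v, exists2 k, gen k & forall p, U p -> 'D_v K p = k p.

(** Each constructor yields differentiable functions with derivatives in the class: for [gen_Re]
    this is the chain rule [lift_pt_chain], together with [hol_on_diff] and the hypothesis on the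
    derivatives of K. *)
Lemma gen_smooth_on k : gen k -> smooth_on U k.
Proof.
have main k0 : gen k0 -> (forall p, U p -> differentiable k0 p) /\
    forall v, exists2 k', gen k' & forall p, U p -> 'D_v k0 p = k' p.
  elim=> {k0} [H hH|k0 sk|k1 k2 g1 [d1 D1] g2 [d2 D2]|k1 k2 g1 [d1 D1] g2 [d2 D2]|k1 g1 [d1 D1] nz].
  - split=> [p Up|v].
      by have [] := lift_pt_chain (dK Up) (hH _ (UO Up)).
    have [kv gkv Ekv] := DK v.
    exists ((fun p => complex.Re ('d H (lift_pt K p) (emb v))) +
      (fun p => complex.Re ('i%C * 'd H (lift_pt K p) ew)) * kv).
      apply: gen_add.
        exact: (gen_Re (hol_on_diff (emb v) oO hH)).
      apply: gen_mul gkv.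
      apply: (@gen_Re (fun z => 'i%C * 'd H z ew)) => z Oz.
      have dw := hol_on_diff ew oO hH Oz.
      exact: (diffZ_at 'i%C 0 dw).1.
    move=> p Up; have [_ ->] := lift_pt_chain (dK Up) (hH _ (UO Up)).
    by rewrite Ekv.
  - split=> [p Up|v]; first exact: smooth_on_diff sk Up.
    by exists ('D_v k0) => //; apply: gen_smooth; exact: smooth_on_derive.
  - split=> [p Up|v]; first by apply: differentiableD; [exact: d1|exact: d2].
    have [k1' G1 E1] := D1 v; have [k2' G2 E2] := D2 v.
    exists (k1' + k2'); first exact: gen_add.
    by move=> p Up; rewrite deriveD ?E1 ?E2//; apply: diff_derivable; [exact: d1|exact: d2].
  - split=> [p Up|v]; first by apply: differentiableM; [exact: d1|exact: d2].
    have [k1' G1 E1] := D1 v; have [k2' G2 E2] := D2 v.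
    exists (k1 * k2' + k2 * k1'); first by apply: gen_add; exact: gen_mul.
    by move=> p Up; rewrite deriveM ?E1 ?E2//; apply: diff_derivable; [exact: d1|exact: d2].
  - split=> [p Up|v]; first by apply: differentiableV; [exact: d1|exact: nz].
    have [k1' G1 E1] := D1 v.
    pose iv := (fun p => (k1 p)^-1) : zu -> R^o.
    exists (cst (-1) * (iv * iv * k1')).
      apply: gen_mul; first exact: gen_smooth (cst_smooth (-1) oU).
      by apply: gen_mul G1; apply: gen_mul; exact: gen_inv.
    move=> p Up; rewrite deriveV; [|exact: nz|exact/diff_derivable/d1].
    by rewrite E1// /iv !fctE mulN1r expr2 invfM -mulNr.
by apply: (smooth_coinduction oU) => k0 /main[].
Qed.

End Generated.

(** With K = 0 the class [gen] yields the closure of smooth functions under sums and products. *)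
Lemma gen_zero_smooth U k : open U -> gen (cst 0) setT U k -> smooth_on U k.
Proof.
move=> oU; apply: gen_smooth_on => //; first exact: openT.
by move=> v; exists (cst 0);
  [apply: gen_smooth; exact: cst_smooth|move=> p _; rewrite derive_cst].
Qed.

Lemma smooth_onD U k1 k2 : open U -> smooth_on U k1 -> smooth_on U k2 ->
  smooth_on U (k1 + k2).
Proof. by move=> oU s1 s2; apply: gen_zero_smooth => //; apply: gen_add; exact: gen_smooth. Qed.

Lemma smooth_onM U k1 k2 : open U -> smooth_on U k1 -> smooth_on U k2 ->
  smooth_on U (k1 * k2).
Proof. by move=> oU s1 s2; apply: gen_zero_smooth => //; apply: gen_mul; exact: gen_smooth. Qed.

Lemma smooth_onZ U (a : R) k : open U -> smooth_on U k -> smooth_on U (fun p => a * k p).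
Proof. by move=> oU sk; apply: (smooth_onM oU (cst_smooth a oU) sk). Qed.

End ZuSpace.

(** * Graphing function of a hypersurface *)


Section ImplicitFunction.
Variables (R : realType) (V : normedModType R).
Variable s : (V * R^o)%type -> R^o.
Implicit Types (p h : V) (v k : R).

Lemma norm_pair p v : `|(p, v) : V * R^o| = Num.max `|p| `|v|.
Proof. by rewrite prod_normE. Qed.

Lemma pairD p h (v k : R^o) : ((p, v) : V * R^o) + (h, k) = (p + h, v + k).
Proof. by []. Qed.

Lemma pairZ (a : R) p (v : R^o) : a *: ((p, v) : V * R^o) = (a *: p, a * v).
Proof. by []. Qed.

Lemma partial_is_derive p v : differentiable s ((p, v) : V * R^o) ->
  is_derive (v : R^o) 1 (fun v : R^o => s (p, v) : R^o) ('d s ((p, v) : V * R^o) (0, 1)).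
Proof.
move=> ds; apply: eps_is_derive => e e0.
have [r r0 Hr] := diff_epsP ds e0; exists r => // k kr.
have := Hr (0, k : R^o); rewrite norm_pair normr0 max_r// => /(_ kr).
rewrite pairD addr0.
have -> : 'd s ((p, v) : V * R^o) (0, k : R^o) = k * 'd s ((p, v) : V * R^o) (0, 1).
  rewrite -[RHS]/(k *: ('d s ((p, v) : V * R^o) (0, 1) : R^o)) -linearZ.
  by congr ('d s _ _); rewrite pairZ scaler0 mulr1.
by [].
Qed.

(** Near 0 the slope of s / lam in v is at least 1/2. Hence on each vertical line there is at most
    one zero, the intermediate value theorem provides one, and the slope bound makes Q Lipschitz at
    p, after which the differential of s at (p, Q p) determines that of Q. *)
Theorem implicit_function (lam : R) : lam != 0 -> s (0, 0) = 0 ->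
  (\forall q \near ((0, 0) : V * R^o), differentiable s q) ->
  (\forall q \near ((0, 0) : V * R^o), `|'d s q (0, 1) / lam - 1| <= 2^-1) ->
  exists Q : V -> R^o, [/\ Q 0 = 0,
    \forall p \near (0 : V), differentiable Q p,
    \forall p \near (0 : V), s (p, Q p) = 0 &
    exists2 d, 0 < d & forall p v, `|p| < d -> `|v| < d -> s (p, v) = 0 <-> v = Q p].
Proof.
move=> lam0 s0 Nd ND.
have [d d0 Hd] : exists2 d, 0 < d & forall p v, `|p| < d -> `|v| < d ->
    differentiable s ((p, v) : V * R^o) /\
    `|'d s ((p, v) : V * R^o) (0, 1) / lam - 1| <= 2^-1.
  have /nbhs_ballP[d /= d0 Hd] : \forall q \near ((0, 0) : V * R^o),
      differentiable s q /\ `|'d s q (0, 1) / lam - 1| <= 2^-1.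
    by apply: filterS2 Nd ND.
  exists d => // p v pd vd; apply: Hd.
  rewrite -ball_normE/= -[(0, 0) - _]/((0 - p, 0 - v) : V * R^o) norm_pair !sub0r.
  by rewrite !normrN gt_max pd.
pose t p v := s (p, v) / lam.
have mono p v1 v2 : `|p| < d -> `|v1| < d -> `|v2| < d -> v1 <= v2 ->
    2^-1 * (v2 - v1) <= t p v2 - t p v1.
  move=> pd; rewrite !ltr_norml => /andP[a1 b1] /andP[a2 b2] v12.
  have dv v : v \in `[v1, v2] ->
      is_derive (v : R^o) 1 (fun v : R^o => s (p, v) : R^o)
        ('d s ((p, v) : V * R^o) (0, 1)) /\
      `|'d s ((p, v) : V * R^o) (0, 1) / lam - 1| <= 2^-1.
    rewrite in_itv/= => /andP[c1 c2]; have vd : `|v| < d.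
      by rewrite ltr_norml; apply/andP; split; lra.
    by have [h1 h2] := Hd p v pd vd; split => //; exact: partial_is_derive.
  have [||c cI E] := @MVT_segment _ (fun v : R^o => s (p, v) : R^o)
      (fun v => 'd s ((p, v) : V * R^o) (0, 1)) v1 v2 v12.
  - move=> v; rewrite in_itv/= => /andP[c1 c2]; apply: (dv v _).1.
    by rewrite in_itv/= !ltW.
  - apply: derivable_within_continuous => v /dv[dsv _]; exact: ex_derive.
  rewrite /t -mulrBl E mulrAC ler_wpM2r ?subr_ge0//.
  by have [_] := dv c cI; rewrite ler_norml => /andP[]; lra.
have lip p v1 v2 : `|p| < d -> `|v1| < d -> `|v2| < d ->
    2^-1 * `|v2 - v1| <= `|t p v2 - t p v1|.
  move=> pd h1 h2; case: (leP v1 v2) => [le12|/ltW le21].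
    rewrite (ger0_norm (_ : 0 <= v2 - v1)) ?subr_ge0//.
    exact: le_trans (mono _ _ _ pd h1 h2 le12) (ler_norm _).
  rewrite distrC (distrC (t _ _)) (ger0_norm (_ : 0 <= v1 - v2)) ?subr_ge0//.
  exact: le_trans (mono _ _ _ pd h2 h1 le21) (ler_norm _).
have t00 : t 0 0 = 0 by rewrite /t s0 mul0r.
have n0d : `|0 : V| < d by rewrite normr0.
have n0d' : `|0 : R| < d by rewrite normr0.
(* Zeros are sought in [- e, e], strictly inside the interval where the slope bound holds. *)
pose e := d / 2; have e0 : 0 < e by rewrite divr_gt0.
have ed : `|e| < d by rewrite gtr0_norm// /e; lra.
have ed' : `|- e| < d by rewrite normrN.
have te : e / 2 <= t 0 e.
  have := mono 0 0 e n0d n0d' ed (ltW e0); rewrite t00; lra.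
have te' : t 0 (- e) <= - (e / 2).
  have := mono 0 (- e) 0 n0d ed' n0d'; rewrite t00 oppr_le0 => /(_ (ltW e0)); lra.
have cont v : `|v| < d -> \forall p \near (0 : V), `|t p v - t 0 v| < e / 2.
  move=> vd; have [ds _] := Hd 0 v n0d vd.
  have lam1 : 0 < `|lam| by rewrite normr_gt0.
  have /differentiable_continuous/cvgrPdist_lt/(_ (e / 2 * `|lam|)) := ds.
  rewrite mulr_gt0 ?divr_gt0// => /(_ isT)/nbhs_ballP[r /= r0 Hr].
  apply/nbhs_ballP; exists r => // p; rewrite -ball_normE/= sub0r normrN => pr.
  have := Hr (p, v); rewrite -ball_normE/= -[(0, v) - _]/((0 - p, v - v) : V * R^o).
  rewrite norm_pair sub0r subrr normr0 normrN.
  rewrite max_l// => /(_ pr); rewrite /t -mulrBl normrM normfV distrC.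
  by rewrite ltr_pdivrMr.
have [d' d'0 [d'd Hd']] : exists2 d', 0 < d' & d' <= d /\ forall p, `|p| < d' ->
    0 < t p e /\ t p (- e) < 0.
  have /nbhs_ballP[r /= r0 Hr] : \forall p \near (0 : V),
      `|t p e - t 0 e| < e / 2 /\ `|t p (- e) - t 0 (- e)| < e / 2.
    by apply: filterS2 (cont e ed) (cont (- e) ed').
  exists (Num.min d r); first by rewrite lt_min d0 r0.
  split; first by rewrite ge_min lexx.
  move=> p; rewrite lt_min => /andP[_ pr].
  have [] := Hr p; first by rewrite -ball_normE/= sub0r normrN.
  by rewrite /= !ltr_norml => /andP[? ?] /andP[? ?]; split; lra.
have root p : `|p| < d' -> exists v, `|v| <= e /\ s (p, v) = 0.
  move=> pd'; have [h1 h2] := Hd' p pd'; have pd := lt_le_trans pd' d'd.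
  have eI v : v \in `[- e, e] -> `|v| < d.
    by rewrite in_itv/= -ler_norml => h; apply: le_lt_trans h _; rewrite /e; lra.
  have [|||v vI tv] := @IVT _ (t p) (- e) e 0.
  - by lra.
  - have -> : t p = (fun v : R^o => lam^-1 *: (s (p, v) : R^o)).
      by apply/funext => v; rewrite /t mulrC.
    apply: derivable_within_continuous => v /eI vd.
    apply: derivableZ; have [ds _] := Hd p v pd vd.
    exact: (@ex_derive _ _ _ _ _ _ _ (partial_is_derive ds)).
  - by rewrite ge_min le_max (ltW h1) (ltW h2) orbT.
  exists v; split; first by rewrite ler_norml; move: vI; rewrite in_itv.
  by move/eqP: tv; rewrite /t mulf_eq0 invr_eq0 (negbTE lam0) orbF => /eqP.
have [Q HQ] : exists Q : V -> R^o, forall p, `|p| < d' -> `|Q p| <= e /\ s (p, Q p) = 0.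
  have H p : exists v, `|p| < d' -> `|v| <= e /\ s (p, v) = 0.
    by case: (pselect (`|p| < d')) => [/root[v]|]; [exists v|exists 0].
  by have [Q HQ] := choice H; exists Q.
have Qd p : `|p| < d' -> `|Q p| < d.
  by move=> /HQ[Qe _]; apply: le_lt_trans Qe _; rewrite /e; lra.
have uniq p v : `|p| < d' -> `|v| < d -> s (p, v) = 0 -> v = Q p.
  move=> pd vd sv; have pd1 := lt_le_trans pd d'd.
  have := lip p (Q p) v pd1 (Qd p pd) vd.
  rewrite /t sv (HQ p pd).2 mul0r subrr normr0 => h.
  by apply/eqP; rewrite -subr_eq0 -normr_le0; lra.
have n0d1 : `|0 : V| < d' by rewrite normr0.
exists Q; split.
- by apply/esym; exact: uniq.
- apply/nbhs_ballP; exists d' => // p; rewrite -ball_normE/= sub0r normrN => pd'.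
  have pd := lt_le_trans pd' d'd.
  have [ds Dn] := Hd p (Q p) pd (Qd p pd').
  set q0 := ((p, Q p) : V * R^o) in ds Dn.
  pose c := 'd s q0 (0, 1).
  have c0 : c != 0.
    apply/negP => /eqP cE; move: Dn; rewrite -/c cE mul0r sub0r normrN normr1; lra.
  have dpair h k : 'd s q0 (h, k : R^o) = 'd s q0 (h, 0) + k * c.
    rewrite /c -[k * _]/(k *: ('d s q0 (0, 1) : R^o)) -linearZ -linearD.
    by congr ('d s _ _); rewrite pairZ pairD scaler0 addr0 add0r mulr1.
  have [L L0 HL] := linear_lipschitz (diff_continuous ds).
  (* The usual quotient - (ds/dp) / (ds/dv). *)
  pose A0 h : R^o := - ('d s q0 (h, 0) / c).
  have A0lin : linear A0.
    move=> a u w; rewrite /A0; have -> : ((a *: u + w, 0) : V * R^o) = a *: (u, 0) + (w, 0).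
      by rewrite pairZ pairD mulr0 addr0.
    rewrite linearP mulrDl opprD -[a *: - _]/(a * - _); congr (_ + _).
    by rewrite mulrN mulrA.
  pose aM := GRing.isLinear.Build R V R^o *:%R A0 A0lin.
  pose A : {linear V -> R^o} := HB.pack A0 aM.
  have Ab h : `|A h| <= L / `|c| * `|h|.
    rewrite normrN normrM normfV mulrAC ler_wpM2r ?invr_ge0//.
    apply: le_trans (HL _) _; rewrite norm_pair normr0 max_l//.
  have cp : 0 < `|c| by rewrite normr_gt0.
  have lamp : 0 < `|lam| by rewrite normr_gt0.
  (* A Lipschitz constant of Q at p; being at least 1, it also bounds the norm of the pair formed by
     h and the increment of Q. *)
  pose K := Num.max 1 (2 * ((1 + L) / `|lam|)).
  have K0 : 0 < K by rewrite lt_max ltr01.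
  have small : \forall h \near (0 : V), `|Q (p + h) - Q p| <= K * `|h| /\ `|p + h| < d'.
    have [r r0 Hr] := diff_epsP ds ltr01.
    apply/nbhs_ballP; exists (Num.min r (d' - `|p|)).
      by rewrite /= lt_min r0 subr_gt0.
    move=> h; rewrite -ball_normE/= sub0r normrN lt_min => /andP[hr hd].
    have phd : `|p + h| < d' by apply: le_lt_trans (ler_normD _ _) _; lra.
    split => //; have phd1 := lt_le_trans phd d'd.
    have := Hr (h, 0 : R^o); rewrite norm_pair normr0 max_l// mul1r => /(_ hr).
    have -> : q0 + (h, 0 : R^o) = (p + h, Q p) by rewrite /q0 pairD addr0.
    rewrite (HQ p pd').2 subr0 => Hh.
    have sh : `|s (p + h, Q p)| <= (1 + L) * `|h|.
      have -> : s (p + h, Q p) = (s (p + h, Q p) - 'd s q0 (h, 0)) + 'd s q0 (h, 0).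
        by rewrite subrK.
      apply: le_trans (ler_normD _ _) _; rewrite mulrDl mul1r lerD//.
      by apply: le_trans (HL _) _; rewrite norm_pair normr0 max_l.
    have := lip (p + h) (Q p) (Q (p + h)) phd1 (Qd _ pd') (Qd _ phd).
    rewrite /t (HQ _ phd).2 mul0r sub0r normrN normrM normfV => l1.
    apply: (@le_trans _ _ (2 * ((1 + L) / `|lam|) * `|h|)).
      have : `|s (p + h, Q p)| / `|lam| <= (1 + L) / `|lam| * `|h|.
        by rewrite mulrAC ler_wpM2r ?invr_ge0.
      lra.
    by rewrite ler_wpM2r// le_max lexx orbT.
  have [|//] := @eps_diff_near _ _ _ Q p A _ Ab.
  move=> x x0; pose y := x * `|c| / K.
  have y0 : 0 < y by rewrite divr_gt0// mulr_gt0.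
  have [r r0 Hr] := diff_epsP ds y0.
  have Nr : \forall h \near (0 : V), `|h| < r / K.
    apply/nbhs_ballP; exists (r / K); first by rewrite /= divr_gt0.
    by move=> h; rewrite -ball_normE/= sub0r normrN.
  apply: filterS2 small Nr => h [hK phd] hr.
  pose k := Q (p + h) - Q p.
  have hkK : `|(h, k : R^o) : V * R^o| <= K * `|h|.
    rewrite norm_pair ge_max hK andbT.
    by rewrite -[leLHS]mul1r ler_wpM2r// le_max lexx.
  have := Hr (h, k : R^o); rewrite ltr_pdivlMr// mulrC in hr.
  move=> /(_ (le_lt_trans hkK hr)).
  have -> : q0 + (h, k : R^o) = (p + h, Q (p + h)).
    by rewrite /q0 pairD /k; congr pair; rewrite addrC subrK.
  rewrite (HQ p pd').2 (HQ _ phd).2 subrr sub0r normrN dpair => H1.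
  have -> : Q (p + h) - Q p - A h = ('d s q0 (h, 0) + k * c) / c.
    by rewrite /A /= /A0 opprK -/k mulrDl mulfK// addrC.
  rewrite normrM normfV ler_pdivrMr//.
  apply: le_trans H1 _; apply: le_trans (ler_wpM2l (ltW y0) hkK) _.
  rewrite /y le_eqVlt; apply/orP; left; apply/eqP; field; exact: lt0r_neq0.
- apply/nbhs_ballP; exists d' => // p; rewrite -ball_normE/= sub0r normrN => pd'.
  exact: (HQ p pd').2.
- exists d' => // p v pd vd; split=> [|->]; last exact: (HQ p pd).2.
  by apply: uniq => //; exact: lt_le_trans vd d'd.
Qed.

End ImplicitFunction.

Section SumOfSquares.
Variables (R : realType) (V : normedModType R) (I : Type).
Implicit Types (p v : V) (a : I -> V -> R^o).

Lemma diff_sum_sqr a (r : seq I) p : (forall k, differentiable (a k) p) ->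
  differentiable (fun q => \sum_(k <- r) a k q ^+ 2 : R^o) p /\
  forall v, 'D_v (fun q => \sum_(k <- r) a k q ^+ 2 : R^o) p =
    \sum_(k <- r) 2 * a k p * 'D_v (a k) p.
Proof.
move=> da; elim: r => [|k r [d D]].
  have -> : (fun q => \sum_(k <- [::]) a k q ^+ 2 : R^o) = cst 0.
    by apply/funext => q; rewrite big_nil.
  by split=> [|v]; [exact: differentiable_cst|rewrite derive_cst big_nil].
have -> : (fun q => \sum_(k <- k :: r) a k q ^+ 2 : R^o) =
    (a k * a k : V -> R^o) + (fun q => \sum_(k <- r) a k q ^+ 2 : R^o).
  by apply/funext => q; rewrite big_cons fctE.
have dk : differentiable (a k * a k : V -> R^o) p by exact: differentiableM.
split=> [|v]; first exact: differentiableD.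
rewrite deriveD; [|exact: diff_derivable|exact: diff_derivable].
rewrite D big_cons deriveM; [|exact: diff_derivable|exact: diff_derivable].
by congr (_ + _); rewrite -mulr2n -mulrA mulr_natl.
Qed.

End SumOfSquares.

Section GraphOfHypersurface.
Variables (R : realType) (n : nat).
Local Notation C := (R[i])^o.
Local Notation normc := Normc.normc.
Local Notation zu := (zu_space R n).
Local Notation Cn := (Cspace R n.+1).
Local Notation zuv := (zu_space R n * R^o)%type.

(** (z, u) and v as real coordinates of C^(n+1). *)
Definition lift2 (q : zuv) : Cn := lift_pt (fun=> q.2) q.1.

Lemma lift2_zu_point (z : Cn) : lift2 (zu_point z, complex.Im (z 0 ord_max)) = z.
Proof.
apply/rowP => j; rewrite /lift2 lift_ptE /=; case: unliftP => [i ->|->].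
  rewrite !mxE; have -> : widen_ord (leqnSn n) i = lift ord_max i.
    by apply: val_inj; rewrite /= /bump leqNgt ltn_ord.
  by case: (z _ _).
by case: (z _ _).
Qed.

Lemma zu_point_norm (z : Cn) : `|zu_point z| <= cnorm z.
Proof.
have z0 := cnorm_ge0 z.
have row_le m (x : 'rV[R]_m) (b : R) : 0 <= b -> (forall j, `|x 0 j| <= b) -> `|x| <= b.
  move=> b0 H; rewrite -[`|x|]/(mx_norm x).
  have [->//|/mx_norm_neq0[[i j] /= ->]] := eqVneq (mx_norm x) 0.
  by rewrite ord1 H.
rewrite prod_normE ge_max; apply/andP; split.
  rewrite prod_normE ge_max; apply/andP; split.
    apply: row_le => // j; rewrite !mxE; apply: le_trans (Re_le_normc _) _.
    exact: cnorm_row_ge.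
  apply: row_le => // j; rewrite !mxE; apply: le_trans (Im_le_normc _) _.
  exact: cnorm_row_ge.
exact: le_trans (Re_le_normc _) (cnorm_row_ge _ _).
Qed.

Lemma zu_norm_x i (p : zu) : `|p.1.1 0 i| <= `|p|.
Proof. by apply: le_trans (norm_coord _ _) _; exact: le_trans (norm_fst p.1) (norm_fst p). Qed.

Lemma zu_norm_y i (p : zu) : `|p.1.2 0 i| <= `|p|.
Proof. by apply: le_trans (norm_coord _ _) _; exact: le_trans (norm_snd p.1) (norm_fst p). Qed.

Lemma lift2_norm (q : zuv) : cnorm (lift2 q) <= n.+1%:R * (2 * `|q|).
Proof.
apply: le_trans (cnorm_row_le _) _.
apply: (@le_trans _ _ (\sum_(j < n.+1) (2 * `|q|))).
  apply: ler_sum => j _; rewrite lift_ptE.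
  have q1 := norm_fst q; have q2 := norm_snd q.
  case: unlift => [i|]; apply: le_trans (normc_le_add _ _) _.
    have := zu_norm_x i q.1; have := zu_norm_y i q.1; lra.
  have := norm_snd q.1; lra.
by rewrite sumr_const card_ord -[_ *+ n.+1]mulr_natl.
Qed.

Lemma lift2_coord j (q : zuv) :
  (differentiable (fun q => complex.Re (lift2 q 0 j) : R^o) q /\
   'D_(0, 1) (fun q => complex.Re (lift2 q 0 j) : R^o) q = 0) /\
  (differentiable (fun q => complex.Im (lift2 q 0 j) : R^o) q /\
   'D_(0, 1) (fun q => complex.Im (lift2 q 0 j) : R^o) q = (ew R n 0 j == 1)%:R).
Proof.
have ewE : (ew R n 0 j == 1) = ~~ unlift ord_max j.
  rewrite /ew mxE eqxx /=; case: unliftP => [i ->|->].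
    by rewrite eq_sym [_ == ord_max]eq_sym (negbTE (neq_lift _ _)) oner_eq0.
  by rewrite !eqxx.
have ReE : (fun q => complex.Re (lift2 q 0 j)) = (fun q : zuv =>
   if unlift ord_max j is Some i then q.1.1.1 0 i else q.1.2).
  by apply/funext => r; rewrite /lift2 lift_ptE; case: unlift.
have ImE : (fun q => complex.Im (lift2 q 0 j)) = (fun q : zuv =>
   if unlift ord_max j is Some i then q.1.1.2 0 i else q.2).
  by apply/funext => r; rewrite /lift2 lift_ptE; case: unlift.
rewrite ewE ReE ImE; split.
  have [d D] : differentiable (fun q : zuv => (if unlift ord_max j is Some i
      then q.1.1.1 0 i else q.1.2) : R^o) q /\
     forall v, 'D_v (fun q : zuv => (if unlift ord_max j is Some i
      then q.1.1.1 0 i else q.1.2) : R^o) q =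
      (if unlift ord_max j is Some i then v.1.1.1 0 i else v.1.2).
    apply: (@bounded_linear_diff _ _ _ q 1); case: unlift => [i|].
    - by move=> a u v; rewrite !mxE.
    - by [].
    - by move=> v; rewrite mul1r; apply: le_trans (zu_norm_x _ _) (norm_fst v).
    - by move=> v; rewrite mul1r; apply: le_trans (norm_snd v.1) (norm_fst v).
  by split => //; rewrite D; case: unlift => [i|//]; rewrite mxE.
have [d D] : differentiable (fun q : zuv => (if unlift ord_max j is Some i
    then q.1.1.2 0 i else q.2) : R^o) q /\
   forall v, 'D_v (fun q : zuv => (if unlift ord_max j is Some i
    then q.1.1.2 0 i else q.2) : R^o) q =
    (if unlift ord_max j is Some i then v.1.1.2 0 i else v.2).
  apply: (@bounded_linear_diff _ _ _ q 1); case: unlift => [i|].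
  - by move=> a u v; rewrite !mxE.
  - by [].
  - by move=> v; rewrite mul1r; apply: le_trans (zu_norm_y _ _) (norm_fst v).
  - by move=> v; rewrite mul1r; exact: norm_snd.
by split => //; rewrite D; case: unlift => [i|//]; rewrite mxE.
Qed.

Lemma lift2_chain (H : Cn -> C) (q : zuv) : differentiable H (lift2 q) ->
  differentiable (fun q => complex.Re (H (lift2 q)) : R^o) q /\
  'D_(0, 1) (fun q => complex.Re (H (lift2 q)) : R^o) q =
     complex.Re ('i%C * 'd H (lift2 q) (ew R n)).
Proof.
move=> dH.
have [dc Dc] := mixed_chain (fun j => (lift2_coord j q).1.1)
  (fun j => (lift2_coord j q).2.1) dH.
split=> //; rewrite Dc -[X in _ = complex.Re X]/('i%C *: ('d H (lift2 q) (ew R n) : C)).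
rewrite -linearZ; congr (complex.Re ('d H (lift2 q) _)).
apply/rowP => j; rewrite mxE (lift2_coord j q).1.2 (lift2_coord j q).2.2 /ew !mxE eqxx /=.
case: (j == ord_max); first by rewrite eqxx mulr1.
by rewrite eq_sym oner_eq0 mulr0.
Qed.

(* A sum of squares of real parts of holomorphic functions, which covers      *)
(* sums of squared moduli since |g|^2 = (Re g)^2 + (Re (- i g))^2.            *)
Definition rho (I : finType) (Z : Cn -> C) (H : I -> Cn -> C) (z : Cn) : R :=
  complex.Re (Z z) + \sum_(k : I) complex.Re (H k z) ^+ 2.

(** The v-derivative of [rho] at 0 is Re (i (i lam)) = - lam, since the squares contribute nothing
    where all H_k vanish; this gives Q by the implicit function theorem. Q is smooth because its
    derivatives are quotients of functions built from holomorphic functions on the graph of Q, that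
    is, of members of [gen]. *)
Theorem hypersurface_graph (I : finType) (Om : set Cn) (Z : Cn -> C) (H : I -> Cn -> C)
    (lam : R) : open Om -> Om 0 -> hol_on Om Z -> (forall k, hol_on Om (H k)) ->
  Z 0 = 0 -> (forall k, H k 0 = 0) -> 'd Z 0 (ew R n) = 0 +i* lam -> lam != 0 ->
  exists (U : set zu) (Q : zu -> R^o), [/\ open U /\ U 0, Q 0 = 0,
    smooth_on U Q /\ (forall p, U p -> Om (lift_pt Q p)),
    forall p, U p -> rho Z H (lift_pt Q p) = 0 &
    \forall z \near (0 : Cn), rho Z H z = 0 <->
      complex.Im (z 0 ord_max) = Q (zu_point z)].
Proof.
move=> oO O0 hZ hH Z0 H0 dZ0 lam0.
pose s (q : zuv) : R^o := rho Z H (lift2 q).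
have l20 : lift2 (0, 0) = 0.
  apply/eqP; rewrite -cnorm_eq0 eq_le cnorm_ge0 andbT.
  by apply: le_trans (lift2_norm _) _; rewrite normr0 !mulr0.
have NO : \forall q \near ((0, 0) : zuv), Om (lift2 q).
  have /nbhs_cnormP[r r0 Hr] := open_nbhs_nbhs (conj oO O0).
  have n0 : 0 < n.+1%:R * 2 :> R by rewrite mulr_gt0.
  apply/nbhs_ballP; exists (r / (n.+1%:R * 2)); first by rewrite /= divr_gt0.
  move=> q; rewrite -ball_normE/= -[(0, 0) - q]/(0 - q) sub0r normrN ltr_pdivlMr// => qr.
  apply: Hr; rewrite subr0; apply: le_lt_trans (lift2_norm _) _.
  by apply: le_lt_trans qr; rewrite mulrA mulrC.
(* The partial derivative of [rho] in v. *)
pose Den (z : Cn) : R := complex.Re ('i%C * 'd Z z (ew R n)) +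
  \sum_(k : I) 2 * complex.Re (H k z) * complex.Re ('i%C * 'd (H k) z (ew R n)).
have sD q : Om (lift2 q) -> differentiable s q /\ 'D_(0, 1) s q = Den (lift2 q).
  move=> Oq; have [d1 D1] := lift2_chain (hZ _ Oq).
  have [d2 D2] := @diff_sum_sqr _ _ _ (fun k q => complex.Re (H k (lift2 q)) : R^o)
    (index_enum I) q (fun k => (lift2_chain (hH k _ Oq)).1).
  have -> : s = (fun q => complex.Re (Z (lift2 q)) : R^o) +
     (fun q => \sum_(k : I) complex.Re (H k (lift2 q)) ^+ 2 : R^o) by [].
  split; first exact: differentiableD.
  rewrite deriveD; [|exact: diff_derivable|exact: diff_derivable].
  rewrite D1 D2 /Den; congr (_ + _); apply: eq_bigr => k _.
  by rewrite (lift2_chain (hH k _ Oq)).2.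
have Den0 : Den 0 = - lam.
  rewrite /Den big1 ?addr0 => [|k _]; last first.
    by rewrite (_ : complex.Re (H k 0) = 0) ?mulr0 ?mul0r// H0.
  apply: (etrans (congr1 (fun w : R[i] => complex.Re ('i%C * w)) dZ0)).
  by rewrite /=; ring.
have hi (G : Cn -> C) : hol_on Om G -> hol_on Om (fun z => 'i%C * 'd G z (ew R n)).
  move=> hG z Oz; exact: (diffZ_at 'i%C 0 (hol_on_diff (ew R n) oO hG Oz)).1.
have Ol : Om (lift2 (0, 0)) by rewrite l20.
have cDen : {for ((0, 0) : zuv), continuous (fun q => Den (lift2 q) : R^o)}.
  apply: cvgD.
    apply: differentiable_continuous; exact: (lift2_chain (hi _ hZ _ Ol)).1.
  have cRe (G : Cn -> C) : hol_on Om G ->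
      {for ((0, 0) : zuv), continuous (fun q => complex.Re (G (lift2 q)) : R^o)}.
    by move=> hG; apply: differentiable_continuous; exact: (lift2_chain (hG _ Ol)).1.
  rewrite /index_enum; elim: (Finite.enum _) => [|k r IH].
    under eq_fun do rewrite big_nil.
    by rewrite big_nil; exact: cvg_cst.
  under eq_fun do rewrite big_cons.
  rewrite big_cons; apply: cvgD IH; apply: cvgM; last exact: (cRe _ (hi _ (hH k))).
  by apply: cvgM; [exact: cvg_cst|exact: (cRe _ (hH k))].
have ND : \forall q \near ((0, 0) : zuv), `|'d s q (0, 1) / (- lam) - 1| <= 2^-1.
  have lamp : 0 < `|lam| by rewrite normr_gt0.
  move/cvgrPdist_le : cDen => /(_ (2^-1 * `|lam|)); rewrite mulr_gt0 ?invr_gt0// => /(_ isT).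
  rewrite l20 Den0; apply: filterS2 NO => q Oq; have [ds DE] := sD q Oq.
  rewrite -deriveE// DE => h; have -> : Den (lift2 q) / - lam - 1 = (- lam - Den (lift2 q)) / lam.
    by field.
  by rewrite normrM normfV ler_pdivrMr.
have Nd : \forall q \near ((0, 0) : zuv), differentiable s q.
  by apply: filterS NO => q /sD[].
have s0 : s (0, 0) = 0.
  rewrite /s l20 /rho Z0 big1 ?addr0// => k _.
  by rewrite H0 expr0n.
have nlam0 : - lam != 0 by rewrite oppr_eq0.
have [Q [Q0 NdQ NQ [d d0 Hd]]] := implicit_function nlam0 s0 Nd ND.
have NDen : \forall q \near ((0, 0) : zuv), Den (lift2 q) != 0.
  apply: filterS2 ND NO => q h Oq; have [ds DE] := sD q Oq; move: h.
  rewrite -deriveE// DE; apply: contraTneq => ->.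
  by rewrite mul0r sub0r normrN normr1 -ltNge invf_lt1// ltr1n.
have cQ : {for (0 : zu), continuous (fun p : zu => (p, Q p) : zuv)}.
  have cQ0 := differentiable_continuous (nbhs_singleton NdQ).
  exact: (cvg_pair (@cvg_id _ (nbhs (0 : zu))) cQ0).
have pull (P : set zuv) : (\forall q \near ((0, 0) : zuv), P q) ->
    \forall p \near (0 : zu), P (p, Q p).
  by move=> HP; apply: cQ; rewrite /= Q0.
have /nbhs_ballP[r /= r0 Hr] : \forall p \near (0 : zu), [/\ differentiable Q p,
    s (p, Q p) = 0, Om (lift_pt Q p) & Den (lift_pt Q p) != 0].
  near=> p; split; near: p => //.
  - exact: (pull _ NO).
  - exact: (pull _ NDen).
pose U := ball (0 : zu) r; have oU : open U by exact: ball_open.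
have UO p : U p -> Om (lift_pt Q p) by move=> /Hr[].
have dQ p : U p -> differentiable Q p by move=> /Hr[].
have sQ p : U p -> rho Z H (lift_pt Q p) = 0 by move=> /Hr[].
have DenU p : U p -> Den (lift_pt Q p) != 0 by move=> /Hr[].
exists U, Q; split => //.
- by split => //; exact: ballxx.
- split => //.
  have gRe (G : Cn -> C) : hol_on Om G -> gen Q Om U (fun p => complex.Re (G (lift_pt Q p))).
    exact: gen_Re.
  have gsum (A B : I -> zu -> R^o) : (forall k, gen Q Om U (A k)) ->
     (forall k, gen Q Om U (B k)) ->
     gen Q Om U (fun p => \sum_(k : I) 2 * A k p * B k p).
    move=> gA gB; rewrite /index_enum; elim: (Finite.enum _) => [|k t IH].
      under eq_fun do rewrite big_nil.
      by apply: gen_smooth; exact: cst_smooth.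
    have -> : (fun p => \sum_(i <- k :: t) 2 * A i p * B i p) =
      (cst 2 * A k * B k) + (fun p => \sum_(i <- t) 2 * A i p * B i p).
      by apply/funext => p; rewrite big_cons.
    apply: gen_add IH; apply: gen_mul (gB k); apply: gen_mul (gA k).
    by apply: gen_smooth; exact: cst_smooth.
  have gDen : gen Q Om U (fun p => Den (lift_pt Q p)).
    apply: (gen_add (gRe _ (hi _ hZ))); apply: gsum => k; first exact: gRe.
    exact: gRe (hi _ (hH k)).
  apply: (gen_smooth_on oO oU UO dQ); last first.
    (* Q itself belongs to the class: it is the real part of - i w on its graph. *)
    have hid : hol_on Om (fun z => - 'i%C * z 0 ord_max : C).
      move=> z _; apply: (diffZ_at (- 'i%C) 0 _).1; exact: differentiable_coord.
    have := gRe _ hid; congr gen; apply/funext => p.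
    by rewrite lift_ptE unlift_none /=; ring.
  move=> v.
  (* Differentiating [rho] = 0 along the graph in direction v gives [Num] + [Den] D_v Q = 0. *)
  pose Num (p : zu) : R := complex.Re ('d Z (lift_pt Q p) (emb v)) +
    \sum_(k : I) 2 * complex.Re (H k (lift_pt Q p)) *
       complex.Re ('d (H k) (lift_pt Q p) (emb v)).
  have gNum : gen Q Om U Num.
    apply: (gen_add (gRe _ (hol_on_diff (emb v) oO hZ))); apply: gsum => k.
      exact: gRe.
    exact: gRe (hol_on_diff (emb v) oO (hH k)).
  exists (cst (-1) * Num * (fun p => (Den (lift_pt Q p))^-1)).
    apply: gen_mul; last exact: gen_inv.
    by apply: gen_mul gNum; apply: gen_smooth; exact: cst_smooth.
  move=> p Up.
  have [d1 D1] := lift_pt_chain (dQ _ Up) (hZ _ (UO _ Up)).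
  have [d2 D2] := @diff_sum_sqr _ _ _ (fun k q => complex.Re (H k (lift_pt Q q)) : R^o)
    (index_enum I) p (fun k => (lift_pt_chain (dQ _ Up) (hH k _ (UO _ Up))).1).
  have : 'D_v (fun q => rho Z H (lift_pt Q q) : R^o) p = 0.
    rewrite -(derive_cst (0 : R^o) p v); apply: near_eq_derive.
    exact: (open_near oU sQ Up).
  have -> : (fun q => rho Z H (lift_pt Q q) : R^o) =
     (fun q => complex.Re (Z (lift_pt Q q)) : R^o) +
     (fun q => \sum_(k : I) complex.Re (H k (lift_pt Q q)) ^+ 2 : R^o) by [].
  rewrite deriveD; [|exact: diff_derivable|exact: diff_derivable].
  rewrite D1 D2; set q' := 'D_v Q p.
  have -> : \sum_(k <- index_enum I) 2 * complex.Re (H k (lift_pt Q p)) *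
      'D_v (fun q => complex.Re (H k (lift_pt Q q)) : R^o) p =
    \sum_(k : I) 2 * complex.Re (H k (lift_pt Q p)) *
       complex.Re ('d (H k) (lift_pt Q p) (emb v)) +
    (\sum_(k : I) 2 * complex.Re (H k (lift_pt Q p)) *
       complex.Re ('i%C * 'd (H k) (lift_pt Q p) (ew R n))) * q'.
    rewrite mulr_suml -big_split /=; apply: eq_bigr => k _.
    by rewrite (lift_pt_chain (dQ _ Up) (hH k _ (UO _ Up))).2 -/q'; ring.
  rewrite addrACA -mulrDl -/(Den _) -/(Num p) => E.
  rewrite !fctE mulN1r; apply/eqP; rewrite eq_sym -mulrN1 mulrAC.
  have := DenU p Up => D0; apply/eqP.
  have {}E : Num p = - (Den (lift_pt Q p) * q') by apply/eqP; rewrite -addr_eq0 E.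
  by rewrite E; field.
- apply/nbhs_cnormP; exists d => // z; rewrite subr0 => zd.
  rewrite -{1}(lift2_zu_point z); apply: Hd.
    exact: le_lt_trans (zu_point_norm _) zd.
  by apply: le_lt_trans zd; exact: le_trans (Im_le_normc _) (cnorm_row_ge _ _).
Unshelve. all: by end_near. Qed.

End GraphOfHypersurface.

(** * Wirtinger calculus *)


Section Clairaut.
Variables (R : realType) (V : normedModType R).
Implicit Types (U : set V) (k : V -> R^o) (p v w : V).

Lemma line_is_derive k p v (t : R) : differentiable k (p + t *: v) ->
  is_derive (t : R^o) 1 (fun t : R^o => k (p + t *: v) : R^o) ('D_v k (p + t *: v)).
Proof.
move=> dk; rewrite deriveE//; apply: eps_is_derive => e e0.
have v1 : 0 < `|v| + 1 by rewrite ltr_wpDl.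
have [r r0 Hr] := diff_epsP dk (divr_gt0 e0 v1).
exists (r / (`|v| + 1)); first exact: divr_gt0.
move=> h; rewrite ltr_pdivlMr// => hr.
have hv : `|h *: v| <= `|h| * (`|v| + 1) by rewrite normrZ ler_wpM2l// lerDl.
have := Hr (h *: v) (le_lt_trans hv hr).
rewrite scalerDl addrA linearZ => /le_trans; apply.
by rewrite -mulrA ler_wpM2l ?(ltW e0)// mulrC ler_pdivrMr.
Qed.

(* The second difference of k over the parallelogram spanned by s v and s w   *)
(* is s^2 times a value of D_w D_v k near p, by the mean value theorem twice. *)
Lemma second_difference U k p v w e : open U -> smooth_on U k -> U p -> 0 < e ->
  exists2 r, 0 < r & forall s : R, 0 < s < r ->
  `|((k (p + s *: v + s *: w) - k (p + s *: v)) - (k (p + s *: w) - k p)) / (s * s)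
    - 'D_w ('D_v k) p| <= e.
Proof.
move=> oU sk Up e0.
have sDk := smooth_on_derive v sk; have sDDk := smooth_on_derive w sDk.
have /differentiable_continuous/cvgrPdist_le/(_ _ e0) := smooth_on_diff sDDk Up.
move=> H; have /nbhs_ballP[r /= r0 Hr] : \forall q \near p, U q /\
    `|'D_w ('D_v k) p - 'D_w ('D_v k) q| <= e.
  by apply: filterS2 (open_nbhs_nbhs (conj oU Up)) H.
pose N := `|v| + `|w| + 1.
have N0 : 0 < N by rewrite ltr_wpDl// addr_ge0.
exists (r / N); first exact: divr_gt0.
move=> s /andP[s0]; rewrite ltr_pdivlMr// => sr.
have inB a b : 0 <= a <= s -> 0 <= b <= s -> ball p r (p + a *: v + b *: w).
  move=> /andP[a0 a1] /andP[b0 b1]; rewrite -ball_normE/= -addrA opprD addrA subrr sub0r normrN.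
  apply: le_lt_trans (ler_normD _ _) _; rewrite !normrZ !ger0_norm//.
  have : a * `|v| <= s * `|v| by rewrite ler_wpM2r.
  have : b * `|w| <= s * `|w| by rewrite ler_wpM2r.
  by move: sr; rewrite /N; lra.
have inU a b : 0 <= a <= s -> 0 <= b <= s -> U (p + a *: v + b *: w).
  by move=> ha hb; have [] := Hr _ (inB _ _ ha hb).
have s00 : (0 : R) <= 0 <= s by rewrite lexx ltW.
have ss : 0 <= s <= s by rewrite lexx ltW.
pose g (a : R^o) : R^o := k (p + s *: w + a *: v) - k (p + a *: v).
have dg a : 0 <= a <= s -> is_derive (a : R^o) 1 g
    ('D_v k (p + s *: w + a *: v) - 'D_v k (p + a *: v)).
  move=> ha; have d1 : is_derive (a : R^o) 1 (fun a : R^o => k (p + s *: w + a *: v) : R^o)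
      ('D_v k (p + s *: w + a *: v)).
    apply: line_is_derive; apply: (smooth_on_diff sk).
    by rewrite addrAC; exact: inU.
  have d2 : is_derive (a : R^o) 1 (fun a : R^o => k (p + a *: v) : R^o)
      ('D_v k (p + a *: v)).
    apply: line_is_derive; apply: (smooth_on_diff sk).
    by have := inU a 0 ha s00; rewrite scale0r addr0.
  exact: is_deriveB.
have [||a aI Ea] := @MVT_segment _ g
    (fun a => 'D_v k (p + s *: w + a *: v) - 'D_v k (p + a *: v)) 0 s (ltW s0).
- by move=> a; rewrite in_itv/= => /andP[a0 a1]; apply: dg; rewrite !ltW.
- by apply: derivable_within_continuous => a; rewrite in_itv/= => /dg d; exact: ex_derive.
have {}aI : 0 <= a <= s by move: aI; rewrite in_itv.
pose g2 (b : R^o) : R^o := 'D_v k (p + a *: v + b *: w).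
have dg2 b : 0 <= b <= s -> is_derive (b : R^o) 1 g2 ('D_w ('D_v k) (p + a *: v + b *: w)).
  by move=> hb; apply: line_is_derive; apply: (smooth_on_diff sDk); exact: inU.
have [||b bI Eb] := @MVT_segment _ g2
    (fun b => 'D_w ('D_v k) (p + a *: v + b *: w)) 0 s (ltW s0).
- by move=> b; rewrite in_itv/= => /andP[a0 a1]; apply: dg2; rewrite !ltW.
- by apply: derivable_within_continuous => b; rewrite in_itv/= => /dg2 d; exact: ex_derive.
have {}bI : 0 <= b <= s by move: bI; rewrite in_itv.
have -> : (k (p + s *: v + s *: w) - k (p + s *: v)) - (k (p + s *: w) - k p) =
    'D_w ('D_v k) (p + a *: v + b *: w) * (s * s).
  move: Ea Eb; rewrite /g /g2 !subr0 !scale0r !addr0 => Ea Eb.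
  by rewrite mulrA -Eb [p + a *: v + s *: w]addrAC -Ea [p + s *: w + s *: v]addrAC.
rewrite mulfK ?mulf_neq0 ?gt_eqF// distrC.
by have [] := Hr _ (inB _ _ aI bI).
Qed.

(** The second difference is symmetric in v and w, so it approximates both mixed derivatives. *)
Theorem clairaut U k p v w : open U -> smooth_on U k -> U p ->
  'D_v ('D_w k) p = 'D_w ('D_v k) p.
Proof.
move=> oU sk Up; apply/eqP; rewrite -subr_eq0 -normr_le0.
apply/ler_addgt0Pr => e e0; rewrite add0r.
have e2 : 0 < e / 2 by rewrite divr_gt0.
have [r1 r10 H1] := second_difference v w oU sk Up e2.
have [r2 r20 H2] := second_difference w v oU sk Up e2.
pose s := Num.min r1 r2 / 2.
have m0 : 0 < Num.min r1 r2 by rewrite lt_min r10.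
have s0 : 0 < s by rewrite divr_gt0.
have sm : s < Num.min r1 r2 by rewrite /s; lra.
move: sm; rewrite lt_min => /andP[s1 s2].
have := H1 s; rewrite s0 s1 => /(_ isT); have := H2 s; rewrite s0 s2 => /(_ isT).
have -> : (k (p + s *: w + s *: v) - k (p + s *: w)) - (k (p + s *: v) - k p) =
   (k (p + s *: v + s *: w) - k (p + s *: v)) - (k (p + s *: w) - k p).
  by rewrite [p + s *: w + _]addrAC; ring.
move: (_ / (s * s)) ('D_v ('D_w k) p) ('D_w ('D_v k) p) => A B D; clear.
rewrite !ler_norml => /andP[? ?] /andP[? ?].
by apply/andP; split; lra.
Qed.

End Clairaut.

Section WirtingerCalculus.
Variables (R : realType) (n : nat).
Local Notation C := (R[i])^o.
Local Notation zu := (zu_space R n).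
Local Notation Cn := (Cspace R n.+1).
Local Notation var := (zu_variable n).
Implicit Types (F G : zu -> R[i]) (p v : zu) (a b : var) (s t : seq var).

Variable U : set zu.
Hypothesis oU : open U.

Definition csmooth F :=
  smooth_on U (fun p => complex.Re (F p) : R^o) /\
  smooth_on U (fun p => complex.Im (F p) : R^o).

(** Every Wirtinger operator is a combination of two directional derivatives with constant
    coefficients; for u the second direction and its coefficient are zero. This allows the three
    kinds of variables to be treated at once. *)
Definition wdir1 a : zu := match a with
  | Var_z j | Var_zbar j => (delta_mx 0 j, 0, 0)
  | Var_u => (0, 0, 1)
  end.
Definition wdir2 a : zu := match a with
  | Var_z j | Var_zbar j => (0, delta_mx 0 j, 0)
  | Var_u => 0
  end.
Definition wcoef1 a : R[i] := if a is Var_u then 1 else 2^-1.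
Definition wcoef2 a : R[i] := match a with
  | Var_z j => - (2^-1 * 'i%C)
  | Var_zbar j => 2^-1 * 'i%C
  | Var_u => 0
  end.

Lemma wirtingerE a F p : wirtinger a F p =
  wcoef1 a * real_derivative (wdir1 a) F p + wcoef2 a * real_derivative (wdir2 a) F p.
Proof.
case: a => [j|j|]; rewrite /wirtinger /wcoef1 /wcoef2 /wdir1 /wdir2.
- by rewrite mulrBr mulNr mulrA.
- by rewrite mulrDr mulrA.
- by rewrite mul1r mul0r addr0.
Qed.

Lemma csmooth_eq F G : (forall p, U p -> F p = G p) -> csmooth F -> csmooth G.
Proof.
move=> E [s1 s2]; split.
  by apply: (eq_smooth_on oU _ s1) => p Up; rewrite E.
by apply: (eq_smooth_on oU _ s2) => p Up; rewrite E.
Qed.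

Lemma csmooth_cst (c : R[i]) : csmooth (fun=> c).
Proof. by split; exact: cst_smooth. Qed.

Lemma csmoothD F G : csmooth F -> csmooth G -> csmooth (fun p => F p + G p).
Proof.
move=> [f1 f2] [g1 g2]; split.
  by apply: (eq_smooth_on oU _ (smooth_onD oU f1 g1)) => p _ /=; rewrite raddfD.
by apply: (eq_smooth_on oU _ (smooth_onD oU f2 g2)) => p _ /=; rewrite raddfD.
Qed.

Lemma csmoothM F G : csmooth F -> csmooth G -> csmooth (fun p => F p * G p).
Proof.
move=> [f1 f2] [g1 g2]; split.
  apply: (eq_smooth_on oU _ (smooth_onD oU (smooth_onM oU f1 g1)
    (smooth_onZ (-1) oU (smooth_onM oU f2 g2)))) => p _ /=.
  by rewrite !fctE; case: (F p) (G p) => [x y] [z w] /=; ring.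
apply: (eq_smooth_on oU _ (smooth_onD oU (smooth_onM oU f1 g2)
    (smooth_onM oU f2 g1))) => p _ /=.
by rewrite !fctE; case: (F p) (G p) => [x y] [z w] /=; ring.
Qed.

Lemma csmooth_sum (I : Type) (r : seq I) (F : I -> zu -> R[i]) :
  (forall i, csmooth (F i)) -> csmooth (fun p => \sum_(i <- r) F i p).
Proof.
move=> sF; elim: r => [|i r IH].
  by under eq_fun do rewrite big_nil; exact: csmooth_cst.
by under eq_fun do rewrite big_cons; exact: csmoothD.
Qed.

Lemma csmooth_conj F : csmooth F -> csmooth (fun p => (F p)^*%C).
Proof.
move=> [f1 f2]; split.
  by apply: (eq_smooth_on oU _ f1) => p _; case: (F p).
apply: (eq_smooth_on oU _ (smooth_onZ (-1) oU f2)) => p _.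
by case: (F p) => x y /=; rewrite mulN1r.
Qed.

Lemma csmooth_real (k : zu -> R^o) : smooth_on U k -> csmooth (fun p => (k p)%:C).
Proof. by split => //; exact: cst_smooth. Qed.

Lemma csmooth_real_derivative v F : csmooth F -> csmooth (real_derivative v F).
Proof. by move=> [f1 f2]; split; exact: smooth_on_derive. Qed.

Lemma csmooth_wirtinger a F : csmooth F -> csmooth (wirtinger a F).
Proof.
move=> sF; apply: (@csmooth_eq (fun p => wcoef1 a * real_derivative (wdir1 a) F p +
    wcoef2 a * real_derivative (wdir2 a) F p)).
  by move=> p _; rewrite wirtingerE.
by apply: csmoothD; apply: csmoothM => //;
  [exact: csmooth_cst|exact: csmooth_real_derivative|
   exact: csmooth_cst|exact: csmooth_real_derivative].
Qed.

Section AtPoint.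
Variable p : zu.
Hypothesis Up : U p.

Lemma real_derivative_eq v F G : (forall q, U q -> F q = G q) ->
  real_derivative v F p = real_derivative v G p.
Proof.
move=> E; rewrite /real_derivative; congr (_ +i* _); apply: near_eq_derive;
  by apply: (open_near oU _ Up) => q Uq; rewrite E.
Qed.

Lemma csmooth_derivable F v : csmooth F ->
  derivable (fun q => complex.Re (F q) : R^o) p v /\
  derivable (fun q => complex.Im (F q) : R^o) p v.
Proof. by move=> [f1 f2]; split; apply: diff_derivable; exact: (smooth_on_diff _ Up). Qed.

Lemma real_derivative_cst v (c : R[i]) : real_derivative v (fun=> c) p = 0.
Proof. by rewrite /real_derivative !derive_cst. Qed.

Lemma real_derivativeD v F G : csmooth F -> csmooth G ->
  real_derivative v (fun q => F q + G q) p = real_derivative v F p + real_derivative v G p.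
Proof.
move=> /(csmooth_derivable v)[f1 f2] /(csmooth_derivable v)[g1 g2].
rewrite /real_derivative.
have -> : (fun q => complex.Re (F q + G q) : R^o) =
  (fun q => complex.Re (F q) : R^o) + (fun q => complex.Re (G q) : R^o).
  by apply/funext => q; rewrite raddfD.
have -> : (fun q => complex.Im (F q + G q) : R^o) =
  (fun q => complex.Im (F q) : R^o) + (fun q => complex.Im (G q) : R^o).
  by apply/funext => q; rewrite raddfD.
by rewrite (deriveD f1 g1) (deriveD f2 g2).
Qed.

Lemma real_derivativeM v F G : csmooth F -> csmooth G ->
  real_derivative v (fun q => F q * G q) p =
  real_derivative v F p * G p + F p * real_derivative v G p.
Proof.
move=> /(csmooth_derivable v)[f1 f2] /(csmooth_derivable v)[g1 g2].
rewrite /real_derivative.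
have -> : (fun q => complex.Re (F q * G q) : R^o) =
  (fun q => complex.Re (F q) : R^o) * (fun q => complex.Re (G q) : R^o) -
  (fun q => complex.Im (F q) : R^o) * (fun q => complex.Im (G q) : R^o).
  by apply/funext => q; rewrite !fctE; case: (F q) (G q) => [? ?] [? ?].
have -> : (fun q => complex.Im (F q * G q) : R^o) =
  (fun q => complex.Re (F q) : R^o) * (fun q => complex.Im (G q) : R^o) +
  (fun q => complex.Im (F q) : R^o) * (fun q => complex.Re (G q) : R^o).
  by apply/funext => q; rewrite !fctE; case: (F q) (G q) => [? ?] [? ?].
rewrite (deriveB (derivableM f1 g1) (derivableM f2 g2)).
rewrite (deriveD (derivableM f1 g2) (derivableM f2 g1)).
rewrite (deriveM f1 g1) (deriveM f2 g2) (deriveM f1 g2) (deriveM f2 g1).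
move: ('D_v _ p) ('D_v _ p) ('D_v _ p) ('D_v _ p) => x y z w.
rewrite -![_ *: _]/(_ * _).
case: (F p) (G p) => [b c] [d e]; apply/eqP; rewrite eq_complex /=.
by apply/andP; split; apply/eqP; ring.
Qed.

Lemma real_derivative_conj v F : csmooth F ->
  real_derivative v (fun q => (F q)^*%C) p = (real_derivative v F p)^*%C.
Proof.
move=> /(csmooth_derivable v)[f1 f2]; rewrite /real_derivative.
have -> : (fun q => complex.Re (F q)^*%C : R^o) = (fun q => complex.Re (F q) : R^o).
  by apply/funext => q; case: (F q).
have -> : (fun q => complex.Im (F q)^*%C : R^o) = - (fun q => complex.Im (F q) : R^o).
  by apply/funext => q; rewrite !fctE; case: (F q).
by rewrite deriveN.
Qed.

Lemma wirtinger_eq a F G : (forall q, U q -> F q = G q) ->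
  wirtinger a F p = wirtinger a G p.
Proof. by move=> E; rewrite !wirtingerE !(real_derivative_eq _ E). Qed.

Lemma wirtinger_cst a (c : R[i]) : wirtinger a (fun=> c) p = 0.
Proof. by rewrite wirtingerE !real_derivative_cst; ring. Qed.

Lemma wirtingerD a F G : csmooth F -> csmooth G ->
  wirtinger a (fun q => F q + G q) p = wirtinger a F p + wirtinger a G p.
Proof.
move=> sF sG; have H1 := real_derivativeD (wdir1 a) sF sG.
have H2 := real_derivativeD (wdir2 a) sF sG.
have alg (c d x y z w : R[i]) : c * (x + y) + d * (z + w) = c * x + d * z + (c * y + d * w).
  ring.
rewrite (wirtingerE a (fun q => F q + G q)) H1 H2 (wirtingerE a F) (wirtingerE a G).
exact: alg.
Qed.

Lemma wirtingerM a F G : csmooth F -> csmooth G ->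
  wirtinger a (fun q => F q * G q) p = wirtinger a F p * G p + F p * wirtinger a G p.
Proof.
move=> sF sG; have H1 := real_derivativeM (wdir1 a) sF sG.
have H2 := real_derivativeM (wdir2 a) sF sG.
have alg (c d x y z w f g : R[i]) : c * (x * g + f * y) + d * (z * g + f * w) =
    (c * x + d * z) * g + f * (c * y + d * w).
  ring.
rewrite (wirtingerE a (fun q => F q * G q)) H1 H2 (wirtingerE a F) (wirtingerE a G).
exact: alg.
Qed.

Lemma wirtinger_sum (I : Type) (r : seq I) (F : I -> zu -> R[i]) a :
  (forall i, csmooth (F i)) ->
  wirtinger a (fun q => \sum_(i <- r) F i q) p = \sum_(i <- r) wirtinger a (F i) p.
Proof.
move=> sF; elim: r => [|i r IH].
  by under eq_fun do rewrite big_nil; rewrite big_nil wirtinger_cst.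
under eq_fun do rewrite big_cons.
by rewrite wirtingerD//; [rewrite IH big_cons|exact: csmooth_sum].
Qed.

Definition var_bar a : var := match a with
  | Var_z j => Var_zbar j
  | Var_zbar j => Var_z j
  | Var_u => @Var_u n
  end.

Lemma wirtinger_conj a F : csmooth F ->
  wirtinger a (fun q => (F q)^*%C) p = (wirtinger (var_bar a) F p)^*%C.
Proof.
move=> sF; rewrite !wirtingerE.
rewrite (real_derivative_conj (wdir1 a) sF) (real_derivative_conj (wdir2 a) sF).
have h2 : (2^-1 : R[i])^*%C = 2^-1 by rewrite fmorphV rmorph_nat.
have hN (z : R[i]) : (- z)^*%C = - z^*%C by case: z.
have hi : ('i%C : R[i])^*%C = - 'i%C by apply/eqP; rewrite eq_complex /= oppr0 !eqxx.
have -> : wcoef1 a = (wcoef1 (var_bar a))^*%C.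
  by case: (a) => [k|k|]; [exact/esym/h2|exact/esym/h2|exact/esym/rmorph1].
have hP (x y : R[i]) : (x * y)^*%C = x^*%C * y^*%C by exact: rmorphM.
have hM : (2^-1 * 'i%C : R[i])^*%C = - (2^-1 * 'i%C) by rewrite hP h2 hi mulrN.
have -> : wcoef2 a = (wcoef2 (var_bar a))^*%C.
  case: (a) => [k|k|].
  - exact/esym/hM.
  - by rewrite -[RHS]/((- (2^-1 * 'i%C) : R[i])^*%C) hN hM opprK.
  - by rewrite -[RHS]/((0 : R[i])^*%C) rmorph0.
have -> : wdir1 (var_bar a) = wdir1 a by case: (a).
have -> : wdir2 (var_bar a) = wdir2 a by case: (a).
have hD (x y : R[i]) : (x + y)^*%C = x^*%C + y^*%C by exact: rmorphD.
move: (real_derivative _ F p) (real_derivative _ F p) (wcoef1 _) (wcoef2 _) => x y c d.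
by rewrite hD !hP.
Qed.

End AtPoint.

Lemma wirtinger_comm a b F p : csmooth F -> U p ->
  wirtinger a (wirtinger b F) p = wirtinger b (wirtinger a F) p.
Proof.
move=> sF Up.
have E c d : wirtinger c (wirtinger d F) p =
   wirtinger c (fun q => wcoef1 d * real_derivative (wdir1 d) F q +
     wcoef2 d * real_derivative (wdir2 d) F q) p.
  by apply: (wirtinger_eq Up) => q _; rewrite wirtingerE.
have sc (c : R[i]) v : csmooth (fun q => c * real_derivative v F q).
  by apply: csmoothM; [exact: csmooth_cst|exact: csmooth_real_derivative].
have D v w (c : R[i]) : real_derivative w (fun q => c * real_derivative v F q) p =
    c * real_derivative w (real_derivative v F) p.
  rewrite (real_derivativeM Up); [|exact: csmooth_cst|exact: csmooth_real_derivative].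
  by rewrite real_derivative_cst mul0r add0r.
have comm v w : real_derivative v (real_derivative w F) p =
    real_derivative w (real_derivative v F) p.
  case: sF => f1 f2.
  exact: (congr2 (fun x y : R => x +i* y) (clairaut v w oU f1 Up) (clairaut v w oU f2 Up)).
have T c v (k : R[i]) : wirtinger c (fun q => k * real_derivative v F q) p =
    k * (wcoef1 c * real_derivative (wdir1 c) (real_derivative v F) p +
         wcoef2 c * real_derivative (wdir2 c) (real_derivative v F) p).
  rewrite wirtingerE (D v (wdir1 c) k) (D v (wdir2 c) k).
  move: (real_derivative _ _ p) (real_derivative _ _ p) => x y.
  by rewrite mulrDr !mulrA (mulrC k) (mulrC k (wcoef2 c)).
pose D2 v w := real_derivative v (real_derivative w F) p.
have E2 c d : wirtinger c (wirtinger d F) p =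
    wcoef1 d * (wcoef1 c * D2 (wdir1 c) (wdir1 d) + wcoef2 c * D2 (wdir2 c) (wdir1 d)) +
    wcoef2 d * (wcoef1 c * D2 (wdir1 c) (wdir2 d) + wcoef2 c * D2 (wdir2 c) (wdir2 d)).
  exact: (etrans (E c d) (etrans (wirtingerD Up c (sc _ _) (sc _ _))
    (congr2 +%R (T c (wdir1 d) (wcoef1 d)) (T c (wdir2 d) (wcoef2 d))))).
have {}comm v w : D2 v w = D2 w v by exact: comm.
rewrite (E2 a b) (E2 b a); clearbody D2.
rewrite (comm (wdir1 b) (wdir1 a)) (comm (wdir1 b) (wdir2 a)).
rewrite (comm (wdir2 b) (wdir1 a)) (comm (wdir2 b) (wdir2 a)); ring.
Qed.

End WirtingerCalculus.

(** * Words of derivatives and the Leibniz rule *)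

Section VariableEqType.
Variable n : nat.

Definition var_code (a : zu_variable n) : 'I_n + 'I_n + unit := match a with
  | Var_z j => inl (inl j)
  | Var_zbar j => inl (inr j)
  | Var_u => inr tt
  end.

Definition var_decode (c : 'I_n + 'I_n + unit) : zu_variable n := match c with
  | inl (inl j) => Var_z j
  | inl (inr j) => Var_zbar j
  | inr _ => @Var_u n
  end.

Lemma var_codeK : cancel var_code var_decode.
Proof. by case. Qed.

HB.instance Definition _ := Equality.copy (zu_variable n) (can_type var_codeK).

End VariableEqType.

Section Splits.
Variable T : eqType.
Implicit Types (s t : seq T).

(* All the ways of distributing the letters of a word over two words. *)
Fixpoint splits s : seq (seq T * seq T) :=
  if s is a :: s' then
    [seq (a :: x.1, x.2) | x <- splits s'] ++ [seq (x.1, a :: x.2) | x <- splits s']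
  else [:: ([::], [::])].

Lemma splits_subseq s x : x \in splits s ->
  [/\ subseq x.1 s, subseq x.2 s & perm_eq (x.1 ++ x.2) s].
Proof.
elim: s x => [|a s IH] x /=; first by rewrite inE => /eqP ->.
rewrite mem_cat => /orP[] /mapP[y /IH[h1 h2 h3] ->] /=.
  split; first by rewrite eqxx.
    exact: subseq_trans h2 (subseq_cons _ _).
  by rewrite perm_cons.
split; [exact: subseq_trans h1 (subseq_cons _ _)|by rewrite eqxx|].
by rewrite -cat1s perm_catCA /= perm_cons.
Qed.

Lemma splits_size s x : x \in splits s -> (size x.1 + size x.2 = size s)%N.
Proof. by move=> /splits_subseq[_ _ /perm_size <-]; rewrite size_cat. Qed.

(** Isolates the Leibniz term in which all derivatives fall on the second factor. *)
Lemma sum_splits_nil (M : zmodType) s (E : seq T * seq T -> M) :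
  (forall x, x \in splits s -> x.1 != [::] -> E x = 0) ->
  \sum_(x <- splits s) E x = E ([::], s).
Proof.
elim: s E => [|a s IH] E /= E0; first by rewrite big_seq1.
rewrite big_cat /= !big_map big_seq_cond big1 ?add0r.
  rewrite (IH (fun x => E (x.1, a :: x.2)))// => x xs x1.
  by apply: E0 => //; rewrite mem_cat; apply/orP; right; apply/mapP; exists x.
move=> x /andP[xs _]; apply: E0 => //.
by rewrite mem_cat; apply/orP; left; apply/mapP; exists x.
Qed.

(** Each letter has one place where it does not kill the product, so a single distribution survives.
    It is applied with P the z letters and a product F conj F. *)
Lemma sum_splits_filter (M : zmodType) (P : pred T) s (E : seq T * seq T -> M) :
  (forall x, x \in splits s -> ~~ (all P x.1 && all (predC P) x.2) -> E x = 0) ->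
  \sum_(x <- splits s) E x = E (seq.filter P s, seq.filter (predC P) s).
Proof.
elim: s E => [|a s IH] E /= E0; first by rewrite big_seq1.
rewrite big_cat /= !big_map.
have in1 x : x \in splits s -> (a :: x.1, x.2) \in
    [seq (a :: y.1, y.2) | y <- splits s] ++ [seq (y.1, a :: y.2) | y <- splits s].
  by move=> xs; rewrite mem_cat; apply/orP; left; apply/mapP; exists x.
have in2 x : x \in splits s -> (x.1, a :: x.2) \in
    [seq (a :: y.1, y.2) | y <- splits s] ++ [seq (y.1, a :: y.2) | y <- splits s].
  by move=> xs; rewrite mem_cat; apply/orP; right; apply/mapP; exists x.
case: (boolP (P a)) => Pa /=.
  rewrite [X in _ + X]big_seq_cond [X in _ + X]big1 ?addr0.
    rewrite (IH (fun x => E (a :: x.1, x.2)))// => x xs nx.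
    by apply: E0; [exact: in1|rewrite /= Pa].
  move=> x /andP[xs _]; apply: E0; first exact: in2.
  by rewrite /= Pa /= andbF.
rewrite [X in X + _]big_seq_cond [X in X + _]big1 ?add0r.
  rewrite (IH (fun x => E (x.1, a :: x.2)))// => x xs nx.
  by apply: E0; [exact: in2|rewrite /= Pa].
move=> x /andP[xs _]; apply: E0; first exact: in1.
by rewrite /= (negbTE Pa).
Qed.

End Splits.

Section Words.
Variables (R : realType) (n : nat).
Local Notation C := (R[i])^o.
Local Notation zu := (zu_space R n).
Local Notation Cn := (Cspace R n.+1).
Local Notation var := (zu_variable n).
Implicit Types (F G : zu -> R[i]) (p v : zu) (a b : var) (s t : seq var).

Definition wword s F : zu -> R[i] := foldr (@wirtinger R n) F s.

Lemma wword_rcons s a F : wword (rcons s a) F = wword s (wirtinger a F).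
Proof. by rewrite /wword foldr_rcons. Qed.

Variable U : set zu.
Hypothesis oU : open U.

Lemma csmooth_wword s F : csmooth U F -> csmooth U (wword s F).
Proof. by move=> sF; elim: s => //= a s IH; exact: csmooth_wirtinger. Qed.

Lemma wword_eq s F G : (forall q, U q -> F q = G q) ->
  forall p, U p -> wword s F p = wword s G p.
Proof. by move=> E; elim: s => //= a s IH p Up; exact: (wirtinger_eq oU Up a IH). Qed.

Lemma wword_cst s (c : R[i]) p : U p -> s != [::] -> wword s (fun=> c) p = 0.
Proof.
elim: s p => //= a s IH p Up _; have [->|s0] := eqVneq s [::].
  exact: (wirtinger_cst p a c).
rewrite (wirtinger_eq oU Up a (fun q Uq => IH q Uq s0)).
exact: (wirtinger_cst p a 0).
Qed.

Lemma wwordD s F G : csmooth U F -> csmooth U G -> forall p, U p ->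
  wword s (fun q => F q + G q) p = wword s F p + wword s G p.
Proof.
move=> sF sG; elim: s => //= a s IH p Up.
rewrite (wirtinger_eq oU Up a IH).
exact: (wirtingerD Up a (csmooth_wword s sF) (csmooth_wword s sG)).
Qed.

Lemma wwordZ s (c : R[i]) F : csmooth U F -> forall p, U p ->
  wword s (fun q => c * F q) p = c * wword s F p.
Proof.
move=> sF; elim: s => //= a s IH p Up.
rewrite (wirtinger_eq oU Up a IH).
rewrite (wirtingerM Up a (csmooth_cst oU c) (csmooth_wword s sF)).
by rewrite (wirtinger_cst p a c) mul0r add0r.
Qed.

Lemma wword_sum (I : Type) (r : seq I) (F : I -> zu -> R[i]) s :
  (forall i, csmooth U (F i)) -> forall p, U p ->
  wword s (fun q => \sum_(i <- r) F i q) p = \sum_(i <- r) wword s (F i) p.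
Proof.
move=> sF; elim: s => //= a s IH p Up.
rewrite (wirtinger_eq oU Up a IH).
exact: (wirtinger_sum oU Up r a (fun i => csmooth_wword s (sF i))).
Qed.

Lemma wword_conj s F : csmooth U F -> forall p, U p ->
  wword s (fun q => (F q)^*%C) p = (wword (map (@var_bar n) s) F p)^*%C.
Proof.
move=> sF; elim: s => //= a s IH p Up.
rewrite (wirtinger_eq oU Up a IH).
exact: (wirtinger_conj Up a (csmooth_wword (map (@var_bar n) s) sF)).
Qed.

Lemma wword_leibniz s F G : csmooth U F -> csmooth U G -> forall p, U p ->
  wword s (fun q => F q * G q) p =
  \sum_(x <- splits s) wword x.1 F p * wword x.2 G p.
Proof.
move=> sF sG; elim: s => [|a s IH] p Up /=; first by rewrite big_seq1.
rewrite (wirtinger_eq oU Up a IH).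
have sP (x : seq var * seq var) : csmooth U (fun q => wword x.1 F q * wword x.2 G q).
  by apply: csmoothM => //; exact: csmooth_wword.
rewrite (wirtinger_sum oU Up (splits s) a sP) big_cat /= !big_map -big_split /=.
apply: eq_bigr => x _.
exact: (wirtingerM Up a (csmooth_wword x.1 sF) (csmooth_wword x.2 sG)).
Qed.

Lemma wword_cat_cons s a t F : csmooth U F -> forall p, U p ->
  wword (s ++ a :: t) F p = wirtinger a (wword (s ++ t) F) p.
Proof.
move=> sF; elim: s => //= b s IH p Up.
rewrite (wirtinger_eq oU Up b IH).
exact: (wirtinger_comm oU b a (csmooth_wword (s ++ t) sF) Up).
Qed.

Lemma wword_perm s t F p : csmooth U F -> U p -> perm_eq s t ->
  wword s F p = wword t F p.
Proof.
move=> sF; elim: s t p => [|a s IH] t p Up st.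
  by move: st; rewrite perm_sym => /perm_nilP ->.
have at_ : a \in t by rewrite -(perm_mem st) inE eqxx.
move: st; case/splitPr: at_ => t1 t2; rewrite perm_sym -[a :: t2]cat1s perm_catCA /= perm_cons perm_sym.
move=> st; rewrite (wword_cat_cons t1 a t2 sF Up) /=.
by apply: (wirtinger_eq oU Up) => q Uq; exact: IH.
Qed.

End Words.

(** * Derivatives of holomorphic functions restricted to a graph *)

Section Composition.
Variables (R : realType) (n : nat).
Local Notation C := (R[i])^o.
Local Notation zu := (zu_space R n).
Local Notation Cn := (Cspace R n.+1).
Local Notation var := (zu_variable n).
Local Notation ew := (@ew R n).
Implicit Types (F G : zu -> R[i]) (p v : zu) (a b : var) (s t : seq var).
Implicit Types (H : Cn -> C).

(** The holomorphic direction of a letter. It is zero for a conjugate variable, whose operator kills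
    holomorphic functions, and for u, which acts only through the coordinate w. *)
Definition hvec a : Cn := if a is Var_z j then delta_mx 0 (lift ord_max j) else 0.

Definition hderiv a H : Cn -> C := fun z => 'd H z (hvec a).

(** Iterated holomorphic derivatives in the z variables; a word with any other letter gives 0
    ([hword_not_z]). *)
Definition hword s H : Cn -> C := foldr hderiv H s.

(** The restriction of the coordinate w to the graph of K. *)
Definition wfun (K : zu -> R) p : R[i] := p.2 +i* K p.

Lemma hvecE a : wcoef1 R a *: emb (wdir1 R a) + wcoef2 R a *: emb (wdir2 R a) =
  hvec a + (wcoef1 R a * (wdir1 R a).2%:C + wcoef2 R a * (wdir2 R a).2%:C) *: ew.
Proof.
have h2 : (2^-1 : R[i]) * 'i%C * 'i%C = - 2^-1 by rewrite -mulrA -expr2 sqr_i mulrN1.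
have hh : (2^-1 : R[i]) + 2^-1 = 1 by rewrite [RHS]splitr div1r.
case: a => [j|j|].
- have -> : (wdir1 R (Var_z j)).2%:C = 0 :> R[i] by [].
  rewrite !mulr0 addr0 scale0r addr0 /emb /hvec /wdir1 /wdir2 /wcoef1 /wcoef2.
  apply/rowP => k; rewrite !mxE eqxx /=; case: unliftP => [i ->|->] /=.
    rewrite !mxE eqxx /= (inj_eq (lift_inj (h := ord_max))).
    case: (i == j); last by rewrite !mulr0 addr0.
    have -> : (0 +i* 1 : R[i]) = 'i%C by [].
    have -> : (1 +i* 0 : R[i]) = 1 by [].
    by rewrite mulr1 mulNr h2 opprK hh.
  by rewrite !mulr0 addr0 (negbTE (neq_lift _ _)).
- have -> : (wdir1 R (Var_zbar j)).2%:C = 0 :> R[i] by [].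
  rewrite !mulr0 addr0 scale0r addr0 /emb /hvec /wdir1 /wdir2 /wcoef1 /wcoef2.
  apply/rowP => k; rewrite !mxE /=; case: unliftP => [i _|_] /=.
    rewrite !mxE eqxx /=; case: (i == j); last by rewrite !mulr0 addr0.
    have -> : (0 +i* 1 : R[i]) = 'i%C by [].
    have -> : (1 +i* 0 : R[i]) = 1 by [].
    by rewrite mulr1 h2 subrr.
  by rewrite !mulr0 addr0.
- have E : emb (wdir1 R (@Var_u n)) = ew.
    apply/rowP => k; rewrite /emb /ew !mxE eqxx /=; case: unliftP => [i ->|->] /=.
      by rewrite !mxE eq_sym (negbTE (neq_lift _ _)).
    by rewrite eqxx.
  have -> : wcoef1 R (@Var_u n) = 1 by [].
  have -> : wcoef2 R (@Var_u n) = 0 by [].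
  rewrite E scale0r scale1r mul0r mul1r !addr0 /hvec add0r.
  by rewrite -[X in X *: _]/(1 : R[i]) scale1r.
Qed.

Variables (K : zu -> R^o) (Om : set Cn) (U : set zu).
Hypothesis oO : open Om.
Hypothesis oU : open U.
Hypothesis UO : forall p, U p -> Om (lift_pt K p).
Hypothesis sK : smooth_on U K.

Lemma hol_on_scale H (c : R[i]) : hol_on Om H -> hol_on Om (fun z => c * H z).
Proof. by move=> hH z Oz; exact: (diffZ_at c 0 (hH z Oz)).1. Qed.

Lemma hol_on_hderiv a H : hol_on Om H -> hol_on Om (hderiv a H).
Proof. by move=> hH; exact: hol_on_diff. Qed.

Lemma csmooth_comp H : hol_on Om H -> csmooth U (fun p => H (lift_pt K p)).
Proof.
move=> hH.
have G H' : hol_on Om H' -> smooth_on U (fun p => complex.Re (H' (lift_pt K p)) : R^o).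
  move=> hH'; apply: (@gen_smooth_on _ _ K Om) => //.
  - by move=> p Up; exact: smooth_on_diff sK Up.
  - by move=> v; exists ('D_v K) => //; apply: gen_smooth; exact: smooth_on_derive.
  - exact: gen_Re.
split; first exact: G.
apply: (eq_smooth_on oU _ (G _ (hol_on_scale (- 'i%C) hH))) => p _.
by case: (H _) => x y /=; ring.
Qed.

Lemma csmooth_wfun : csmooth U (wfun K).
Proof.
split; last by exact: sK.
apply: (smooth_coinduction oU (F := fun k => k = (fun p : zu => p.2 : R^o) \/
    exists c, k = cst c)).
- move=> k [->|[c ->]] p Up; first by have [] := zu_coord_u p.
  exact: differentiable_cst.
- move=> k [->|[c ->]] v.
    by exists (cst v.2); [right; exists v.2|move=> p _; have [_ ->] := zu_coord_u p].
  by exists (cst 0); [right; exists 0|move=> p _; rewrite derive_cst].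
- by left.
Qed.

Lemma real_derivative_comp H p v : hol_on Om H -> U p ->
  real_derivative v (fun q => H (lift_pt K q)) p =
  'd H (lift_pt K p) (emb v) + 'd H (lift_pt K p) ew * (0 +i* 'D_v K p).
Proof.
move=> hH Up; have dK := smooth_on_diff sK Up.
have dH := hH _ (UO Up).
have [_ DRe] := lift_pt_chain dK dH.
have [dmi DmI] := diffZ_at (- 'i%C) (emb v) dH.
have [_ DmW] := diffZ_at (- 'i%C) ew dH.
have [_ DIm] := lift_pt_chain dK dmi.
have ImE : (fun q => complex.Im (H (lift_pt K q)) : R^o) =
    (fun q => complex.Re (((- 'i%C) *: H) (lift_pt K q)) : R^o).
  apply/funext => q; rewrite fctE; case: (H _) => x y.
  by rewrite -[_ *: _]/(- 'i%C * (x +i* y)) /=; ring.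
have E2 := etrans (congr1 (fun k : zu -> R^o => 'D_v k p) ImE) (etrans (DIm v)
  (congr2 (fun a b : R[i] => complex.Re a + complex.Re ('i%C * b) * 'D_v K p) DmI DmW)).
have alg (A B : R[i]) (d : R) : (complex.Re A + complex.Re ('i%C * B) * d) +i*
    (complex.Re (- 'i%C * A) + complex.Re ('i%C * (- 'i%C * B)) * d) = A + B * (0 +i* d).
  case: A B => [a1 a2] [b1 b2]; apply/eqP; rewrite eq_complex /=.
  by apply/andP; split; apply/eqP; ring.
exact: (etrans (congr2 (fun x y : R => x +i* y) (DRe v) E2) (alg _ _ _)).
Qed.

Lemma real_derivative_wfun v p : U p ->
  real_derivative v (wfun K) p = v.2%:C + (0 +i* 'D_v K p).
Proof.
move=> Up; rewrite /real_derivative /wfun /=.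
have [_ ->] := zu_coord_u p.
by apply/eqP; rewrite eq_complex /= addr0 add0r !eqxx.
Qed.

Lemma wirtinger_comp a H p : hol_on Om H -> U p ->
  wirtinger a (fun q => H (lift_pt K q)) p =
  hderiv a H (lift_pt K p) + 'd H (lift_pt K p) ew * wirtinger a (wfun K) p.
Proof.
move=> hH Up; rewrite (wirtingerE a (wfun K)) (wirtingerE a (fun q => H (lift_pt K q))).
rewrite (real_derivative_comp (wdir1 R a) hH Up) (real_derivative_comp (wdir2 R a) hH Up).
rewrite (real_derivative_wfun (wdir1 R a) Up) (real_derivative_wfun (wdir2 R a) Up).
have L : wcoef1 R a * 'd H (lift_pt K p) (emb (wdir1 R a)) +
    wcoef2 R a * 'd H (lift_pt K p) (emb (wdir2 R a)) =
    'd H (lift_pt K p) (hvec a) +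
    (wcoef1 R a * (wdir1 R a).2%:C + wcoef2 R a * (wdir2 R a).2%:C) *
      'd H (lift_pt K p) ew.
  have := congr1 ('d H (lift_pt K p)) (hvecE a).
  by rewrite 2!linearD 3!linearZ.
have alg (A B D E d1 d2 c1 c2 e1 e2 : R[i]) : c1 * A + c2 * B = E + (c1 * e1 + c2 * e2) * D ->
    c1 * (A + D * d1) + c2 * (B + D * d2) = E + D * (c1 * (e1 + d1) + c2 * (e2 + d2)).
  move=> L'; have -> : c1 * (A + D * d1) + c2 * (B + D * d2) =
    c1 * A + c2 * B + D * (c1 * d1 + c2 * d2) by ring.
  by rewrite L'; ring.
exact: alg L.
Qed.

Hypothesis U0 : U 0.
Hypothesis K0 : K 0 = 0.

Lemma lift_pt0 : lift_pt K 0 = 0.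
Proof.
apply/rowP => j; rewrite lift_ptE K0 mxE; case: unlift => [i|//].
by rewrite /= !mxE.
Qed.

(* Every summand of the Leibniz expansion but one contains a derivative of    *)
(* wfun K along a proper nonempty subword.                                    *)
Lemma wword_comp s H : hol_on Om H ->
  (forall t, subseq t s -> t != [::] -> (size t < size s)%N -> wword t (wfun K) 0 = 0) ->
  wword s (fun p => H (lift_pt K p)) 0 =
  hword s H 0 + (s != [::])%:R * ('d H 0 ew * wword s (wfun K) 0).
Proof.
move: {2}(size s) (erefl (size s)) => m; elim: m s H => [|m IH] s H ss hH ks.
  move: ss => /size0nil ->.
  by rewrite /= lift_pt0 mul0r addr0.
case/lastP: s ss ks => // s a; rewrite size_rcons => -[ss] ks.
have -> : rcons s a != [::] by case: (s).
rewrite mul1r !wword_rcons.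
have hHw := hol_on_diff ew oO hH.
have sHw := csmooth_comp hHw.
have sW := csmooth_wirtinger oU a csmooth_wfun.
rewrite (wword_eq oU s (fun q Uq => wirtinger_comp a hH Uq) U0).
have sha := csmooth_comp (hol_on_hderiv a hH).
rewrite (wwordD oU s sha (csmoothM oU sHw sW) U0).
have sub_s t : subseq t s -> subseq t (rcons s a).
  by move=> ts; apply: subseq_trans ts _; rewrite -cats1 prefix_subseq.
congr (_ + _).
  rewrite (IH s (hderiv a H) ss (hol_on_hderiv a hH)); last first.
    by move=> t ts t0 st; apply: ks => //; [exact: sub_s|rewrite ltnS ltnW].
  rewrite /hword foldr_rcons; have [->|s0] := eqVneq s [::]; first by rewrite mul0r addr0.
  by rewrite (ks s)// ?sub_s// mulr0 mulr0 addr0.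
rewrite (wword_leibniz oU s sHw sW U0) sum_splits_nil /=; last first.
  move=> x xs x1; rewrite -(wword_rcons x.2 a).
  have [_ h2 _] := splits_subseq xs.
  rewrite (ks (rcons x.2 a)) ?mulr0//.
  - by rewrite -!cats1 cat_subseq.
  - by case: (x.2).
  - rewrite size_rcons ltnS -(splits_size xs) -[ltnLHS]add0n ltn_add2r lt0n size_eq0.
    exact: x1.
by rewrite lift_pt0.
Qed.

End Composition.

(** * Weighted jets of the defining functions *)


Section WeightedWords.
Variable n : nat.
Variable L : n.-tuplelexi rat.
Local Notation var := (zu_variable n).
Implicit Types (a b : var) (s t : seq var).

Definition is_z a := if a is Var_z _ then true else false.
Definition is_zbar a := if a is Var_zbar _ then true else false.

Definition wt s : rat := \sum_(a <- s) weight_of_variable L a.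

Lemma wt_nil : wt [::] = 0. Proof. exact: big_nil. Qed.

Lemma wt_cat s t : wt (s ++ t) = wt s + wt t.
Proof. exact: big_cat. Qed.

Lemma wt_bar s : wt (map (@var_bar n) s) = wt s.
Proof. by rewrite /wt big_map; apply: eq_bigr => -[]. Qed.

Lemma var_barK : involutive (@var_bar n).
Proof. by case. Qed.

Lemma all_is_zbar s : all is_zbar (map (@var_bar n) s) = all is_z s.
Proof. by rewrite all_map; apply: eq_all => -[]. Qed.

Lemma all_is_z_bar s : all is_z (map (@var_bar n) s) = all is_zbar s.
Proof. by rewrite all_map; apply: eq_all => -[]. Qed.

(* The words along which the graphing function of a hypersurface in normal    *)
(* form of weight L has to vanish.                                            *)
Definition good s := (wt s < 1) || ((wt s <= 1) && (all is_z s || all is_zbar s)).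

Lemma good_bar s : good (map (@var_bar n) s) = good s.
Proof. by rewrite /good wt_bar all_is_zbar all_is_z_bar orbC [all _ _ || _]orbC orbC. Qed.

Hypothesis L0 : forall j, 0 <= tnth L j.

Lemma weight_ge0 a : 0 <= weight_of_variable L a.
Proof. by case: a => [j|j|] /=. Qed.

Lemma wt_ge0 s : 0 <= wt s.
Proof. by apply: sumr_ge0 => a _; exact: weight_ge0. Qed.

Lemma wt_subseq s t : subseq t s -> wt t <= wt s.
Proof.
elim: s t => [|a s IH] t; first by rewrite subseq0 => /eqP ->.
case: t => [|b t]; first by rewrite wt_nil wt_ge0.
rewrite /wt /= [X in _ <= X]big_cons; case: eqP => [->|_] h.
  by rewrite big_cons lerD2l; exact: IH.
by apply: le_trans (IH _ h) _; rewrite lerDr weight_ge0.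
Qed.

Lemma good_subseq s t : subseq t s -> good s -> good t.
Proof.
move=> ts /orP[h|/andP[h /orP[p|p]]]; rewrite /good.
- by rewrite (le_lt_trans (wt_subseq ts) h).
- rewrite (le_trans (wt_subseq ts) h) /=; apply/orP; right; apply/orP; left.
  by apply/allP => a /(mem_subseq ts); exact: (allP p).
- rewrite (le_trans (wt_subseq ts) h) /=; apply/orP; right; apply/orP; right.
  by apply/allP => a /(mem_subseq ts); exact: (allP p).
Qed.

Lemma good_no_u s : good s -> @Var_u n \notin s.
Proof.
move=> gs; apply/negP => us.
have h1 : 1 <= wt s.
  have := @wt_subseq s [:: @Var_u n]; rewrite sub1seq => /(_ us).
  by rewrite /wt big_seq1.
case/orP: gs => [|/andP[_ /orP[] /allP/(_ _ us)//]].
by rewrite ltNge h1.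
Qed.

End WeightedWords.

Section Jets.
Variables (R : realType) (n : nat).
Local Notation C := (R[i])^o.
Local Notation zu := (zu_space R n).
Local Notation Cn := (Cspace R n.+1).
Local Notation var := (zu_variable n).
Local Notation ew := (@ew R n).
Local Notation normc := Normc.normc.
Implicit Types (a b : var) (s t : seq var) (H : Cn -> C).

Lemma hderiv_cst0 a (z : Cn) : hderiv a (fun=> 0 : C) z = 0.
Proof. by have := congr1 (fun F : Cn -> C => F (hvec R a)) (@diff_cst _ Cn C 0 z). Qed.

Lemma hword_not_z s H (z : Cn) : ~~ all (@is_z n) s -> hword s H z = 0 :> R[i].
Proof.
elim/last_ind: s H z => // s a IH H z.
rewrite all_rcons negb_and /hword foldr_rcons => /orP[na|]; last exact: IH.
have -> : hderiv a H = (fun=> 0 : C).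
  apply/funext => w; rewrite /hderiv /hvec; case: a na => // *; exact: linear0.
elim: s {IH} z => //= b s IH z.
have -> : foldr (@hderiv R n) (fun=> 0 : C) s = (fun=> 0 : C) by apply/funext.
exact: hderiv_cst0.
Qed.

Lemma wirtinger_u a (p : zu) : wirtinger a (fun q : zu => q.2%:C) p = (a == @Var_u n)%:R.
Proof.
have D v : real_derivative v (fun q : zu => q.2%:C) p = v.2%:C.
  rewrite /real_derivative /= derive_cst; have [_ ->] := zu_coord_u p; by [].
rewrite wirtingerE !D; case: a => [j|j|].
- by have -> : (wdir1 R (Var_z j)).2%:C = 0 :> R[i] by []; rewrite !mulr0 addr0.
- by have -> : (wdir1 R (Var_zbar j)).2%:C = 0 :> R[i] by []; rewrite !mulr0 addr0.
- by rewrite /= mul0r addr0 mul1r.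
Qed.

Section Graph.
Variables (K : zu -> R^o) (Om : set Cn) (U : set zu).
Hypothesis oO : open Om.
Hypothesis oU : open U.
Hypothesis UO : forall p, U p -> Om (lift_pt K p).
Hypothesis sK : smooth_on U K.
Hypothesis U0 : U 0.
Hypothesis K0 : K 0 = 0.

Local Notation Kc := (fun p : zu => (K p)%:C).

Lemma csmooth_u : csmooth U (fun q : zu => q.2%:C).
Proof.
have := csmoothD oU (csmooth_wfun oU sK) (csmoothM oU (csmooth_cst oU (- 'i%C)) (csmooth_real oU sK)).
apply: csmooth_eq => // p _; rewrite /wfun; apply/eqP; rewrite eq_complex /=.
by apply/andP; split; apply/eqP; ring.
Qed.

Lemma wword_wfun s : s != [::] ->
  wword s (wfun K) 0 = (s == [:: @Var_u n])%:R + 'i%C * wword s Kc 0.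
Proof.
move=> s0.
have E p : wfun K p = p.2%:C + 'i%C * (K p)%:C.
  by apply/eqP; rewrite /wfun eq_complex /=; apply/andP; split; apply/eqP; ring.
rewrite (wword_eq oU s (fun q _ => E q) U0).
have sK' := csmooth_real oU sK.
rewrite (wwordD oU s csmooth_u (csmoothM oU (csmooth_cst oU 'i%C) sK') U0).
rewrite (wwordZ oU s 'i%C sK' U0); congr (_ + _).
case/lastP: s s0 => // s a _; rewrite wword_rcons.
rewrite (wword_eq oU s (fun q _ => wirtinger_u a q) U0).
have [->|s0] := eqVneq s [::]; first by rewrite /= eqseq_cons eqxx andbT.
rewrite (wword_cst oU _ U0 s0); case: s s0 => // b s _.
by rewrite rcons_cons eqseq_cons; case: s => [|c s]; rewrite andbF.
Qed.

Lemma wword_bar_real s : wword (map (@var_bar n) s) Kc 0 = (wword s Kc 0)^*%C.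
Proof.
have sK' := csmooth_real oU sK.
have := wword_conj oU (map (@var_bar n) s) sK' U0.
rewrite (mapK (@var_barK n)) => <-; apply: (wword_eq oU _ _ U0) => q _.
by rewrite /= oppr0.
Qed.

(** If K has no derivatives along the shorter nonempty subwords, the only effect of the graph on the
    derivative along s is through the derivative of w = u + i K along the whole of s. *)
Lemma wword_comp_kill s H : hol_on Om H -> s != [:: @Var_u n] ->
  (forall t, subseq t s -> t != [::] -> t != [:: @Var_u n]) ->
  (forall t, subseq t s -> t != [::] -> (size t < size s)%N -> wword t Kc 0 = 0) ->
  wword s (fun p => H (lift_pt K p)) 0 =
  hword s H 0 + 'd H 0 ew * ('i%C * wword s Kc 0) * (s != [::])%:R.
Proof.
move=> hH su nu ks; rewrite (wword_comp oO oU UO sK U0 K0 hH); last first.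
  move=> t ts t0 st; rewrite (wword_wfun t0) (ks t ts t0 st) mulr0 addr0.
  by rewrite (negbTE (nu t ts t0)).
congr (_ + _); have [->|s0] := eqVneq s [::]; first by rewrite mul0r mulr0.
by rewrite mul1r mulr1 (wword_wfun s0) (negbTE su) add0r.
Qed.

Lemma wword_comp_u H : hol_on Om H ->
  wword [:: @Var_u n] (fun p => H (lift_pt K p)) 0 =
  'd H 0 ew * (1 + 'i%C * wword [:: @Var_u n] Kc 0).
Proof.
move=> hH; rewrite (wword_comp oO oU UO sK U0 K0 hH); last first.
  by move=> [|b t] //= ts _; rewrite ltnS ltn0.
by rewrite hword_not_z// add0r mul1r wword_wfun// eqxx.
Qed.

Variables (N : nat) (Z : Cn -> C) (F : 'I_N -> Cn -> C).
Hypothesis hZ : hol_on Om Z.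
Hypothesis hF : forall j, hol_on Om (F j).
Hypothesis Z0 : Z 0 = 0 :> R[i].
Hypothesis F0 : forall j, F j 0 = 0 :> R[i].
Hypothesis graphE : forall p, U p ->
  complex.Re (Z (lift_pt K p)) + \sum_(j < N) normc (F j (lift_pt K p)) ^+ 2 = 0.

Local Notation Zc := (fun p => Z (lift_pt K p)).
Local Notation Fc j := (fun p => F j (lift_pt K p)).

(** The derivative along s, at 0, of the identity (Z + conj Z) / 2 + sum F_j conj F_j = 0 on the
    graph. Conjugation turns a word into its barred word. *)
Lemma graph_expand s :
  2^-1 * (wword s Zc 0 + (wword (map (@var_bar n) s) Zc 0)^*%C) +
  \sum_(j < N) \sum_(x <- splits s)
    wword x.1 (Fc j) 0 * (wword (map (@var_bar n) x.2) (Fc j) 0)^*%C = 0.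
Proof.
have sZ := csmooth_comp oO oU UO sK hZ.
have sF j := csmooth_comp oO oU UO sK (hF j).
have sZ' := csmooth_conj oU sZ.
have sF' j := csmooth_conj oU (sF j).
have E p : U p -> 2^-1 * (Zc p + (Zc p)^*%C) +
    \sum_(j < N) Fc j p * (Fc j p)^*%C = 0.
  move=> Up; rewrite mulrC -[X in X + _]ReJ_add.
  have -> : \sum_(j < N) Fc j p * (Fc j p)^*%C = (\sum_(j < N) normc (Fc j p) ^+ 2)%:C.
    rewrite rmorph_sum; apply: eq_bigr => j _; rewrite -sqr_normc normc_def rmorphXn.
    by case: (F j _).
  by rewrite -rmorphD graphE.
have sum_s : csmooth U (fun p => \sum_(j < N) Fc j p * (Fc j p)^*%C).
  by apply: csmooth_sum => // j; exact: csmoothM.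
have W0 : wword s (fun=> 0) (0 : zu) = 0.
  have [->//|s0] := eqVneq s [::]; exact: (wword_cst oU 0 U0 s0).
apply: etrans (etrans (wword_eq oU s E U0) W0).
rewrite (wwordD oU s (csmoothM oU (csmooth_cst oU 2^-1) (csmoothD oU sZ sZ')) sum_s U0).
rewrite (wwordZ oU s 2^-1 (csmoothD oU sZ sZ') U0) (wwordD oU s sZ sZ' U0).
rewrite (wword_conj oU s sZ U0); congr (_ + _).
rewrite (wword_sum oU _ s (fun j => csmoothM oU (sF j) (sF' j)) U0).
apply: eq_bigr => j _.
rewrite (wword_leibniz oU s (sF j) (sF' j) U0); apply: eq_bigr => x _.
by rewrite (wword_conj oU x.2 (sF j) U0).
Qed.

Variable L : n.-tuplelexi rat.
Hypothesis L0 : forall j, 0 <= tnth L j.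

Lemma good_not_u s : good L s -> forall t, subseq t s -> t != [:: @Var_u n].
Proof.
move=> gs t ts; apply: contraTneq ts => ->; rewrite sub1seq.
exact: good_no_u gs.
Qed.

Section FromNormalForm.
Hypothesis kill : forall s, good L s -> wword s Kc 0 = 0.
Hypothesis kill_u : wword [:: @Var_u n] Kc 0 = 0.

(** Along good words the graph cannot be told from v = 0. *)
Lemma wword_comp_good s H : hol_on Om H -> good L s ->
  wword s (fun p => H (lift_pt K p)) 0 = hword s H 0.
Proof.
move=> hH gs; have nu := good_not_u gs; rewrite (wword_comp_kill hH).
- by rewrite (kill gs) !mulr0 mul0r addr0.
- exact: nu (subseq_refl s).
- by move=> t ts _; exact: nu.
- by move=> t ts _ _; apply: kill; exact: good_subseq gs.
Qed.

(** Expand along s followed by its conjugate, a word of weight below 1. For nonempty s, Z drops out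
    because the word is mixed, and of each product F_k conj F_k only |d^s F_k (0)|^2 survives. A
    vanishing sum of nonnegative terms has vanishing terms. *)
Lemma jets_of_squares j s : all (@is_z n) s -> wt L s + wt L s < 1 -> hword s (F j) 0 = 0 :> R[i].
Proof.
move=> zs ws; have [->|s0] := eqVneq s [::]; first exact: F0.
pose sb := map (@var_bar n) s; have bzs : all (@is_zbar n) sb by rewrite all_is_zbar.
have nzb : ~~ all (@is_z n) sb.
  by rewrite all_is_z_bar; case: (s) s0 zs => // -[].
have g1 : good L (s ++ sb) by rewrite /good wt_cat wt_bar ws.
have bar1 : map (@var_bar n) (s ++ sb) = sb ++ s by rewrite map_cat (mapK (@var_barK n)).
have g2 : good L (sb ++ s) by rewrite -bar1 good_bar.
have nz1 : ~~ all (@is_z n) (s ++ sb) by rewrite all_cat (negbTE nzb) andbF.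
have nz2 : ~~ all (@is_z n) (sb ++ s) by rewrite all_cat (negbTE nzb).
have := graph_expand (s ++ sb).
rewrite bar1 (wword_comp_good hZ g1) (wword_comp_good hZ g2).
rewrite (hword_not_z Z 0 nz1) (hword_not_z Z 0 nz2). rewrite conjc0 addr0 mulr0 add0r.
have T k : \sum_(x <- splits (s ++ sb))
    wword x.1 (Fc k) 0 * (wword (map (@var_bar n) x.2) (Fc k) 0)^*%C =
    hword s (F k) 0 * (hword s (F k) 0)^*%C.
  have sg x : x \in splits (s ++ sb) -> good L x.1 /\ good L (map (@var_bar n) x.2).
    move=> /splits_subseq[x1 x2 _]; rewrite good_bar.
    by split; exact: good_subseq g1.
  rewrite (sum_splits_filter (P := @is_z n)); last first.
    move=> x xs; have [gx1 gx2] := sg x xs.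
    rewrite (wword_comp_good (hF k) gx1) (wword_comp_good (hF k) gx2) negb_and.
    case/orP => nx; first by rewrite hword_not_z// mul0r.
    rewrite [X in _ * X^*%C]hword_not_z ?conjc0 ?mulr0//.
    apply: contra nx; rewrite all_is_z_bar => /allP h.
    by apply/allP => b /h; case: b.
  have f1 : [seq x <- s ++ sb | is_z x] = s.
    rewrite filter_cat (all_filterP zs) -[RHS]cats0; congr (_ ++ _).
    by rewrite -(filter_pred0 sb); apply: eq_in_filter => b /(allP bzs); case: b.
  have f2 : [seq x <- s ++ sb | predC (@is_z n) x] = sb.
    rewrite filter_cat -[RHS]cat0s; congr (_ ++ _).
      by rewrite -(filter_pred0 s); apply: eq_in_filter => b /(allP zs); case: b.
    by apply/all_filterP/allP => b /(allP bzs); case: b.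
  rewrite f1 f2 /sb (mapK (@var_barK n)).
  have gs : good L s by rewrite /good (le_lt_trans _ ws)// lerDl wt_ge0.
  by rewrite (wword_comp_good (hF k) gs).
rewrite (eq_bigr _ (fun k _ => T k)) => /eqP.
rewrite psumr_eq0 => [|k _]; last exact: mulcJ_ge0.
move=> /allP/(_ j); rewrite mem_index_enum => /(_ isT) /=.
by rewrite mulf_eq0 conjc_eq0 orbb => /eqP.
Qed.

(** A nonempty word in z kills conj F_k, and along the empty word the factor is F_k (0) = 0. *)
Lemma pure_splits s k : all (@is_z n) s -> good L s ->
  \sum_(x <- splits s) wword x.1 (Fc k) 0 * (wword (map (@var_bar n) x.2) (Fc k) 0)^*%C = 0.
Proof.
move=> zs gs; rewrite big_seq_cond big1// => x /andP[xs _].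
have [x1 x2 _] := splits_subseq xs.
have gx2 : good L (map (@var_bar n) x.2) by rewrite good_bar; exact: good_subseq gs.
rewrite (wword_comp_good (hF k) gx2).
have [->|x20] := eqVneq x.2 [::]; first by rewrite /= F0 conjc0 mulr0.
rewrite [X in _ * X^*%C]hword_not_z ?conjc0 ?mulr0//.
rewrite all_is_z_bar; case: (x.2) x20 x2 => // b t _ /mem_subseq h.
have /(allP zs) : b \in s by apply: h; rewrite inE eqxx.
by case: (b).
Qed.

Lemma jets_of_linear_part s : all (@is_z n) s -> wt L s <= 1 -> hword s Z 0 = 0 :> R[i].
Proof.
move=> zs ws; have [->|s0] := eqVneq s [::]; first exact: Z0.
have gs : good L s by rewrite /good ws zs orbT.
have gb : good L (map (@var_bar n) s) by rewrite good_bar.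
have := graph_expand s; rewrite (wword_comp_good hZ gs) (wword_comp_good hZ gb).
rewrite [X in X^*%C]hword_not_z; last first.
  by rewrite all_is_z_bar; case: (s) s0 zs => // -[].
rewrite conjc0 addr0 big1 ?addr0 => [|k _]; last exact: pure_splits.
by move/eqP; rewrite mulf_eq0 invr_eq0 pnatr_eq0 => /eqP.
Qed.

(** In the u-derivative of the identity each product F_k conj F_k keeps an undifferentiated factor,
    which vanishes at 0. What remains is the real part of dZ/dw. *)
Lemma normal_derivative_imaginary : complex.Re ('d Z 0 ew) = 0.
Proof.
have := graph_expand [:: @Var_u n].
have -> : map (@var_bar n) [:: @Var_u n] = [:: @Var_u n] by [].
rewrite (wword_comp_u hZ) kill_u mulr0 addr0 mulr1 big1 ?addr0 => [|k _]; last first.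
  rewrite /= !big_cons big_nil /= !lift_pt0// F0 conjc0 mulr0 mul0r !addr0//.
by rewrite mulrC -ReJ_add => /complexI.
Qed.

End FromNormalForm.

Section ToNormalForm.
Hypothesis jF : forall j s, all (@is_z n) s -> wt L s + wt L s < 1 -> hword s (F j) 0 = 0 :> R[i].
Hypothesis jZ : forall s, all (@is_z n) s -> wt L s <= 1 -> hword s Z 0 = 0 :> R[i].
Variable lam : R.
Hypothesis dZ : 'd Z 0 ew = 0 +i* lam.
Hypothesis lam0 : lam != 0.

(** Induction on the length of s, all subwords of a good word being good. The products F_k conj F_k
    contribute nothing: in a word of weight below 1 one of the two factors has weight below 1/2, and
    in a pure word one factor is differentiated by letters that kill it. The Z terms reduce to - lam
    times the derivative of K along s. *)
Lemma graph_jets s : good L s -> wword s Kc 0 = 0.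
Proof.
move: {2}(size s) (leqnn (size s)) => m; elim: m s => [|m IH] s sm gs.
  by move: sm; rewrite leqn0 => /nilP ->; rewrite /= K0.
have [->|s0] := eqVneq s [::]; first by rewrite /= K0.
have kill t : subseq t s -> t != [::] -> (size t < size s)%N -> wword t Kc 0 = 0.
  by move=> ts t0 st; apply: IH; [rewrite -ltnS (leq_trans st)|exact: good_subseq gs].
have kill' t : subseq t s -> t != [::] -> (size t < size s)%N ->
    wword (map (@var_bar n) t) Kc 0 = 0.
  by move=> ts t0 st; rewrite wword_bar_real (kill t)// conjc0.
have comp t H : hol_on Om H -> subseq t s ->
    wword t (fun p => H (lift_pt K p)) 0 =
    hword t H 0 + 'd H 0 ew * ('i%C * wword t Kc 0) * (t != [::])%:R.
  move=> hH ts; have gt := good_subseq L0 ts gs; have nu := good_not_u gt.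
  apply: (wword_comp_kill hH); first exact: nu (subseq_refl t).
    by move=> r rt _; exact: nu.
  move=> r rt r0 sr; apply: kill => //; first exact: subseq_trans rt ts.
  exact: leq_trans sr (size_subseq ts).
have compb t H : hol_on Om H -> subseq t s ->
    wword (map (@var_bar n) t) (fun p => H (lift_pt K p)) 0 =
    hword (map (@var_bar n) t) H 0 +
    'd H 0 ew * ('i%C * (wword t Kc 0)^*%C) * (t != [::])%:R.
  move=> hH ts; have gt := good_subseq L0 ts gs.
  have gb : good L (map (@var_bar n) t) by rewrite good_bar.
  have nu := good_not_u gb; rewrite (wword_comp_kill hH).
  - by rewrite wword_bar_real -!size_eq0 size_map.
  - exact: nu (subseq_refl _).
  - by move=> r rt _; exact: nu.
  move=> r rt r0; rewrite size_map => sr.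
  rewrite -[r](mapK (@var_barK n)); apply: kill'.
  - apply: subseq_trans ts; rewrite -[t](mapK (@var_barK n)); exact: map_subseq.
  - by rewrite -size_eq0 size_map size_eq0.
  - by rewrite size_map (leq_trans sr)// size_subseq.
have jZ' t : good L t -> hword t Z 0 = 0 :> R[i].
  case: (boolP (all (@is_z n) t)) => zt gt; last exact: hword_not_z.
  by apply: jZ => //; case/orP: gt => [/ltW|/andP[]].
have gsb : good L (map (@var_bar n) s) by rewrite good_bar.
have S0 k : \sum_(x <- splits s)
   wword x.1 (Fc k) 0 * (wword (map (@var_bar n) x.2) (Fc k) 0)^*%C = 0.
  rewrite big_seq_cond big1// => x /andP[xs _].
  have [x1 x2 px] := splits_subseq xs; have sz := splits_size xs.
  have [x10|x10] := eqVneq x.1 [::]; first by rewrite x10 /= lift_pt0// F0 mul0r.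
  have [x20|x20] := eqVneq x.2 [::]; first by rewrite x20 /= lift_pt0// F0 conjc0 mulr0.
  have s1 : (size x.1 < size s)%N by rewrite -sz -[ltnLHS]addn0 ltn_add2l lt0n size_eq0.
  have s2 : (size x.2 < size s)%N by rewrite -sz -[ltnLHS]add0n ltn_add2r lt0n size_eq0.
  rewrite (comp _ _ (hF k) x1) (compb _ _ (hF k) x2) (kill _ x1 x10 s1).
  rewrite (kill _ x2 x20 s2) conjc0 !mulr0 !mul0r !addr0.
  have wx : wt L x.1 + wt L x.2 = wt L s by rewrite -wt_cat; exact: perm_big.
  case/orP: gs => [ws|/andP[_ /orP[zs|zs]]].
  (* The lighter of the two subwords has less than half of a weight below 1. *)
  - have [h|h] : wt L x.1 + wt L x.1 < 1 \/ wt L x.2 + wt L x.2 < 1.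
      case: (lerP (wt L x.1) (wt L x.2)) => h; [left|right]; apply: le_lt_trans ws;
        by rewrite -wx ?lerD2l ?lerD2r// ltW.
    + have -> : hword x.1 (F k) 0 = 0 :> R[i]; last by rewrite mul0r.
      by case: (boolP (all (@is_z n) x.1)) => [zx|/hword_not_z//]; exact: jF.
    + have -> : hword (map (@var_bar n) x.2) (F k) 0 = 0 :> R[i]; last by rewrite conjc0 mulr0.
      case: (boolP (all (@is_z n) (map (@var_bar n) x.2))) => [zx|/hword_not_z//].
      by apply: jF => //; rewrite wt_bar.
  - rewrite [X in _ * X^*%C]hword_not_z ?conjc0 ?mulr0//.
    rewrite all_is_z_bar; case: (x.2) x20 x2 => // b t _ /mem_subseq h.
    have /(allP zs) : b \in s by apply: h; rewrite inE eqxx.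
by case: (b).
  - rewrite hword_not_z ?mul0r//.
    case: (x.1) x10 x1 => // b t _ /mem_subseq h.
    have /(allP zs) : b \in s by apply: h; rewrite inE eqxx.
by case: (b).
have := graph_expand s; rewrite big1 ?addr0 => [|k _]; last exact: S0.
rewrite (comp _ _ hZ (subseq_refl s)) (compb _ _ hZ (subseq_refl s)) s0 !mulr1.
rewrite (jZ' _ gs) (jZ' _ gsb) !add0r.
set q := wword s Kc 0.
(* Since dZ/dw = i lam, the term from Z and the conjugate of its barred term coincide, so that they
   add up instead of cancelling. *)
have -> : 'd Z 0 ew * ('i%C * q) = - lam%:C * q.
  by rewrite dZ mulrA; congr (_ * q); apply/eqP; rewrite eq_complex /=; apply/andP; split;
    apply/eqP; ring.
have -> : ('d Z 0 ew * ('i%C * q^*%C))^*%C = - lam%:C * q.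
  rewrite dZ mulrA; case: q => x y; apply/eqP; rewrite eq_complex /=.
  by apply/andP; split; apply/eqP; ring.
have -> : 2^-1 * (- lam%:C * q + - lam%:C * q) = - lam%:C * q.
  by rewrite mulrDr -mulrDl -[2^-1]div1r -splitr mul1r.
move/eqP; rewrite mulf_eq0 oppr_eq0 => /orP[/eqP|/eqP//].
by move=> /complexI/eqP; rewrite (negbTE lam0).
Qed.

(** The u-derivative of K at 0 is a real number x, and the real part of i lam (1 + i x) is - lam
    x. *)
Lemma graph_jet_u : wword [:: @Var_u n] Kc 0 = 0.
Proof.
have := graph_expand [:: @Var_u n].
have -> : map (@var_bar n) [:: @Var_u n] = [:: @Var_u n] by [].
have qr := wword_bar_real [:: @Var_u n].
have -> : \sum_(j < N) \sum_(x <- splits [:: @Var_u n])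
    wword x.1 (Fc j) 0 * (wword (map (@var_bar n) x.2) (Fc j) 0)^*%C = 0.
  rewrite big1// => k _.
  by rewrite /= !big_cons big_nil /= !lift_pt0// F0 conjc0 mulr0 mul0r !addr0.
rewrite addr0 (wword_comp_u hZ) dZ.
move: qr; rewrite -[map _ _]/[:: @Var_u n]; move: (wword _ Kc 0) => q qr.
have [x ->] : exists x : R, q = x%:C.
  exists (complex.Re q); move: qr; case: q => a b /(congr1 (@complex.Im R)) /= h.
  by apply/eqP; rewrite eq_complex /= eqxx; apply/eqP; lra.
move/eqP; rewrite mulf_eq0 invr_eq0 pnatr_eq0 /= eq_complex /= => /andP[/eqP h _].
have {h} : lam * x = 0 by lra.
by move/eqP; rewrite mulf_eq0 (negbTE lam0) => /eqP ->.
Qed.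

End ToNormalForm.

End Graph.

End Jets.

(** * Greatest lower bounds of weights *)


Section GreatestLowerBound.
Variable n : nat.
Implicit Types (L : n.-tuplelexi rat) (B : set (n.-tuplelexi rat)).

(* The k-th entry of a weight is (1 - sum_(j < k) a_j mu_j) / a_k, and for a  *)
(* positive lower bound v0 on it only finitely many values of the             *)
(* coefficients are possible.                                                 *)
Lemma weight_entry_max (V : set rat) (k : 'I_n) (mu : 'I_n -> rat) : V !=set0 ->
  (forall v, V v -> 0 <= v /\ (v = 0 \/ exists a : 'I_n -> nat,
    [/\ (0 < a k)%N, forall j : 'I_n, (j < k)%N -> v <= mu j &
     v * (a k)%:R = 1 - \sum_(j < n | (j < k)%N) (a j)%:R * mu j])) ->
  exists2 v, V v & forall v', V v' -> v' <= v.
Proof.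
move=> [w Vw] HV.
have [[v0 Vv0 v00]|none] := pselect (exists2 v, V v & 0 < v); last first.
  exists w => // v' Vv'; have [w0 _] := HV w Vw; apply: le_trans w0.
  by rewrite leNgt; apply/negP => v'0; apply: none; exists v'.
(* The relevant coefficients of an entry v >= v0 are at most 1 / v0, since each of them multiplies a
   number at least v0 in a sum of nonnegative terms equal to 1. *)
have [M HM] : exists M : nat, v0^-1 <= M%:R.
  by exists (Num.bound v0^-1); apply/ltW/archi_boundP; rewrite invr_ge0 ltW.
have bnd (a : nat) (x : rat) : v0 <= x -> a%:R * x <= 1 -> (a <= M)%N.
  move=> vx ax; rewrite -(ler_nat rat); apply: le_trans HM.
  rewrite -[leRHS]mul1r ler_pdivlMr//; apply: le_trans ax.
  by rewrite ler_wpM2l.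
pose val (a : {ffun 'I_n -> 'I_M.+1}) : rat :=
  (1 - \sum_(j < n | (j < k)%N) (a j)%:R * mu j) / (a k)%:R.
have rep v : V v -> v0 <= v -> exists a, val a = v.
  move=> Vv vv0; have [_ [v0'|[a [ak mun E]]]] := HV v Vv.
    by move: v00; rewrite ltNge -v0' vv0.
  have vpos : 0 < v := lt_le_trans v00 vv0.
  have muk (j : 'I_n) : (j < k)%N -> 0 <= (a j)%:R * mu j.
    by move=> jk; rewrite mulr_ge0// (le_trans (ltW vpos))// mun.
  have ajM (j : 'I_n) : (j <= k)%N -> (a j <= M)%N.
    rewrite leq_eqVlt => /orP[/eqP/val_inj ->|jk].
      apply: (bnd _ v) => //; rewrite mulrC E gerBl sumr_ge0// => i; exact: muk.
    apply: (bnd _ (mu j)); first exact: le_trans vv0 (mun j jk).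
    have : 0 < v * (a k)%:R by rewrite mulr_gt0 ?ltr0n.
    rewrite E subr_gt0 => /ltW; apply: le_trans.
    rewrite (bigD1 j)//= lerDl sumr_ge0// => i /andP[ik _]; exact: muk.
  exists [ffun j => inord (a j)]; rewrite /val !ffunE inordK ?ltnS ?ajM//.
  rewrite -[RHS](@mulfK _ (a k)%:R) ?pnatr_eq0 ?gtn_eqF// E; congr ((_ - _) / _).
  by apply: eq_bigr => j jk; rewrite ffunE inordK// ltnS ajM// ltnW.
have [a0 Ea0] := rep v0 Vv0 (lexx _).
pose P (a : {ffun 'I_n -> 'I_M.+1}) := `[< V (val a) >] && (v0 <= val a).
have Pa0 : P a0 by rewrite /P Ea0 lexx andbT; apply/asboolP.
case: (@arg_maxP _ _ _ a0 P val Pa0) => a /andP[/asboolP Va _] amax.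
exists (val a) => // v Vv; have [vv0|vv0] := leP v0 v.
  have [b Eb] := rep v Vv vv0; rewrite -Eb; apply: amax.
  by rewrite /P Eb vv0 andbT; apply/asboolP.
by apply: le_trans (ltW vv0) _; rewrite -Ea0; exact: amax.
Qed.

(** The lexicographic maximum is found entry by entry: among the members of B with the prescribed
    first k entries, the next one has a maximum by [weight_entry_max]. *)
Lemma weight_max B : B !=set0 -> (forall L, B L -> is_weight L) ->
  exists2 L, B L & forall L', B L' -> (L' <= L)%O.
Proof.
move=> [L0 BL0] Bw.
(* After k entries each member of B either is already smaller than the candidate or agrees with it
   so far. *)
have claim k : (k <= n)%N -> exists2 L, B L & forall L', B L' ->
    (exists i : 'I_n, [/\ (i < k)%N, forall j : 'I_n, (j < i)%N -> tnth L' j = tnth L j &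
       tnth L' i < tnth L i]) \/
    (forall i : 'I_n, (i < k)%N -> tnth L' i = tnth L i).
  elim: k => [_|k IH kn]; first by exists L0 => // L' _; right.
  have [L BL HL] := IH (ltnW kn).
  pose ko := Ordinal kn.
  pose V := [set tnth L' ko | L' in [set L' | B L' /\
     forall i : 'I_n, (i < k)%N -> tnth L' i = tnth L i]].
  have [||_ [L1 [BL1 eq1] <-] max1] := @weight_entry_max V ko (tnth L).
  - by exists (tnth L ko), L.
  - move=> _ [L' [BL' eq'] <-]; have [w1 w2 w3] := Bw _ BL'.
    have /andP[l0 _] := w1 ko; split => //.
    case: (w3 ko) => [|[a [ak sa]]]; [by left|right; exists a; split => //].
      by move=> j jk; rewrite -eq'//; apply: w2; exact: ltnW.
    have SE : \sum_(i < n | (i <= ko)%N && (i != ko)) (a i)%:R * tnth L' i =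
        \sum_(i < n | (i < k)%N) (a i)%:R * tnth L i.
      apply: eq_big => [i|i ik]; first by rewrite [RHS]ltn_neqAle andbC -(inj_eq val_inj).
      by rewrite eq'//; move: ik; rewrite -(inj_eq val_inj) /= => /andP[ik /negPf ne];
         rewrite ltn_neqAle ne.
    move: sa; rewrite (bigD1 ko)//= SE => sa.
    by rewrite mulrC; apply/eqP; rewrite eq_sym subr_eq sa.
  exists L1 => // L' BL'; case: (HL L' BL') => [[i [ik e1 e2]]|e].
    left; exists i; split; first exact: ltnW.
      by move=> j ji; rewrite e1// eq1// (ltn_trans ji).
    by rewrite eq1.
  have : tnth L' ko <= tnth L1 ko by apply: max1; exists L'.
  rewrite le_eqVlt => /orP[/eqP E|lt].
    right=> i; rewrite ltnS leq_eqVlt => /orP[/eqP ik|ik]; last by rewrite e// eq1.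
    by have -> : i = ko by exact: val_inj.
  by left; exists ko; split => //= j jk; rewrite e// eq1.
have [L BL HL] := claim n (leqnn n).
exists L => // L' BL'; case: (HL L' BL') => [[i [_ e1 e2]]|e].
  by apply/ltW/ltxi_tuplePlt; exists i.
by have -> : L' = L by apply: eq_from_tnth => i; exact: e.
Qed.

Lemma zero_weight_le L : (forall j, 0 <= tnth L j) -> (([tuple of nseq n 0] : n.-tuplelexi rat) <= L)%O.
Proof.
move=> L0; have [j0|none] := pselect (exists j : 'I_n, 0 < tnth L j).
  have [j jpos jmin] : exists2 j : 'I_n, 0 < tnth L j & forall i : 'I_n, 0 < tnth L i -> (j <= i)%N.
    case: j0 => j0 j0p; case: (@arg_minnP _ j0 (fun j => 0 < tnth L j) (fun j => j : nat) j0p).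
    by move=> j jp jm; exists j.
  apply/ltW/ltxi_tuplePlt; exists j; last by rewrite tnth_nseq.
  move=> i ij; rewrite tnth_nseq; apply/eqP; rewrite eq_le L0 /= leNgt.
  by apply/negP => /jmin; rewrite leqNgt ij.
have -> : L = [tuple of nseq n 0] :> n.-tuple rat; last exact: lexx.
apply: eq_from_tnth => j; rewrite tnth_nseq; apply/eqP.
by rewrite eq_le L0 andbT leNgt; apply/negP => h; apply: none; exists j.
Qed.

(** The weights that are lower bounds of B include the zero weight, and a nonempty set of weights
    has a maximum by [weight_max]. B may be empty. *)
Theorem exists_glb_weight B : (forall L, B L -> is_weight L) ->
  exists L, is_glb_weight B L.
Proof.
move=> Bw; pose D := [set L | is_weight L /\ lbound B L].
have [||L [wL lL] maxL] := @weight_max D.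
- exists [tuple of nseq n 0]; split.
    split=> [j|i j _|t]; rewrite ?tnth_nseq//.
    by left.
  by move=> L /Bw[L01 _ _]; apply: zero_weight_le => j; have /andP[] := L01 j.
- by move=> L [].
by exists L; split => // L' wL' lL'; apply: maxL; split.
Qed.

End GreatestLowerBound.

(** * Weighted Taylor polynomials *)


Section Polynomials.
Variables (R : realType) (n : nat).
Local Notation C := (R[i])^o.
Local Notation zu := (zu_space R n).
Local Notation var := (zu_variable n).
Local Notation poly := (zzbar_poly R n).
Implicit Types (a b : var) (s : seq var) (P Q : poly) (p v : zu).

Lemma constant_derivative_smooth (U : set zu) (k : zu -> R^o) : open U ->
  (forall p, differentiable k p) -> (forall v, exists c, forall p, 'D_v k p = c) ->
  smooth_on U k.
Proof.
move=> oU dk Dk.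
apply: (smooth_coinduction oU (F := fun k' => k' = k \/ exists c, k' = cst c)).
- by move=> _ [->|[c ->]] p Up; [exact: dk|exact: differentiable_cst].
- move=> _ [->|[c ->]] v.
    by have [c Dc] := Dk v; exists (cst c) => [|p _]; [right; exists c|exact: Dc].
  by exists (cst 0) => [|p _]; [right; exists 0|exact: derive_cst].
- by left.
Qed.

Definition zrow p : Cspace R n := \row_j (p.1.1 0 j +i* p.1.2 0 j).

Definition var_of (i : 'I_(n + n)) : var :=
  match fintype.split i with inl j => Var_z j | inr j => Var_zbar j end.

Definition zzbar_coord (i : 'I_(n + n)) p : R[i] :=
  match fintype.split i with inl j => zrow p 0 j | inr j => Num.conj (zrow p 0 j) end.

Definition evalp P p : R[i] := eval_zzbar P (zrow p).

Lemma evalpE P p : evalp P p = meval (zzbar_coord^~ p) P.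
Proof. by []. Qed.

Lemma csmooth_zrow j : csmooth setT (fun p => zrow p 0 j).
Proof.
split; under eq_fun do rewrite mxE /=; apply: constant_derivative_smooth => [|p|v];
  try exact: openT; try exact: (zu_coord_x j p).1; try exact: (zu_coord_y j p).1.
  by exists (v.1.1 0 j) => p; exact: (zu_coord_x j p).2.
by exists (v.1.2 0 j) => p; exact: (zu_coord_y j p).2.
Qed.

Lemma wirtinger_zrow a j p : wirtinger a (fun q => zrow q 0 j) p = (a == Var_z j)%:R.
Proof.
have D v : real_derivative v (fun q => zrow q 0 j) p = v.1.1 0 j +i* v.1.2 0 j.
  rewrite /real_derivative; congr (_ +i* _).
    by under eq_fun do rewrite mxE /=; exact: (zu_coord_x j p).2.
  by under eq_fun do rewrite mxE /=; exact: (zu_coord_y j p).2.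
have cE (x : bool) : x%:R +i* 0 = x%:R :> R[i] by rewrite -[RHS](rmorph_nat (real_complex R)).
have ciE (x : bool) : 0 +i* x%:R = 'i%C * x%:R :> R[i].
  rewrite -(rmorph_nat (real_complex R)); apply/eqP; rewrite eq_complex /=.
  by apply/andP; split; apply/eqP; ring.
have alg (y c : R[i]) : c * 'i%C * ('i%C * y) = - (c * y).
  have -> : c * 'i%C * ('i%C * y) = c * ('i%C * 'i%C) * y by ring.
  by rewrite -expr2 sqr_i; ring.
have half (x : R[i]) : 2^-1 * x + 2^-1 * x = x.
  by rewrite -mulrDl [2^-1 + _](_ : _ = 1) ?mul1r// [RHS]splitr div1r.
rewrite wirtingerE !D; case: a => [i|i|] /=; rewrite ?mxE ?eqxx /=.
- rewrite cE ciE mulNr alg opprK half.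
  have -> : (Var_z i == Var_z j) = (i == j).
    by apply/eqP/eqP => [[]|->].
  by rewrite eq_sym.
- by rewrite cE ciE alg subrr.
- by rewrite mulr0 mul0r addr0.
Qed.

Lemma csmooth_coord i : csmooth setT (zzbar_coord i).
Proof.
rewrite /zzbar_coord; case: (fintype.split i) => j; first exact: csmooth_zrow.
exact: (csmooth_conj openT (csmooth_zrow j)).
Qed.

Lemma wirtinger_coord a i p : wirtinger a (zzbar_coord i) p = (a == var_of i)%:R.
Proof.
rewrite /zzbar_coord /var_of; case: (fintype.split i) => j.
  exact: wirtinger_zrow.
rewrite (wirtinger_conj (I : [set: zu] p) a (csmooth_zrow j)) wirtinger_zrow.
have -> : (a == Var_zbar j) = (var_bar a == Var_z j).
  by apply/eqP/eqP => [->//|E]; rewrite -[a]var_barK E.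
exact: rmorph_nat.
Qed.

Lemma var_of_inj : injective var_of.
Proof.
move=> i j E; apply: (can_inj (@splitK n n)); move: E; rewrite /var_of.
by case: (fintype.split i) => k; case: (fintype.split j) => l // [->].
Qed.

Definition mder a P : poly := match a with
  | Var_z j => mderiv (lshift n j) P
  | Var_zbar j => mderiv (rshift n j) P
  | Var_u => 0
  end.

Lemma mder_var_of i P : mder (var_of i) P = mderiv i P.
Proof. by rewrite -{2}(splitK i) /var_of; case: (fintype.split i). Qed.

Lemma mder_linear a : [/\ mder a 0 = 0, forall P Q, mder a (P + Q) = mder a P + mder a Q,
  forall c, mder a (mpolyC _ c) = 0, forall P Q, mder a (P * Q) = mder a P * Q + P * mder a Q &
  forall i, mder a (mpolyX _ (mnm1 i)) = mpolyC _ (a == var_of i)%:R].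
Proof.
have [[i ->]|->] : (exists i, a = var_of i) \/ a = @Var_u n.
- case: a => [j|j|]; [left|left|by right].
    by exists (lshift n j); rewrite /var_of (unsplitK (inl _ j)).
  by exists (rshift n j); rewrite /var_of (unsplitK (inr _ j)).
- split=> [|P Q|c|P Q|j]; rewrite !mder_var_of.
  + exact: mderiv0.
  + exact: mderivD.
  + exact: mderivC.
  + exact: mderivM.
  + rewrite mderivX mnm1E (inj_eq var_of_inj) eq_sym; case: eqP => [->|_].
      rewrite (_ : mnm_sub _ _ = mnm0) ?mpolyX0 ?scale1r ?mpolyC1//.
      by apply/mnmP => k; rewrite mnmBE mnm0E subnn.
    by rewrite scale0r mpolyC0.
- split=> [|P Q|c|P Q|j] //=.
  + by rewrite addr0.
  + by rewrite mul0r mulr0 addr0.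
  + by rewrite -mpolyC0; congr mpolyC; case: eqP => //; rewrite /var_of; case: (fintype.split j).
Qed.

(** The property holds for constants and coordinates and passes to sums and products, which generate
    all polynomials. *)
Lemma poly_calculus P : csmooth setT (evalp P) /\
  forall a p, wirtinger a (evalp P) p = evalp (mder a P) p.
Proof.
pose T P := csmooth setT (evalp P) /\
  forall a p, wirtinger a (evalp P) p = evalp (mder a P) p.
have Tc c : T (mpolyC _ c).
  have E : evalp (mpolyC _ c) = (fun=> c) by apply/funext => p; rewrite evalpE mevalC.
  split=> [|a p]; rewrite E; first exact: (csmooth_cst openT c).
  have [_ _ -> _ _] := mder_linear a; rewrite evalpE meval0.
  exact: (wirtinger_cst p a c).
have TD P1 P2 : T P1 -> T P2 -> T (P1 + P2).
  move=> [s1 w1] [s2 w2].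
  have E : evalp (P1 + P2) = (fun p => evalp P1 p + evalp P2 p).
    by apply/funext => p; rewrite !evalpE mevalD.
  split=> [|a p]; rewrite E; first exact: (csmoothD openT s1 s2).
  have [_ -> _ _ _] := mder_linear a.
  rewrite (wirtingerD (I : [set: zu] p) a s1 s2) w1 w2.
  by rewrite !evalpE mevalD.
have TM P1 P2 : T P1 -> T P2 -> T (P1 * P2).
  move=> [s1 w1] [s2 w2].
  have E : evalp (P1 * P2) = (fun p => evalp P1 p * evalp P2 p).
    by apply/funext => p; rewrite !evalpE mevalM.
  split=> [|a p]; rewrite E; first exact: (csmoothM openT s1 s2).
  have [_ _ _ -> _] := mder_linear a.
  rewrite (wirtingerM (I : [set: zu] p) a s1 s2) w1 w2.
  by rewrite !evalpE mevalD !mevalM.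
have TX i : T (mpolyX _ (mnm1 i)).
  have E : evalp (mpolyX _ (mnm1 i)) = zzbar_coord i.
    by apply/funext => p; rewrite evalpE mevalXU.
  split=> [|a p]; rewrite E; first exact: csmooth_coord.
  have [_ _ _ _ ->] := mder_linear a.
  by rewrite wirtinger_coord evalpE mevalC.
rewrite -[csmooth _ _ /\ _]/(T P) [P]mpolyE.
elim/big_ind: _ => [|//|m _]; first by rewrite -mpolyC0; exact: Tc.
rewrite -mul_mpolyC; apply: (TM) => //; rewrite mpolyXE_id.
elim/big_ind: _ => [|//|i _]; first by rewrite -mpolyC1; exact: Tc.
by elim: (m i) => [|k IH]; [rewrite expr0 -mpolyC1; exact: Tc|rewrite exprS; exact: TM].
Qed.

Lemma csmooth_evalp P : csmooth setT (evalp P).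
Proof. by have [] := poly_calculus P. Qed.

Lemma wword_evalp s P p : wword s (evalp P) p = evalp (foldr mder P s) p.
Proof. by elim: s p => //= a s IH p; rewrite -(poly_calculus _).2; apply: (wirtinger_eq openT I) => q _. Qed.


Local Notation mnm := (multinom (n + n)).
Implicit Types (t : seq 'I_(n + n)) (m : mnm).

Definition mnm_of t : mnm := foldr (fun i m => mnm_add (mnm1 i) m) mnm0 t.

Definition word_of m : seq 'I_(n + n) := flatten [seq nseq (m i) i | i <- enum 'I_(n + n)].

Lemma mnm_of_count t i : mnm_of t i = count_mem i t.
Proof. by elim: t => [|j t IH]; rewrite /= ?mnm0E// mnmDE mnm1E IH. Qed.

Lemma count_word_of m i : count_mem i (word_of m) = m i.
Proof.
rewrite count_flatten -map_comp sumnE big_map big_enum /= (bigD1 i)//= count_nseq /= eqxx mul1n.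
by rewrite big1 ?addn0// => j ji; rewrite count_nseq /= (negPf ji).
Qed.

Lemma mnm_of_word_of m : mnm_of (word_of m) = m.
Proof. by apply/mnmP => i; rewrite mnm_of_count count_word_of. Qed.

Lemma word_of_mnm_of t : perm_eq (word_of (mnm_of t)) t.
Proof. by apply/allP => i _ /=; rewrite count_word_of mnm_of_count. Qed.

(** If beta is the multi-index of t, this is (m + beta)! / m!, the factor that d^beta produces on
    the monomial of exponent m + beta. *)
Fixpoint derivation_factor t m : nat :=
  if t is i :: t' then ((m i).+1 * derivation_factor t' (mnm_add m (mnm1 i)))%N else 1%N.

Lemma derivation_factor_gt0 t m : (0 < derivation_factor t m)%N.
Proof. by elim: t m => //= i t IH m; rewrite muln_gt0 IH. Qed.

Lemma mcoeff_derivations t m P : mcoeff m (foldr mder P (map var_of t)) =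
  mcoeff (mnm_add m (mnm_of t)) P *+ derivation_factor t m.
Proof.
elim: t m => [|i t IH] m /=; first by rewrite addm0.
by rewrite mder_var_of mcoeff_mderiv IH -mulrnA mulnC addmA.
Qed.

Lemma zzbar_coord0 i : zzbar_coord i 0 = 0.
Proof.
have z0 j : zrow (0 : zu) 0 j = 0 by rewrite !mxE.
by rewrite /zzbar_coord; case: (fintype.split i) => j; rewrite z0// conjC0.
Qed.

Lemma evalp0 P : evalp P 0 = mcoeff mnm0 P.
Proof.
rewrite evalpE mevalE.
have E m : \prod_(i < n + n) zzbar_coord i 0 ^+ m i = (m == mnm0)%:R.
  case: eqP => [->|/eqP m0]; first by rewrite big1// => i _; rewrite mnm0E.
  have [i mi] : exists i, m i != 0%N.
    apply: contrapT => H; move/eqP: m0; apply; apply/mnmP => i; rewrite mnm0E.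
    by apply/eqP; apply: contrapT => /negP mi; apply: H; exists i.
  by rewrite (bigD1 i)//= zzbar_coord0 expr0n (negPf mi) mul0r.
rewrite [in RHS](mpolyE P) raddf_sum /=; apply: eq_bigr => m _.
by rewrite E mcoeffZ mcoeffX.
Qed.

Lemma wword_evalp_mnm_of t P : wword (map var_of t) (evalp P) 0 =
  mcoeff (mnm_of t) P *+ derivation_factor t mnm0.
Proof. by rewrite wword_evalp evalp0 mcoeff_derivations add0m. Qed.

Lemma wword_evalp_u s P p : @Var_u n \in s -> wword s (evalp P) p = 0.
Proof.
rewrite wword_evalp => us; suff -> : foldr mder P s = 0 by rewrite evalpE meval0.
elim: s us => //= a s IH; rewrite inE => /orP[/eqP <-//|/IH ->].
by have [] := mder_linear a.
Qed.

Lemma word_without_u s : @Var_u n \notin s -> exists t, s = map var_of t.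
Proof.
elim: s => [|a s IH]; first by exists [::].
rewrite inE negb_or => /andP[au /IH[t ->]].
case: a au => [j|j|] // _.
  by exists (lshift n j :: t); rewrite /= {2}/var_of (unsplitK (inl _ j)).
by exists (rshift n j :: t); rewrite /= {2}/var_of (unsplitK (inr _ j)).
Qed.

Variable L : n.-tuplelexi rat.

Definition mnm_weight m : rat := \sum_(j < n) (exp_z m j + exp_zbar m j)%:R * tnth L j.

Lemma mnm_weightE m : mnm_weight m = \sum_i (m i)%:R * weight_of_variable L (var_of i).
Proof.
rewrite big_split_ord /= -big_split /=; apply: eq_bigr => j _.
rewrite /var_of (unsplitK (inl _ j)) (unsplitK (inr _ j)) /=.
by rewrite natrD mulrDl.
Qed.

Lemma wt_mnm_of t : wt L (map var_of t) = mnm_weight (mnm_of t).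
Proof.
rewrite mnm_weightE; elim: t => [|i t IH].
  by rewrite wt_nil big1// => i _; rewrite mnm0E mul0r.
rewrite /wt /= big_cons -/(wt L _) IH (bigD1 i)//= [in RHS](bigD1 i)//=.
rewrite mnmDE mnm1E eqxx natrD mulrDl mul1r addrA; congr (_ + _).
by apply: eq_bigr => j ji; rewrite mnmDE mnm1E eq_sym (negPf ji).
Qed.

Lemma all_is_z_mnm_of t :
  all (@is_z n) (map var_of t) = [forall j, exp_zbar (mnm_of t) j == 0%N].
Proof.
apply/idP/forallP => [/allP az j|H].
  rewrite /exp_zbar mnm_of_count -leqn0 leqNgt -has_count has_pred1.
  apply/negP => jt; have /az : var_of (rshift n j) \in map var_of t by exact: map_f.
  by rewrite /var_of (unsplitK (inr _ j)).
apply/allP => _ /mapP[i it ->]; rewrite /var_of -{1}(splitK i) in it *.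
case: (fintype.split i) it => //= j jt; have := H j.
by rewrite /exp_zbar mnm_of_count -leqn0 leqNgt -has_count has_pred1 jt.
Qed.

Lemma all_is_zbar_mnm_of t :
  all (@is_zbar n) (map var_of t) = [forall j, exp_z (mnm_of t) j == 0%N].
Proof.
apply/idP/forallP => [/allP az j|H].
  rewrite /exp_z mnm_of_count -leqn0 leqNgt -has_count has_pred1.
  apply/negP => jt; have /az : var_of (lshift n j) \in map var_of t by exact: map_f.
  by rewrite /var_of (unsplitK (inl _ j)).
apply/allP => _ /mapP[i it ->]; rewrite /var_of -{1}(splitK i) in it *.
case: (fintype.split i) it => //= j jt; have := H j.
by rewrite /exp_z mnm_of_count -leqn0 leqNgt -has_count has_pred1 jt.
Qed.

(** The derivative of P at 0 is a multiple of one coefficient. For a good word the monomial has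
    weight below 1 or is pure, so it does not occur in P; and P does not involve u. *)
Lemma normal_form_jets P s : weighted_homogeneous L 1 P -> no_pluriharmonic_terms P ->
  good L s || (@Var_u n \in s) -> (forall j, 0 <= tnth L j) -> wword s (evalp P) 0 = 0.
Proof.
move=> wP pP gs L0; have [us|nus] := boolP (@Var_u n \in s); first exact: wword_evalp_u.
move: gs; rewrite (negPf nus) orbF.
have [t ->] := word_without_u nus; rewrite wword_evalp_mnm_of /good wt_mnm_of.
rewrite all_is_z_mnm_of all_is_zbar_mnm_of.
have [|nm] := boolP (mnm_of t \in msupp P); last by move/memN_msupp_eq0: nm => ->; rewrite mul0rn.
move=> mP; have := wP _ mP; rewrite -/(mnm_weight _) => ->; rewrite ltxx /=.
have [[i i0] [j j0]] := pP _ mP.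
by move=> /orP[] /forallP; [move=> /(_ j)|move=> /(_ i)]; rewrite ?(negPf i0) ?(negPf j0).
Qed.

End Polynomials.

Section WeightedTaylor.
Variables (R : realType) (n : nat) (L : n.-tuplelexi rat).
Local Notation zu := (zu_space R n).
Local Notation var := (zu_variable n).
Local Notation poly := (zzbar_poly R n).
Local Notation mnm := (multinom (n + n)).
Implicit Types (s : seq var) (t : seq 'I_(n + n)) (m : mnm) (P : poly).

Lemma conj_poly P : exists Q : poly, forall z, eval_zzbar Q z = Num.conj (eval_zzbar P z).
Proof.
pose bar (i : 'I_(n + n)) : 'I_(n + n) :=
  match fintype.split i with inl j => rshift n j | inr j => lshift n j end.
pose X i : poly := mpolyX _ (mnm1 (bar i)).
pose c m : R[i] := Num.conj (mcoeff m P).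
pose Y m : poly := \prod_i X i ^+ m i.
exists (\sum_(m <- msupp P) c m *: Y m).
move=> z; pose v i : R[i] :=
  match fintype.split i with inl j => z 0 j | inr j => Num.conj (z 0 j) end.
rewrite -[eval_zzbar _ _]/(meval v _) -[eval_zzbar P _]/(meval v P).
rewrite [in RHS]mevalE (raddf_sum (meval v)) (rmorph_sum Num.conj) /=.
apply: eq_bigr => m _; rewrite mevalZ rmorphM !rmorph_prod /=; congr (_ * _).
apply: eq_bigr => i _; rewrite !rmorphXn /=; congr (_ ^+ _).
rewrite mevalXU /v /bar; case: (fintype.split i) => j.
  by rewrite (unsplitK (inr _ j)).
by rewrite (unsplitK (inl _ j)) conjCK.
Qed.

Hypothesis Lpos : forall j, 0 < tnth L j.

(** With positive weights w_i, the degree of a monomial is at most its weight times the sum of the 1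
    / w_i. Hence the part of weight 1 of a Taylor expansion is a polynomial. *)
Lemma mdeg_bounded : exists b : nat, forall m, mnm_weight L m = 1 -> (mdeg m < b)%N.
Proof.
pose w i := weight_of_variable L (var_of i) : rat.
have wpos i : 0 < w i by rewrite /w /var_of; case: (fintype.split i) => j; exact: Lpos.
pose M := \sum_i (w i)^-1.
have wM i : 1 <= w i * M.
  rewrite /M (bigD1 i)//= mulrDr mulfV ?gt_eqF// lerDl mulr_ge0 ?(ltW (wpos i))//.
  by apply: sumr_ge0 => j _; rewrite invr_ge0 ltW.
exists (Num.bound M) => m; rewrite mnm_weightE => m1.
have M0 : 0 <= M by apply: sumr_ge0 => j _; rewrite invr_ge0 ltW.
rewrite -(ltr_nat rat); apply: le_lt_trans (archi_boundP M0).
have -> : M = (\sum_i (m i)%:R * w i) * M by rewrite m1 mul1r.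
rewrite mulr_suml mdegE natr_sum; apply: ler_sum => i _.
by rewrite -mulrA ler_peMr.
Qed.

Variables (K : zu -> R^o) (U : set zu).
Hypothesis oU : open U.
Hypothesis sK : smooth_on U K.
Hypothesis U0 : U 0.
Local Notation Kc := (fun p : zu => (K p)%:C).

Let coefficient m : R[i] := if mnm_weight L m == 1 then
  wword (map (@var_of n) (word_of m)) Kc 0 / (derivation_factor (word_of m) mnm0)%:R else 0.

Lemma weighted_taylor_polynomial : exists P, forall t,
  wword (map (@var_of n) t) (evalp P) 0 =
  if wt L (map (@var_of n) t) == 1 then wword (map (@var_of n) t) Kc 0 else 0.
Proof.
have [b Hb] := mdeg_bounded.
exists (\sum_(m : bmultinom (n + n) b) coefficient m *: mpolyX _ m) => t.
have tw : perm_eq (map (@var_of n) t) (map (@var_of n) (word_of (mnm_of t))).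
  by rewrite perm_sym; apply: perm_map; exact: word_of_mnm_of.
rewrite (wword_perm openT (csmooth_evalp _) (I : [set: zu] 0) tw).
rewrite wword_evalp_mnm_of mnm_of_word_of wt_mnm_of.
case: eqP => m1; last first.
  rewrite (raddf_sum (mcoeff (mnm_of t))) big1 ?mul0rn// => m _.
  rewrite /= mcoeffZ mcoeffX; have [->|_] := eqVneq (bmnm m) (mnm_of t).
    by rewrite /coefficient ifN ?mul0r//; exact/eqP.
  by rewrite mulr0.
rewrite mcoeff_mpoly ?Hb// /coefficient m1 eqxx (wword_perm oU (csmooth_real oU sK) U0 tw).
by rewrite -[_ *+ _]mulr_natr mulfVK// pnatr_eq0 -lt0n derivation_factor_gt0.
Qed.

Hypothesis kill : forall s, good L s -> wword s Kc 0 = 0.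
Hypothesis kill_u : wword [:: @Var_u n] Kc 0 = 0.

(** The Taylor polynomial of weight 1 is averaged with its conjugate to be real, which does not
    change its jets at 0 because K is real. It has no pluriharmonic terms because pure words of
    weight at most 1 are good. *)
Lemma weighted_taylor : exists P : poly, [/\ weighted_homogeneous L 1 P,
  no_pluriharmonic_terms P, forall z, eval_zzbar P z \is Num.real &
  forall s, wt L s <= 1 -> wword s (evalp P) 0 = wword s Kc 0].
Proof.
have L0 j : 0 <= tnth L j by rewrite ltW.
have [P1 HP1] := weighted_taylor_polynomial; have [P2 HP2] := conj_poly P1.
have half (x : R[i]) : 2^-1 * (x + x) = x.
  by rewrite mulrDr -mulrDl [2^-1 + _](_ : _ = 1) ?mul1r// [RHS]splitr div1r.
pose P := 2^-1 *: (P1 + P2).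
have evP z : eval_zzbar P z = 2^-1 * (eval_zzbar P1 z + Num.conj (eval_zzbar P1 z)).
  by rewrite -HP2 /eval_zzbar mevalZ mevalD.
have jets t : wword (map (@var_of n) t) (evalp P) 0 =
    if wt L (map (@var_of n) t) == 1 then wword (map (@var_of n) t) Kc 0 else 0.
  set s := map _ t.
  have sP := csmooth_evalp P1; have cP := csmooth_conj openT sP.
  have E (p : zu) : setT p -> evalp P p = 2^-1 * (evalp P1 p + (evalp P1 p)^*%C).
    by move=> _; exact: evP.
  rewrite (wword_eq openT s E (I : [set: zu] 0)).
  rewrite (wwordZ openT s (2^-1) (csmoothD openT sP cP) (I : [set: zu] 0)).
  rewrite (wwordD openT s sP cP (I : [set: zu] 0)).
  rewrite (wword_conj openT s sP (I : [set: zu] 0)).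
  have [t' st'] : exists t', map (@var_bar n) s = map (@var_of n) t'.
    apply: word_without_u; apply/negP => /mapP[a /mapP[i _ ->]].
    by rewrite /var_of; case: (fintype.split i).
  rewrite HP1 st' HP1 -st' wt_bar -/s; case: eqP => _; last by rewrite conjc0 addr0 mulr0.
  by rewrite (wword_bar_real oU sK U0) conjcK half.
have coef m : m \in msupp P -> wt L (map (@var_of n) (word_of m)) = 1 /\
    wword (map (@var_of n) (word_of m)) Kc 0 != 0.
  rewrite mcoeff_msupp => Pm; have := jets (word_of m).
  rewrite wword_evalp_mnm_of mnm_of_word_of; case: eqP => [w1|_] E.
    by split => //; rewrite -E mulrn_eq0 negb_or Pm andbT -lt0n derivation_factor_gt0.
  by move/eqP: E; rewrite mulrn_eq0 (negPf Pm) orbF -leqn0 leqNgt derivation_factor_gt0.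
exists P; split.
- by move=> m /coef[w1 _]; rewrite -[LHS]/(mnm_weight L m) -{1}(mnm_of_word_of m) -wt_mnm_of.
- move=> m /coef[w1 n0].
  have ng : ~~ good L (map (@var_of n) (word_of m)).
    by apply: contra n0 => /kill ->.
  move: ng; rewrite /good w1 ltxx lexx /= negb_or all_is_z_mnm_of all_is_zbar_mnm_of.
  rewrite mnm_of_word_of => /andP[/existsP h1 /existsP h2].
  by split.
- move=> z; rewrite CrealE evP; apply/eqP.
  have hc (x y : R[i]) : Num.conj (x * y) = Num.conj x * Num.conj y by exact: rmorphM.
  have hd (x y : R[i]) : Num.conj (x + y) = Num.conj x + Num.conj y by exact: rmorphD.
  have hn : Num.conj (2^-1 : R[i]) = 2^-1 by rewrite fmorphV rmorph_nat.
  by rewrite [LHS]hc hn; congr (_ * _); rewrite [LHS]hd [in LHS](conjCK (eval_zzbar P1 z)) [LHS]addrC.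
- move=> s ws; have [us|nus] := boolP (@Var_u n \in s).
    rewrite wword_evalp_u//; suff -> : s = [:: @Var_u n] by rewrite kill_u.
    (* The letter u has weight 1 and the other letters have positive weight, so u is the whole
       word. *)
    case/splitPr: us ws => s1 s2 ws.
    have s12 : perm_eq (s1 ++ Var_u n :: s2) (Var_u n :: (s1 ++ s2)).
      by rewrite -cat1s perm_catCA.
    move: ws; rewrite /wt (perm_big _ s12) big_cons /= gerDl.
    case: (s1 ++ s2) (perm_size s12) => [|a r] ss.
      by case: s1 s2 {s12} ss => [|c s1] [|d s2] //=; rewrite ?size_cat ?addnS.
    rewrite big_cons leNgt ltr_pwDl//; first by case: a {ss} => [j|j|] /=.
    exact: wt_ge0.
  have [t E] := word_without_u nus; rewrite E jets -E; case: eqP => // w1.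
  by rewrite kill// /good lt_neqAle ws andbT; apply/orP; left; apply/eqP.
Qed.

End WeightedTaylor.

(** * Distinguished weights and coordinate charts *)


Section Charts.
Variables (R : realType) (n : nat).
Local Notation C := (R[i])^o.
Local Notation Cn := (Cspace R n.+1).
Implicit Types (Phi Psi : Cn -> Cn) (H : Cn -> C).

Definition inverse_charts Phi Psi : Prop :=
  [/\ holomorphic0 Phi /\ Phi 0 = 0, holomorphic0 Psi /\ Psi 0 = 0,
     \forall p \near (0 : Cn), Psi (Phi p) = p &
     \forall q \near (0 : Cn), Phi (Psi q) = q].

Lemma near_fixed (V W : normedModType R[i]) (f : V -> W) (P : W -> Prop) :
  differentiable f 0 -> f 0 = 0 -> (\forall y \near (0 : W), P y) -> \forall x \near (0 : V), P (f x).
Proof. by move=> df f0 HP; apply: (differentiable_continuous df); rewrite f0. Qed.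

Lemma diff_local_id (V W : normedModType R[i]) (f : V -> W) (g : W -> V) v :
  differentiable f 0 -> f 0 = 0 -> differentiable g 0 ->
  (\forall x \near (0 : V), g (f x) = x) -> 'd g 0 ('d f 0 v) = v.
Proof.
move=> df f0 dg E; have dgf : differentiable g (f 0) by rewrite f0.
have := congr1 (fun F => F v) (diff_comp df dgf); rewrite /= f0 => <-.
have dc : differentiable (g \o f) 0 by exact: differentiable_comp.
apply: (etrans (esym (deriveE v dc))).
apply: (etrans (@near_eq_derive _ _ _ (g \o f) id 0 v E)).
exact: derive_id.
Qed.


Lemma diff_coordinate m (x v : Cspace R m) j :
  differentiable (fun p : Cspace R m => p 0 j : C) x /\
  'd (fun p : Cspace R m => p 0 j : C) x v = v 0 j.
Proof.
pose k (p : Cspace R m) : C := p 0 j.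
have kl : linear k by move=> a p q; rewrite /k !mxE.
pose aM := GRing.isLinear.Build R[i] (Cspace R m) C *:%R k kl.
pose A : {linear (Cspace R m) -> C} := HB.pack k aM.
have cA : continuous A by move=> p; exact: coord_continuous.
split; first exact: (linear_differentiable (f := A) x cA).
exact: (congr1 (fun F : Cspace R m -> C => F v) (@diff_lin _ _ _ A x cA)).
Qed.

Definition chart_Z Psi : Cn -> C := fun z => 2 * Psi z 0 ord_max.
Definition chart_F N (f : 'I_N -> Cn -> C) Psi (j : 'I_N) : Cn -> C := fun z => f j (Psi z).

Lemma diff_chart_Z Psi x v : differentiable Psi x ->
  differentiable (chart_Z Psi) x /\ 'd (chart_Z Psi) x v = 2 * 'd Psi x v 0 ord_max.
Proof.
move=> dP; pose c : Cn -> C := fun p => p 0 ord_max.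
have [dc cE] := diff_coordinate (Psi x) ('d Psi x v) ord_max.
have dcP : differentiable (c \o Psi) x := differentiable_comp dP dc.
have [dZ ZE] := diffZ_at 2 v dcP; split; first exact: dZ.
apply: (etrans ZE); congr (2 * _).
exact: (etrans (congr1 (fun F => F v) (diff_comp dP dc))).
Qed.

Lemma near_open (T : topologicalType) (x : T) (P : T -> Prop) : (\forall z \near x, P z) ->
  exists U, [/\ open U, U x & forall z, U z -> P z].
Proof.
by rewrite -[X in X -> _]/(nbhs x P) nbhsE => -[U [oU U0] UP]; exists U; split.
Qed.

Lemma chart_neighborhood N (f : 'I_N -> Cn -> C) Psi (W : Cn -> Prop) :
  holomorphic0 Psi -> Psi 0 = 0 -> (forall j, holomorphic0 (f j)) ->
  (\forall z \near (0 : Cn), W z) ->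
  exists Om, [/\ open Om, Om 0, hol_on Om (chart_Z Psi),
    forall j, hol_on Om (chart_F f Psi j) & forall z, Om z -> W z].
Proof.
move=> hP P0 hf HW; have dP0 : differentiable Psi 0 := nbhs_singleton hP.
have [|Om [oO O0 HO]] := @near_open Cn 0 (fun z => [/\ differentiable Psi z,
    forall j, differentiable (f j) (Psi z) & W z]).
  have H1 : \forall z \near (0 : Cn), forall j, differentiable (f j) (Psi z).
    have X j : \forall z \near (0 : Cn), differentiable (f j) (Psi z) := near_fixed dP0 P0 (hf j).
    pose D (j : 'I_N) (z : Cn) : Prop := differentiable (f j) (Psi z).
    exact: (@filter_forall _ _ D (nbhs (0 : Cn)) _ X).
  apply: filterS (filterI hP (filterI H1 HW)) => z [h1 [h2 h3]].
  by split; [exact: h1|exact: h2|exact: h3].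
exists Om; split.
- exact: oO.
- exact: O0.
- move=> z /HO[dz _ _]; exact: (diff_chart_Z 0 dz).1.
- move=> j z /HO[dz fz _]; exact: (differentiable_comp dz (fz j)).
- move=> z /HO[_ _ Wz]; exact: Wz.
Qed.

(** Otherwise the differential of Z at 0 would be zero, whereas Z is twice a coordinate composed
    with a local biholomorphism. *)
Lemma normal_derivative_neq0 Phi Psi : inverse_charts Phi Psi ->
  (forall j : 'I_n, 'd (chart_Z Psi) 0 (delta_mx 0 (lift ord_max j)) = 0) ->
  'd (chart_Z Psi) 0 (ew R n) != 0.
Proof.
move=> [[hPhi Phi0] [hPsi Psi0] PsiPhi _] dZ0; apply/eqP => dZw.
have dPhi : differentiable Phi 0 := nbhs_singleton hPhi.
have dPsi : differentiable Psi 0 := nbhs_singleton hPsi.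
have Z0 v : 'd (chart_Z Psi) 0 v = 0.
  rewrite [v]row_sum_delta linear_sum big1// => j _.
  have key : 'd (chart_Z Psi) 0 (delta_mx 0 j) = 0.
    by case: (unliftP ord_max j) => [i ->|->].
  apply: (etrans (linearZ _ _)); apply: (etrans (congr1 _ key)); exact: scaler0.
have := (diff_chart_Z ('d Phi 0 (ew R n)) dPsi).2.
rewrite Z0 (diff_local_id _ dPhi Phi0 dPsi PsiPhi) /ew mxE !eqxx mulr1.
by move/esym/eqP; rewrite pnatr_eq0.
Qed.

End Charts.

Section NormalForm.
Variables (R : realType) (n : nat).
Local Notation C := (R[i])^o.
Local Notation Cn := (Cspace R n.+1).
Local Notation zu := (zu_space R n).
Local Notation var := (zu_variable n).
Local Notation normc := Normc.normc.
Implicit Types (Phi Psi : Cn -> Cn) (H : Cn -> C) (L : n.-tuplelexi rat) (s t : seq var).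

(* The conditions on jets that make L distinguished, without reference to P. *)
Definition adapted N (f : 'I_N -> Cn -> C) Psi L : Prop :=
  [/\ forall j s, all (@is_z n) s -> wt L s + wt L s < 1 ->
        hword s (chart_F f Psi j) 0 = 0 :> R[i],
      forall s, all (@is_z n) s -> wt L s <= 1 -> hword s (chart_Z Psi) 0 = 0 :> R[i] &
      exists2 lam : R, lam != 0 & 'd (chart_Z Psi) 0 (ew R n) = 0 +i* lam].

Lemma lift_pt_near (K : zu -> R^o) (Om : set Cn) : differentiable K 0 -> K 0 = 0 ->
  open Om -> Om 0 -> \forall p \near (0 : zu), Om (lift_pt K p).
Proof.
move=> dK K0 oO O0; have /nbhs_cnormP[r r0 Hr] := open_nbhs_nbhs (conj oO O0).
have n0 : 0 < n.+1%:R * 2 :> R by rewrite mulr_gt0.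
pose e := r / (n.+1%:R * 2); have e0 : 0 < e by rewrite divr_gt0.
have N1 : \forall p \near (0 : zu), `|p| < e.
  by apply/nbhs_ballP; exists e => // p; rewrite -ball_normE/= sub0r normrN.
have N2 : \forall p \near (0 : zu), `|K p| < e.
  have /cvgrPdist_lt/(_ _ e0) := differentiable_continuous dK; rewrite K0.
  by apply: filterS => p; rewrite sub0r normrN.
apply: filterS2 N1 N2 => p p1 p2; rewrite -[lift_pt K p]/(lift2 (p, K p)); apply: Hr.
rewrite subr0; apply: le_lt_trans (lift2_norm _) _.
rewrite mulrA mulrC -ltr_pdivlMr// -/e prod_normE /= gt_max.
by apply/andP.
Qed.

Lemma Re_evalp (P : zzbar_poly R n) p : (forall z, eval_zzbar P z \is Num.real) ->
  (complex.Re (evalp P p))%:C = evalp P p.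
Proof. by move=> rP; apply: RRe_real; exact: rP. Qed.

Lemma smooth_Re_evalp (P : zzbar_poly R n) (U : set zu) : smooth_on U (fun p => complex.Re (evalp P p) : R^o).
Proof. exact: smooth_on_sub (@subsetT _ _) (csmooth_evalp P).1. Qed.

Lemma hypersurface_charts N (f : 'I_N -> Cn -> C) Psi z : hypersurface f (Psi z) <->
  complex.Re (chart_Z Psi z) + \sum_(j < N) normc (chart_F f Psi j z) ^+ 2 = 0.
Proof.
rewrite /hypersurface /defining_function /= /chart_Z.
have -> // : complex.Re (2 * Psi z 0 ord_max) = 2 * complex.Re (Psi z 0 ord_max).
by case: (Psi z 0 ord_max) => a b /=; ring.
Qed.

Lemma zrow_zu_point (z : Cn) : zrow (zu_point z) = z_part z.
Proof. by apply/rowP => j; rewrite !mxE; case: (z _ _). Qed.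

Lemma zu_point_lift_pt K (p : zu) : zu_point (lift_pt K p) = p.
Proof.
have E (j : 'I_n) : z_part (lift_pt K p) 0 j = p.1.1 0 j +i* p.1.2 0 j.
  rewrite mxE lift_ptE; have -> : widen_ord (leqnSn n) j = lift ord_max j.
    by apply: val_inj; rewrite /= /bump leqNgt ltn_ord.
  by rewrite liftK.
case: p E => [[x y] u] E; congr (_, _, _).
- by apply/rowP => j; rewrite mxE E.
- by apply/rowP => j; rewrite mxE E.
- by rewrite lift_ptE unlift_none.
Qed.

(** The graphing function is K = Re P + h. Along good words and along u both P and h have zero
    derivatives, so the section on graphs gives the conditions on Z and the F_j. *)
Lemma normal_form_adapted N (f : 'I_N -> Cn -> C) Phi Psi L (P : zzbar_poly R n) (h : zu -> R^o) :
  inverse_charts Phi Psi -> (forall j, holomorphic0 (f j)) -> (forall j, f j 0 = 0) ->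
  (forall j, 0 <= tnth L j <= 1) -> weighted_homogeneous L 1 P -> no_pluriharmonic_terms P ->
  (forall z, eval_zzbar P z \is Num.real) -> o_weighted L h ->
  (\forall p \near (0 : Cn), hypersurface f p <-> complex.Im (Phi p 0 ord_max) =
     complex.Re (eval_zzbar P (z_part (Phi p))) + h (zu_point (Phi p))) ->
  adapted f Psi L.
Proof.
move=> charts hf f0 L01 wP pP rP [sh oh] graph.
have L0 j : 0 <= tnth L j by have /andP[] := L01 j.
have [_ [hPsi Psi0] _ PhiPsi] := charts.
have dPsi : differentiable Psi 0 := nbhs_singleton hPsi.
pose W z : Prop := (hypersurface f (Psi z) <-> complex.Im (Phi (Psi z) 0 ord_max) =
  complex.Re (eval_zzbar P (z_part (Phi (Psi z)))) + h (zu_point (Phi (Psi z)))) /\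
  Phi (Psi z) = z.
have near1 : \forall z \near (0 : Cn), W z by exact: filterI (near_fixed dPsi Psi0 graph) PhiPsi.
have [Om [oO O0 hZ hF HO]] := chart_neighborhood hPsi Psi0 hf near1.
pose K p : R^o := complex.Re (evalp P p) + h p.
have [U1 [oU1 U10 sh1]] := near_open sh.
have sh1' : smooth_on U1 h by move=> vs p Up; exact: sh1.
have sK1 : smooth_on U1 K := smooth_onD oU1 (@smooth_Re_evalp P U1) sh1'.
have h0 : h 0 = 0.
  have := oh [::]; rewrite big_nil ler01 => /(_ isT) /=.
  by move=> /(congr1 (@complex.Re R)).
have K0 : K 0 = 0.
  rewrite /K h0 addr0 -[evalp P 0]/(wword [::] (evalp P) 0) (normal_form_jets wP pP _ L0)//.
  by rewrite /good wt_nil ltr01.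
have near2 : \forall p \near (0 : zu), U1 p /\ Om (lift_pt K p).
  exact: filterI (open_nbhs_nbhs (conj oU1 U10)) (lift_pt_near (smooth_on_diff sK1 U10) K0 oO O0).
have [U [oU U0 HU]] := near_open near2.
have sK : smooth_on U K by apply: smooth_on_sub sK1 => p /HU[].
have UO p : U p -> Om (lift_pt K p) by move=> /HU[].
have graphE p : U p -> complex.Re (chart_Z Psi (lift_pt K p)) +
    \sum_(j < N) normc (chart_F f Psi j (lift_pt K p)) ^+ 2 = 0.
  move=> /UO/HO[g1 g2]; apply/hypersurface_charts/g1; rewrite g2 zu_point_lift_pt.
  rewrite -zrow_zu_point zu_point_lift_pt lift_ptE unlift_none.
  by [].
have kill' s : wt L s <= 1 -> wword s (evalp P) 0 = 0 -> wword s (fun p => (K p)%:C) 0 = 0.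
  move=> ws wP0.
  have E p : U p -> (K p)%:C = evalp P p + (h p)%:C.
    by move=> _; rewrite -(Re_evalp p rP); exact: (rmorphD (real_complex R)).
  rewrite (wword_eq oU s E U0) (wwordD oU s _ _ U0); last 2 first.
  - exact: (csmooth_eq oU (fun p _ => erefl) (conj (@smooth_Re_evalp P U) (smooth_on_sub (@subsetT _ _) (csmooth_evalp P).2))).
  - have sU : U `<=` U1 by move=> p /HU[].
    exact: (csmooth_real oU (smooth_on_sub sU sh1')).
  by rewrite wP0 add0r; apply: oh.
have kill s : good L s -> wword s (fun p => (K p)%:C) 0 = 0.
  move=> gs; apply: kill'; last by apply: (normal_form_jets wP pP _ L0); rewrite gs.
  by case/orP: gs => [/ltW|/andP[]].
have kill_u : wword [:: @Var_u n] (fun p => (K p)%:C) 0 = 0.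
  apply: kill'; first by rewrite /wt big_seq1.
  by apply: (normal_form_jets wP pP _ L0); rewrite inE eqxx orbT.
have Z0 : chart_Z Psi 0 = 0 by rewrite /chart_Z Psi0 mxE mulr0.
have F0 j : chart_F f Psi j 0 = 0 by rewrite /chart_F Psi0.
have jZ s : all (@is_z n) s -> wt L s <= 1 -> hword s (chart_Z Psi) 0 = 0 :> R[i].
  exact: (jets_of_linear_part oO oU UO sK U0 K0 hZ hF Z0 F0 graphE L0 kill).
split.
- exact: (jets_of_squares oO oU UO sK U0 K0 hZ hF F0 graphE L0 kill).
- exact: jZ.
have ReZ := normal_derivative_imaginary oO oU UO sK U0 K0 hZ hF F0 graphE kill_u.
(* As a single z_j has weight at most 1, the differential of Z vanishes in all z directions. *)
have dZ : 'd (chart_Z Psi) 0 (ew R n) != 0.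
  apply: (normal_derivative_neq0 charts) => j.
  have := jZ [:: Var_z j]; rewrite /= /wt big_seq1 /=.
  by have /andP[_ ->] := L01 j; move=> /(_ isT isT).
move: ReZ dZ; case: ('d _ _ _) => a b /= -> b0; exists b => //.
by apply: contra b0 => /eqP ->.
Qed.

End NormalForm.

(** * Invariance of the jet conditions under change of generators *)

Section IdealTransfer.
Variables (R : realType) (n : nat).
Local Notation C := (R[i])^o.
Local Notation Cn := (Cspace R n.+1).
Local Notation zu := (zu_space R n).
Local Notation var := (zu_variable n).
Implicit Types (Psi : Cn -> Cn) (H : Cn -> C) (L : n.-tuplelexi rat) (s t : seq var).

(** On the graph of K = 0, holomorphic derivatives become Wirtinger derivatives, which makes the
    Leibniz rule for the latter available for [hword]. *)
Lemma wword_flat (U : set zu) (Om : set Cn) s H : open Om -> open U ->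
  (forall p, U p -> Om (lift_pt (fun=> 0) p)) -> U 0 -> hol_on Om H ->
  all (@is_z n) s -> wword s (fun p => H (lift_pt (fun=> 0) p)) 0 = hword s H 0.
Proof.
move=> oO oU UO U0 hH zs; pose K (p : zu) : R^o := 0.
have nu t : subseq t s -> t != [::] -> t != [:: @Var_u n].
  move=> ts _; apply: contraTneq ts => ->; rewrite sub1seq.
  by apply/negP => /(allP zs).
have k0 t : t != [::] -> wword t (fun p => (K p)%:C) 0 = 0.
  by move=> t0; exact: (wword_cst openT 0 (I : [set: zu] 0) t0).
have [->|s0] := eqVneq s [::].
  by rewrite /= -[X in H X]/(lift_pt K 0) lift_pt0.
rewrite (@wword_comp_kill _ _ K Om U oO oU UO (cst_smooth 0 oU) U0 erefl s H hH).
- by rewrite (k0 s s0) !mulr0 mul0r addr0.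
- exact: nu (subseq_refl s) s0.
- exact: nu.
- by move=> t _ t0 _; exact: k0.
Qed.

(** Write g_j as a combination of the f_k. In the Leibniz expansion f_k is differentiated along a
    subword, of weight again below 1/2, so every term vanishes at 0. The conditions on Z do not
    involve the generators. *)
Lemma adapted_ideal N S (f : 'I_N -> Cn -> C) (g : 'I_S -> Cn -> C) Psi L :
  holomorphic0 Psi -> Psi 0 = 0 -> (forall j, holomorphic0 (f j)) ->
  (forall j, holomorphic0 (g j)) -> (forall j, germ_ideal f (g j)) ->
  (forall j, 0 <= tnth L j) -> adapted f Psi L -> adapted g Psi L.
Proof.
move=> hPsi Psi0 hf hg gf L0 [jF jZ dZ]; split => // j s zs ws.
have dPsi : differentiable Psi 0 := nbhs_singleton hPsi.
have [a [ha ga]] := gf j.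
have near1 : \forall z \near (0 : Cn), g j (Psi z) = \sum_(k < N) a k (Psi z) * f k (Psi z).
  exact: (near_fixed dPsi Psi0 ga).
have [Om1 [oO1 O10 _ hF HO1]] := chart_neighborhood hPsi Psi0 hf near1.
have [Om2 [oO2 O20 _ hG HO2]] := chart_neighborhood hPsi Psi0 hg (open_nbhs_nbhs (conj oO1 O10)).
have [Om [oO O0 _ hA HO]] := chart_neighborhood hPsi Psi0 ha (open_nbhs_nbhs (conj oO2 O20)).
pose l (p : zu) : Cn := lift_pt (fun=> 0) p.
have d0 : differentiable (fun _ : zu => 0 : R^o) 0 by exact: differentiable_cst.
have [U [oU U0 UO]] := near_open (lift_pt_near d0 erefl oO O0).
have hF' k : hol_on Om (chart_F f Psi k) by move=> z /HO/HO2; exact: hF.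
have hG' : hol_on Om (chart_F g Psi j) by move=> z /HO; exact: hG.
have cs H : hol_on Om H -> csmooth U (fun p => H (l p)).
  exact: (csmooth_comp oO oU UO (cst_smooth 0 oU)).
rewrite -(wword_flat oO oU UO U0 hG' zs).
have E p : U p -> chart_F g Psi j (l p) =
    \sum_(k < N) chart_F a Psi k (l p) * chart_F f Psi k (l p).
  by move=> /UO/HO/HO2/HO1.
rewrite (wword_eq oU s E U0).
have sAF k : csmooth U (fun p => chart_F a Psi k (l p) * chart_F f Psi k (l p)).
  by apply: csmoothM => //; exact: cs.
rewrite (wword_sum oU (index_enum 'I_N) s sAF U0) big1// => k _.
rewrite (wword_leibniz oU s (cs _ (hA k)) (cs _ (hF' k)) U0) big_seq_cond big1// => x /andP[xs _].
have [_ x2 _] := splits_subseq xs.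
have zx : all (@is_z n) x.2 by apply/allP => b /(mem_subseq x2); exact: (allP zs).
rewrite (wword_flat oO oU UO U0 (hF' k) zx) jF ?mulr0//.
by apply: le_lt_trans ws; rewrite lerD// wt_subseq.
Qed.

End IdealTransfer.

(** * Weights with a zero entry *)


Section ZeroWeight.
Variables (R : realType) (n : nat) (i : 'I_n).
Local Notation C := (R[i])^o.
Local Notation Cn := (Cspace R n.+1).
Local Notation V := (R^o * R^o)%type.
Local Notation normc := Normc.normc.
Local Notation axis := (hvec R (Var_z i)).
Implicit Types (Psi : Cn -> Cn) (H : Cn -> C) (p v : V) (k l : V -> R^o).

Definition axis_pt (p : V) : Cn := (p.1 +i* p.2) *: axis.

Lemma axis_pt_coord j p :
  (differentiable (fun q : V => complex.Re (axis_pt q 0 j) : R^o) p /\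
   forall v, 'D_v (fun q : V => complex.Re (axis_pt q 0 j) : R^o) p = complex.Re (axis_pt v 0 j)) /\
  (differentiable (fun q : V => complex.Im (axis_pt q 0 j) : R^o) p /\
   forall v, 'D_v (fun q : V => complex.Im (axis_pt q 0 j) : R^o) p = complex.Im (axis_pt v 0 j)).
Proof.
have E v : axis_pt v 0 j = (v.1 * (j == lift ord_max i)%:R) +i* (v.2 * (j == lift ord_max i)%:R).
  rewrite /axis_pt !mxE eqxx /=; case: (j == _); rewrite ?mulr0 ?mulr1; last by [].
  by [].
have ReE : (fun q : V => complex.Re (axis_pt q 0 j)) = (fun q => q.1 * (j == lift ord_max i)%:R).
  by apply/funext => q; rewrite E.
have ImE : (fun q : V => complex.Im (axis_pt q 0 j)) = (fun q => q.2 * (j == lift ord_max i)%:R).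
  by apply/funext => q; rewrite E.
have bnd (x : R) (b : bool) y : `|x| <= y -> `|x * b%:R| <= 1 * y.
  by move=> xy; rewrite mul1r; case: b; rewrite ?mulr1 ?mulr0 ?normr0// (le_trans _ xy).
split; rewrite ?ReE ?ImE.
  have [|v|d D] := @bounded_linear_diff R V (fun q : V => q.1 * (j == lift ord_max i)%:R) p 1.
  - by move=> a u v; rewrite /= mulrDl -mulrA.
  - by apply: bnd; exact: norm_fst.
  - by split => // v; rewrite D E.
have [|v|d D] := @bounded_linear_diff R V (fun q : V => q.2 * (j == lift ord_max i)%:R) p 1.
- by move=> a u v; rewrite /= mulrDl -mulrA.
- by apply: bnd; exact: norm_snd.
- by split => // v; rewrite D E.
Qed.

Variables (Om : set Cn) (U : set V).
Hypothesis oO : open Om.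
Hypothesis oU : open U.
Hypothesis UO : forall p, U p -> Om (axis_pt p).
Hypothesis U0 : U 0.

Lemma axis_chain H (c : R[i]) p : hol_on Om H -> U p ->
  differentiable (fun q => complex.Re (c * H (axis_pt q)) : R^o) p /\
  forall v, 'D_v (fun q => complex.Re (c * H (axis_pt q)) : R^o) p =
    complex.Re (c * (v.1 +i* v.2) * hderiv (Var_z i) H (axis_pt p)).
Proof.
move=> hH Up; have dH := hH _ (UO Up).
have [dcH _] := diffZ_at c 0 dH.
have [d D] := mixed_chain (fun j => (axis_pt_coord j p).1.1) (fun j => (axis_pt_coord j p).2.1) dcH.
split=> [|v]; first exact: d.
apply: (etrans (D v)); congr complex.Re.
have -> : (\row_j ('D_v (fun q : V => complex.Re (axis_pt q 0 j) : R^o) p +i*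
    'D_v (fun q : V => complex.Im (axis_pt q 0 j) : R^o) p) : Cn) = axis_pt v.
  apply/rowP => j; rewrite [LHS]mxE (axis_pt_coord j p).1.2 (axis_pt_coord j p).2.2.
  by case: (axis_pt v 0 j).
apply: (etrans (diffZ_at c (axis_pt v) dH).2); rewrite -mulrA; congr (c * _).
exact: linearZ.
Qed.

Definition flat H := hol_on Om H /\ forall m, hword (nseq m (Var_z i)) H 0 = 0 :> R[i].

Lemma flat_hderiv H : flat H -> flat (hderiv (Var_z i) H).
Proof.
move=> [hH jH]; split; first exact: hol_on_hderiv.
have E m : hword (nseq m (Var_z i)) (hderiv (Var_z i) H) = hword (nseq m.+1 (Var_z i)) H.
  by elim: m => [|m IH]; [|exact: (congr1 (hderiv (Var_z i)) IH)].
by move=> m; rewrite E; exact: jH.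
Qed.

(** Closed under differentiation on U, and every member vanishes at 0; hence every member vanishes
    there to infinite order. *)
Inductive flat_function : (V -> R^o) -> Prop :=
| flat_zero : flat_function (cst 0)
| flat_Re c H : flat H -> flat_function (fun p => complex.Re (c * H (axis_pt p)))
| flat_add k l : flat_function k -> flat_function l -> flat_function (k + l)
| flat_mul k l : flat_function k -> flat_function l -> flat_function (k * l).

Lemma flat_function_diff k p : flat_function k -> U p -> differentiable k p.
Proof.
move=> fk Up; elim: fk => [|c H [hH _]|k1 k2 _ d1 _ d2|k1 k2 _ d1 _ d2].
- exact: differentiable_cst.
- exact: (axis_chain c hH Up).1.
- exact: differentiableD.
- exact: differentiableM.
Qed.

Lemma flat_function_derive k v : flat_function k ->
  exists2 k', flat_function k' & forall p, U p -> 'D_v k p = k' p.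
Proof.
elim=> [|c H fH|k1 k2 f1 [l1 fl1 D1] f2 [l2 fl2 D2]|k1 k2 f1 [l1 fl1 D1] f2 [l2 fl2 D2]].
- by exists (cst 0); [exact: flat_zero|move=> p _; exact: derive_cst].
- exists (fun p => complex.Re (c * (v.1 +i* v.2) * hderiv (Var_z i) H (axis_pt p))).
    by apply: flat_Re; exact: flat_hderiv.
  by move=> p Up; exact: (axis_chain c fH.1 Up).2.
- exists (l1 + l2); first exact: flat_add.
  move=> p Up; rewrite deriveD; last 2 first.
  + by apply: diff_derivable; exact: flat_function_diff.
  + by apply: diff_derivable; exact: flat_function_diff.
  by rewrite D1// D2.
- exists (k1 * l2 + k2 * l1); first by apply: flat_add; exact: flat_mul.
  move=> p Up; rewrite deriveM; last 2 first.
  + by apply: diff_derivable; exact: flat_function_diff.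
  + by apply: diff_derivable; exact: flat_function_diff.
  by rewrite D1// D2.
Qed.

Lemma flat_function0 k : flat_function k -> k 0 = 0.
Proof.
elim=> [//|c H [_ jH]|k1 k2 _ E1 _ E2|k1 k2 _ E1 _ E2].
- have -> : axis_pt 0 = 0 by rewrite /axis_pt scale0r.
  by rewrite -[H 0]/(hword (nseq 0 (Var_z i)) H 0) jH mulr0.
- by rewrite fctE E1 E2 addr0.
- by rewrite fctE E1 mul0r.
Qed.

Lemma flat_function_iterD k vs : flat_function k -> Defs.iterD vs k 0 = 0.
Proof.
move=> /(iterD_coinduction oU (fun k fk v => flat_function_derive v fk) vs)[k' fk' ->//].
exact: flat_function0.
Qed.

Lemma flat_defining_function N (f : 'I_N -> Cn -> C) Psi :
  flat (chart_Z Psi) -> (forall j, flat (chart_F f Psi j)) ->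
  flat_function (pullback (defining_function f) (fun t => Psi (t *: axis))).
Proof.
move=> fZ fF.
have -> : pullback (defining_function f) (fun t => Psi (t *: axis)) =
  (fun p => complex.Re (1 * chart_Z Psi (axis_pt p))) +
  \sum_(j < N) ((fun p => complex.Re (1 * chart_F f Psi j (axis_pt p))) *
                (fun p => complex.Re (1 * chart_F f Psi j (axis_pt p))) +
                (fun p => complex.Re (- 'i%C * chart_F f Psi j (axis_pt p))) *
                (fun p => complex.Re (- 'i%C * chart_F f Psi j (axis_pt p)))) :> (V -> R^o).
  apply/funext => p; rewrite fctE fct_sumE /pullback /defining_function mul1r; congr (_ + _).
    by rewrite /chart_Z; case: (Psi _ 0 ord_max) => a b /=; ring.
  apply: eq_bigr => j _; rewrite !fctE /chart_F /axis_pt.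
  case: (f j _) => a b /=; rewrite sqr_sqrtr ?addr_ge0 ?sqr_ge0//; ring.
apply: flat_add; first exact: flat_Re.
elim/big_ind: _ => [|//|j _]; [exact: flat_zero|exact: flat_add|].
by apply: flat_add; apply: flat_mul; exact: flat_Re.
Qed.

End ZeroWeight.

Section InfiniteType.
Variables (R : realType) (n : nat).
Local Notation C := (R[i])^o.
Local Notation Cn := (Cspace R n.+1).
Local Notation normc := Normc.normc.

Lemma axis_pt_near (i : 'I_n) (Om : set Cn) : open Om -> Om 0 ->
  \forall p \near (0 : R^o * R^o), Om (axis_pt i p).
Proof.
move=> oO O0; have /nbhs_cnormP[r r0 Hr] := open_nbhs_nbhs (conj oO O0).
pose b := cnorm (hvec R (Var_z i)) + 1; have b0 : 0 < b by rewrite ltr_wpDl// cnorm_ge0.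
apply/nbhs_ballP; exists (r / (2 * b)); first by rewrite /= divr_gt0// mulr_gt0.
move=> p; rewrite -ball_normE/= -[(0, 0) - p]/(0 - p) sub0r normrN ltr_pdivlMr ?mulr_gt0// => pr.
apply: Hr; rewrite subr0; apply: le_lt_trans pr; rewrite /axis_pt cnormZ mulrA.
apply: ler_pM; [exact: normc_ge0|exact: cnorm_ge0| |by rewrite lerDl].
apply: le_trans (normc_le_add _ _) _; rewrite mulr_natr mulr2n.
by apply: lerD; [exact: norm_fst|exact: norm_snd].
Qed.

(** The differential of Psi at 0 is injective, so the image of a coordinate axis has nonzero
    velocity at 0 and order exactly 1. *)
Lemma chart_axis_curve Phi Psi (i : 'I_n) : inverse_charts Phi Psi ->
  let phi := fun t : C => Psi (t *: hvec R (Var_z i)) in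
  curve_germ phi /\ vanishing_order R phi 0 = 1%:E.
Proof.
move=> [[hPhi Phi0] [hPsi Psi0] PsiPhi PhiPsi] phi; set e := hvec R (Var_z i).
have dPhi : differentiable Phi 0 := nbhs_singleton hPhi.
have dPsi : differentiable Psi 0 := nbhs_singleton hPsi.
pose l (t : C) : Cn := t *: e.
have l0 : l 0 = 0 by rewrite /l scale0r.
have dl t : differentiable l t := (diff_scalev e t).1.
have phi0 : phi 0 = 0 by rewrite /phi scale0r.
have D1 : 'D_1 phi 0 != 0.
  have dPsi' : differentiable Psi (l 0) by rewrite l0.
  have dphi : differentiable phi 0 := differentiable_comp (dl 0) dPsi'.
  have -> : 'D_1 phi 0 = 'd Psi 0 e.
    apply: (etrans (deriveE (1 : C) dphi)).
    apply: (etrans (congr1 (fun F : C -> Cn => F (1 : C)) (diff_comp (dl 0) dPsi'))).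
    by rewrite /= (diff_scalev e 0).2 l0.
  apply/eqP => E.
  have e0 : e = 0 := etrans (esym (diff_local_id e dPsi Psi0 dPhi PhiPsi))
    (etrans (congr1 ('d Phi 0) E) (linear0 _)).
  move: (congr1 (fun w : Cn => w 0 (lift ord_max i)) e0); rewrite !mxE !eqxx /=.
  by move/eqP; rewrite oner_eq0.
split; first split.
- by apply: filterS (near_fixed (dl 0) l0 hPsi) => t dt; exact: (differentiable_comp (dl t) dt).
- exact: phi0.
- move=> E; move/eqP: D1; apply; apply: (etrans (@near_eq_derive _ _ _ phi (cst 0) 0 1 E)).
  exact: derive_cst.
apply/eqP; rewrite eq_le; apply/andP; split.
  by apply: ereal_inf_lbound; exists [:: 1].
apply: le_ereal_inf_tmp => _ [vs vs0 <-]; rewrite lee_fin ler1n lt0n.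
by apply: contra vs0 => /nilP -> /=; exact/eqP.
Qed.

(** If the weight of z_i is 0, all words in z_i have weight 0, so Z and the F_j are flat along the
    z_i axis. The image of this axis is a curve of order 1 on which the defining function vanishes
    to infinite order, and the type is infinite. *)
Lemma adapted_weight_gt0 N (f : 'I_N -> Cn -> C) Phi Psi (L : n.-tuplelexi rat) :
  inverse_charts Phi Psi -> (forall j, holomorphic0 (f j)) ->
  (forall j, 0 <= tnth L j) -> adapted f Psi L ->
  (dangelo_type (defining_function f) < +oo)%E -> forall i, 0 < tnth L i.
Proof.
move=> charts hf L0 [jF jZ _] ft i; rewrite lt_neqAle L0 andbT; apply/eqP => /esym Li.
have [_ [hPsi Psi0] _ _] := charts.
have [Om [oO O0 hZ hF _]] := chart_neighborhood hPsi Psi0 hf (filterT : \forall z \near (0 : Cn), True).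
have [U [oU U0 UO]] := near_open (axis_pt_near i oO O0).
have zs m : all (@is_z n) (nseq m (Var_z i)) by apply/allP => a /nseqP[->].
have ws m : wt L (nseq m (Var_z i)) = 0.
  by rewrite /wt big1_seq// => a /andP[_ /nseqP[-> _]].
have fZ : flat i Om (chart_Z Psi) by split => // m; apply: jZ; rewrite ?ws.
have fF j : flat i Om (chart_F f Psi j) by split => // m; apply: jF; rewrite ?ws ?addr0.
have ff := flat_defining_function fZ fF.
have [cg vo] := chart_axis_curve i charts.
move: ft; rewrite ltNge => /negP; apply.
apply: ereal_sup_ubound; exists (fun t : C => Psi (t *: hvec R (Var_z i))) => //.
rewrite vo; have -> : vanishing_order R (pullback (defining_function f)
    (fun t : C => Psi (t *: hvec R (Var_z i)))) 0 = +oo%E.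
  (* The order is the infimum of an empty set. *)
  rewrite /vanishing_order -[RHS](@ereal_inf0 R); congr ereal_inf.
  apply/seteqP; split => [x [vs vs0 _]|x []//]; case/negP: vs0; apply/eqP.
  exact: (flat_function_iterD oO oU UO U0 vs ff).
by rewrite inve1 mule1.
Qed.

End InfiniteType.

(** * Equality of the sets of distinguished weights *)

Section DistinguishedWeights.
Variables (R : realType) (n : nat).
Local Notation C := (R[i])^o.
Local Notation Cn := (Cspace R n.+1).
Local Notation zu := (zu_space R n).
Local Notation normc := Normc.normc.
Implicit Types (Phi Psi : Cn -> Cn) (L : n.-tuplelexi rat).

Lemma local_coordinatesP Phi : local_coordinates Phi <-> exists Psi, inverse_charts Phi Psi.
Proof. by split=> [[h1 h2 [Psi [h3 h4 h5 h6]]]|[Psi [[h1 h2] [h3 h4] h5 h6]]]; [exists Psi|split => //; exists Psi]. Qed.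

Lemma sum_sqr_Re N (F : 'I_N -> R[i]) :
  \sum_(k : 'I_N * bool) complex.Re ((if k.2 then 1 else - 'i%C) * F k.1) ^+ 2 =
  \sum_j normc (F j) ^+ 2.
Proof.
rewrite -(pair_bigA _ (fun j b => complex.Re ((if b then 1 else - 'i%C) * F j) ^+ 2)) /=.
apply: eq_bigr => j _; rewrite big_bool /=; case: (F j) => a b /=.
by rewrite sqr_sqrtr ?addr_ge0 ?sqr_ge0//; ring.
Qed.

(** The same chart serves. In it the hypersurface is the graph of some Q, whose jets along good
    words and along u vanish; P is the part of weight 1 of the Taylor expansion of Q, and h the
    rest. *)
Lemma adapted_distinguished N (f : 'I_N -> Cn -> C) Phi Psi L :
  inverse_charts Phi Psi -> (forall j, holomorphic0 (f j)) -> (forall j, f j 0 = 0) ->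
  is_weight L -> (forall j, 0 < tnth L j) -> adapted f Psi L ->
  distinguished (hypersurface f) L.
Proof.
move=> charts hf f0 wL Lpos [jF jZ [lam lam0 dZ]]; split => //.
have L0 j : 0 <= tnth L j by exact: ltW.
have [[hPhi Phi0] [hPsi Psi0] PsiPhi _] := charts.
have dPhi : differentiable Phi 0 := nbhs_singleton hPhi.
have [Om [oO O0 hZ hF _]] := chart_neighborhood hPsi Psi0 hf (filterT : \forall z \near (0 : Cn), True).
have Z0 : chart_Z Psi 0 = 0 by rewrite /chart_Z Psi0 mxE mulr0.
have F0 j : chart_F f Psi j 0 = 0 by rewrite /chart_F Psi0.
pose H (k : 'I_N * bool) z : C := (if k.2 then 1 else - 'i%C) * chart_F f Psi k.1 z.
have hH k : hol_on Om (H k) by exact: hol_on_scale.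
have H0 k : H k 0 = 0 by rewrite /H F0 mulr0.
have [U [Q [[oU U0] Q0 [sQ UO] rhoQ graphQ]]] := hypersurface_graph oO O0 hZ hH Z0 H0 dZ lam0.
have rhoE z : rho (chart_Z Psi) H z =
    complex.Re (chart_Z Psi z) + \sum_(j < N) normc (chart_F f Psi j z) ^+ 2.
  by congr (_ + _); exact: (sum_sqr_Re (fun j => chart_F f Psi j z)).
have graphE p : U p -> complex.Re (chart_Z Psi (lift_pt Q p)) +
    \sum_(j < N) normc (chart_F f Psi j (lift_pt Q p)) ^+ 2 = 0.
  by move=> Up; rewrite -rhoE; exact: rhoQ.
have kill := graph_jets oO oU UO sQ U0 Q0 hZ hF F0 graphE L0 jF jZ dZ lam0.
have kill_u := graph_jet_u oO oU UO sQ U0 Q0 hZ hF F0 graphE dZ lam0.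
have [P [wP pP rP jets]] := weighted_taylor Lpos oU sQ U0 kill kill_u.
pose h p : R^o := Q p - complex.Re (evalp P p).
exists Phi, P, h; split => //.
- by apply/local_coordinatesP; exists Psi.
- have sh : smooth_on U h.
    have := smooth_onD oU sQ (smooth_onZ (-1) oU (@smooth_Re_evalp R n P U)).
    by apply: (eq_smooth_on oU) => p _; rewrite fctE mulN1r.
  split.
    by apply: (open_near oU _ U0) => p Up vs; exact: sh.
  move=> s ws.
  have E p : U p -> (h p)%:C = (Q p)%:C + -1 * evalp P p.
    by move=> _; rewrite mulN1r -(Re_evalp p rP); exact: (rmorphB (real_complex R)).
  have sQc := csmooth_real oU sQ.
  have sP : csmooth U (evalp P).
    exact: (conj (@smooth_Re_evalp R n P U) (smooth_on_sub (@subsetT _ _) (csmooth_evalp P).2)).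
  rewrite -[LHS]/(wword s (fun p => (h p)%:C) 0) (wword_eq oU s E U0).
  rewrite (wwordD oU s sQc (csmoothM oU (csmooth_cst oU (-1)) sP) U0).
  by rewrite (wwordZ oU s (-1) sP U0) (jets s ws) mulN1r subrr.
have near1 := near_fixed dPhi Phi0 graphQ.
apply: filterS (filterI PsiPhi near1) => p [Ep].
have Eh q : complex.Re (eval_zzbar P (zrow q)) + h q = Q q by rewrite /h addrC subrK.
rewrite rhoE -zrow_zu_point Eh => G.
by have := iff_trans (hypersurface_charts f Psi (Phi p)) G; rewrite Ep.
Qed.

(** Pass from a normal form for one system to [adapted], transfer along the ideal, and return to a
    normal form for the other. *)
Lemma distinguished_transfer N S (f : 'I_N -> Cn -> C) (g : 'I_S -> Cn -> C) :
  (forall j, holomorphic0 (f j)) -> (forall j, holomorphic0 (g j)) ->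
  (forall j, f j 0 = 0) -> (forall j, g j 0 = 0) ->
  (forall j, germ_ideal f (g j)) -> (forall j, germ_ideal g (f j)) ->
  (dangelo_type (defining_function f) < +oo)%E ->
  distinguished (hypersurface f) = distinguished (hypersurface g).
Proof.
move=> hf hg f0 g0 gf fg ft.
have weight01 L : is_weight L -> forall j, 0 <= tnth L j <= 1.
  move=> [w _ _] j; have /andP[-> /le_trans] := w j; apply.
  by rewrite invf_le1// ler1n.
have extract M (k : 'I_M -> Cn -> C) L : (forall j, holomorphic0 (k j)) -> (forall j, k j 0 = 0) ->
    distinguished (hypersurface k) L ->
    is_weight L /\ exists Phi Psi, inverse_charts Phi Psi /\ adapted k Psi L.
  move=> hk k0 [wL [Phi [P [h [/local_coordinatesP[Psi charts] [wP pP] rP oh graph]]]]].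
  split => //; exists Phi, Psi; split => //.
  exact: (normal_form_adapted charts hk k0 (weight01 L wL) wP pP rP oh graph).
apply/seteqP; split => L /extract.
  move=> /(_ hf f0)[wL [Phi [Psi [charts af]]]].
  have L0 j : 0 <= tnth L j by have /andP[] := weight01 L wL j.
  have Lpos := adapted_weight_gt0 charts hf L0 af ft.
  have [_ [hPsi Psi0] _ _] := charts.
  exact: (adapted_distinguished charts hg g0 wL Lpos (adapted_ideal hPsi Psi0 hf hg gf L0 af)).
move=> /(_ hg g0)[wL [Phi [Psi [charts ag]]]].
have L0 j : 0 <= tnth L j by have /andP[] := weight01 L wL j.
have [_ [hPsi Psi0] _ _] := charts.
(* Finite type is assumed for f, so the positivity of L is obtained after the transfer to f. *)
have af := adapted_ideal hPsi Psi0 hg hf fg L0 ag.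
exact: (adapted_distinguished charts hf f0 wL (adapted_weight_gt0 charts hf L0 af ft) af).
Qed.

Lemma germ_ideal_generator N (f : 'I_N -> Cn -> C) j : germ_ideal f (f j).
Proof.
exists (fun k => cst (k == j)%:R); split=> [k|].
  by apply/nbhs_cnormP; exists 1 => // z _; exact: differentiable_cst.
apply/nbhs_cnormP; exists 1 => // z _; rewrite (bigD1 j)//= eqxx mul1r big1 ?addr0// => k /negPf ->.
by rewrite mul0r.
Qed.

End DistinguishedWeights.

Theorem theorem1p2 (R : realType) (n N S : nat)
    (f : 'I_N -> Cspace R n.+1 -> R[i]^o)
    (g : 'I_S -> Cspace R n.+1 -> R[i]^o)
    (hol_f : forall j, holomorphic0 (f j))
    (M0 : hypersurface f 0)
    (finite_type : (dangelo_type (defining_function f) < +oo)%E)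
    (hol_g : forall j, holomorphic0 (g j))
    (same_ideal : germ_ideal g = germ_ideal f) :
  exists m : n.-tuple (\bar rat),
    is_multitype (hypersurface f) m /\ is_multitype (hypersurface g) m.
Proof.
(* At the origin the defining function is the sum of the |f_j(0)|^2, which vanishes since 0 lies on
   M. *)
have f0 j : f j 0 = 0.
  move: M0; rewrite /hypersurface /defining_function /= mxE mulr0 add0r => /eqP.
  rewrite psumr_eq0 => [/allP/(_ j (mem_index_enum j))|k _]; last exact: sqr_ge0.
  by rewrite /= sqrf_eq0 normc_eq0 => /eqP.
have gf j : germ_ideal f (g j) by rewrite -same_ideal; exact: germ_ideal_generator.
have fg j : germ_ideal g (f j) by rewrite same_ideal; exact: germ_ideal_generator.
have g0 j : g j 0 = 0.
  have [a [_ /nbhs_singleton ->]] := gf j.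
  by rewrite big1// => k _; rewrite f0 mulr0.
have E := distinguished_transfer hol_f hol_g f0 g0 gf fg finite_type.
have [L glb] := @exists_glb_weight n (distinguished (hypersurface f)) (fun L => @proj1 _ _).
exists (multitype_of_weight L); split; exists L; split => //.
by rewrite -E.
Qed.
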